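(* Assume $Q,q\in C^\infty(N)$. Let $i,j,k$ be distinct, let $\hat v^{(i)},\hat v^{(j)},\hat v^{(k)}$ be formal Gaussian beams of degree $K$ along distinct lightlike geodesics through $p_0$, let $\hat w^{(ij)},\hat w^{(ik)},\hat w^{(jk)}$ be the associated formal interaction solutions near $p_0$ (see context), let $\Phi:=\Phi^{(i)}+\Phi^{(j)}+\Phi^{(k)}$, and let \[ F=q\big(\hat v^{(i)}\hat w^{(jk)}+\hat v^{(j)}\hat w^{(ik)}+\hat v^{(k)}\hat w^{(ij)}\big)=e^{i\Phi/h}\sum_{m=2}^{3K+2}q\,\beta_mh^m , \] which defines $\beta_m\in C_0^\infty(N_0)$. Assume that $\langle\nabla\Phi,\nabla\Phi\rangle_g\ne0$ in the neighbourhood $N_0$ of $p_0$. Then there exists a solution $\hat\omega\in C^\infty(M_T)$ of \[ (\square_g+Q)\hat\omega=F+\hat r\quad\text{in } M_T \] which can be written in the form \[ \hat\omega=e^{i\Phi/h}\sum_{l=4}^{3K+4}\theta_lh^l\quad\text{in } M_T, \] where the $\theta_l\in C_0^\infty(N_0)$ are given recursively by $\theta_2=\theta_3=0$ and \[ \theta_l=\frac{q\,\beta_{l-2}-(\square_g+Q)\theta_{l-2}-i(\square_g\Phi)\theta_{l-1}+2i\langle\nabla\Phi,\nabla\theta_{l-1}\rangle_g}{\langle\nabla\Phi,\nabla\Phi\rangle_g},\quad l=4,\dots,3K+4, \] and where the error term $\hat r\in C_0^\infty(N_0)$ satisfies \[ \|\hat r\|_{H^\kappa(M_T)}\le C\,h^{3K-\kappa+1}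 \] (here $\kappa$ denotes the Sobolev order).
   Context: $(N,g)$ is a globally hyperbolic Lorentzian manifold of dimension $n+1$, signature $(-,+,\dots,+)$, identified with $\mathbb R\times M$; $M_T=[0,T]\times M$; $\square_gu=-|g|^{-1/2}\partial_a(|g|^{1/2}g^{ab}\partial_bu)$. $h\in(0,1)$ is the asymptotic parameter and $C$ is independent of $h$. Fermi coordinates along a lightlike geodesic $\gamma$ are coordinates $z=(s,z')=(s,z^1,\dots,z^n)\in I\times B_{\delta'}$ ($I$ an interval, $B_{\delta'}$ the ball of radius $\delta'$ about $0$ in $\mathbb R^n$) near $\gamma$ in which $\gamma(s)=(s,0)$, $g|_\gamma=2\,ds\otimes dz^1+\sum_{i=2}^n dz^i\otimes dz^i$ and $\partial_ig_{jk}|_\gamma=0$. Formal Gaussian beam of degree $K$ along $\gamma$ (for $\square_g+Q$): $\hat v=e^{i\Phi/h}a$ with $\Phi\in C^\infty(N)$, $a\in C_0^\infty(N)$ such that, with $\mathbf H\Phi=\langle\nabla\Phi,\nabla\Phi\rangle_g$ and $\mathbf Ta=2\langle\nabla\Phi,\nabla a\rangle_g-(\square_g\Phi)a$: (1) $\partial_z^\alpha\mathbf H\Phi(s,0)=0$ for $s\in I$, $|\alpha|\le K$; (2) $\operatorname{Im}\Phi|_\gamma=0$ and $\operatorname{Im}\Phi(z)\ge C|z'|^2$ on $I\times B_{\delta'}$; (3) $a=\chi\sum_{j=0}^Ka_jh^j$, $a_j=\sum_{i=0}^Ka_{j,i}$ with $a_{j,i}$ complex-valued homogeneous polynomials in $z^1,\dots,z^n$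 with coefficients depending on $s$, and $\chi$ a nonnegative smooth cut-off equal to $1$ for $|z'|\le\delta'/4$ and $0$ for $|z'|\ge\delta'/2$; (4) $\partial_z^\alpha(\mathbf Ta_0)(s,0)=0$ and $\partial_z^\alpha(-i\mathbf Ta_k+(\square_g+Q)a_{k-1})(s,0)=0$ for $s\in I$, $|\alpha|\le K$, $1\le k\le K$. Write $\hat v^{(m)}=e^{i\Phi^{(m)}/h}\chi_m\sum_{l=0}^Ka^{(m)}_lh^l$. $N_0$ is a small compact neighbourhood of $p_0$. For a pair $(j,k)$, with $\Phi^{(jk)}=\Phi^{(j)}+\Phi^{(k)}$ (assumed to satisfy $\langle\nabla\Phi^{(jk)},\nabla\Phi^{(jk)}\rangle_g\ne0$ on $N_0$) and $b_l=\chi_j\chi_k\chi_B\sum_{m+m'=l}a^{(j)}_ma^{(k)}_{m'}$, $\chi_B$ a smooth cut-off supported in a small ball around $p_0$ contained in $N_0$, the formal interaction solution is $\hat w^{(jk)}=e^{i\Phi^{(jk)}/h}\sum_{m=2}^{2K+2}c_mh^m$, where $c_0=c_1=0$ and \[ c_m=\frac{q\,b_{m-2}-(\square_g+Q)c_{m-2}-i(\square_g\Phi^{(jk)})c_{m-1}+2i\langle\nabla\Phi^{(jk)},\nabla c_{m-1}\rangle_g}{\langle\nabla\Phi^{(jk)},\nabla\Phi^{(jk)}\rangle_g}, \] so $c_m\in C_0^\infty(N_0)$ (smooth functions supported in $N_0$). *)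

(* Defs.v *)
From HB Require Import structures.
From mathcomp Require Import all_boot all_order all_algebra.
From mathcomp Require Import complex.
From mathcomp Require Import all_classical all_reals all_analysis.
Set Implicit Arguments.
Unset Strict Implicit.
Unset Printing Implicit Defensive.
Import Order.TTheory GRing.Theory Num.Theory.
Import numFieldNormedType.Exports.
Local Open Scope classical_set_scope.
Local Open Scope ring_scope.

(* Iterated partial derivative d_{i_1} ... d_{i_k} f for l = [:: i_1; ...; i_k]. *)
Fixpoint pd (R : realType) (d : nat) (l : seq 'I_d) (f : 'rV[R]_d -> R)
    : 'rV[R]_d -> R :=
  if l is i :: l' then fun x => 'D_(delta_mx 0 i) (pd l' f) x else f.

(* C^oo on an open set: partial derivatives of all orders exist and are
   Frechet differentiable. *)
Definition smooth_on (R : realType) (d : nat) (U : set 'rV[R]_d)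
    (f : 'rV[R]_d -> R) : Prop :=
  forall (l : seq 'I_d) (x : 'rV[R]_d), U x -> differentiable (pd l f) x.

(* Complex-valued functions are differentiated through their real and
   imaginary parts. *)
Definition cpd (R : realType) (d : nat) (l : seq 'I_d) (f : 'rV[R]_d -> R[i])
    (x : 'rV[R]_d) : R[i] :=
  Complex (pd l (fun y => complex.Re (f y)) x)
          (pd l (fun y => complex.Im (f y)) x).

Definition csmooth_on (R : realType) (d : nat) (U : set 'rV[R]_d)
    (f : 'rV[R]_d -> R[i]) : Prop :=
  smooth_on U (fun x => complex.Re (f x)) /\
  smooth_on U (fun x => complex.Im (f x)).

Definition mindex_seq (d k : nat) (alpha : {ffun 'I_d -> 'I_k.+1}) : seq 'I_d :=
  flatten [seq nseq (alpha i) i | i <- enum 'I_d].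

Definition cexp (R : realType) (z : R[i]) : R[i] :=
  (expR (complex.Re z))%:C%C *
  Complex (cos (complex.Im z)) (sin (complex.Im z)).

(* Lebesgue integral over R^d of a nonnegative function, as an iterated
   integral (Tonelli). *)
Fixpoint iint (R : realType) (d : nat) : ('rV[R]_d -> \bar R) -> \bar R :=
  match d with
  | 0 => fun f => f 0
  | d'.+1 => fun f =>
      (\int[@lebesgue_measure R]_t
         iint (fun y : 'rV[R]_d' => f (row_mx t%:M y : 'rV[R]_(1 + d'))))%E
  end.

(* The values of [cmap] off [cdom], and of [cinv] off [crange], are junk. *)
Record chart (R : realType) (d : nat) (X : Type) := Chart {
  cdom : set X;
  cmap : X -> 'rV[R]_d;
  cinv : 'rV[R]_d -> X }.

Definition crange (R : realType) (d : nat) (X : Type) (c : chart R d X) :=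
  cmap c @` cdom c.

Definition is_chart (R : realType) (d : nat) (X : topologicalType)
    (c : chart R d X) : Prop :=
  [/\ open (cdom c), open (crange c),
      forall p, cdom c p -> cinv c (cmap c p) = p,
      forall p, cdom c p -> {for p, continuous (cmap c)} &
      forall x, crange c x -> {for x, continuous (cinv c)}].

Definition transition (R : realType) (d : nat) (X : Type) (c c' : chart R d X)
    (x : 'rV[R]_d) : 'rV[R]_d := cmap c' (cinv c x).

Definition compatible (R : realType) (d : nat) (X : Type)
    (c c' : chart R d X) : Prop :=
  forall a : 'I_d,
    smooth_on (cmap c @` (cdom c `&` cdom c')) (fun x => transition c c' x 0 a) /\
    smooth_on (cmap c' @` (cdom c `&` cdom c')) (fun x => transition c' c x 0 a).

(* The smooth structure is given by an atlas indexed by the points, the chart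
   with index p being defined at p. *)
Record manifold (R : realType) (n : nat) := Manifold {
  carrier :> topologicalType;
  chart_at : carrier -> chart R n carrier;
  chart_at_is_chart : forall p, is_chart (chart_at p);
  chart_at_dom : forall p, cdom (chart_at p) p;
  chart_at_compatible : forall p q, compatible (chart_at p) (chart_at q);
  manifold_hausdorff : hausdorff_space carrier;
  manifold_second_countable : @second_countable carrier }.

(* N = R x M. *)
Definition spacetime (R : realType) (n : nat) (M : manifold R n)
    : topologicalType := (R * M)%type.

(* Coordinates (t, x) on N, with x the coordinates of [chart_at M p.2]. *)
Definition st_chart (R : realType) (n : nat) (M : manifold R n)
    (p : spacetime M) : chart R n.+1 (spacetime M) :=
  let c := chart_at p.2 in
  @Chart R n.+1 (spacetime M)
    [set q : R * M | cdom c q.2]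
    (fun q : R * M => row_mx q.1%:M (cmap c q.2) : 'rV[R]_(1 + n))
    (fun z : 'rV[R]_(1 + n) => (z 0 ord0, cinv c (rsubmx z))).

(* Membership in the maximal atlas of N. *)
Definition smooth_chart (R : realType) (n : nat) (M : manifold R n)
    (c : chart R n.+1 (spacetime M)) : Prop :=
  is_chart c /\ forall p : spacetime M, compatible c (st_chart p).

(* C^oo(N), complex-valued. *)
Definition csmooth (R : realType) (n : nat) (M : manifold R n)
    (u : spacetime M -> R[i]) : Prop :=
  forall p : spacetime M,
    csmooth_on (crange (st_chart p)) (fun x => u (cinv (st_chart p) x)).

Definition rsmooth (R : realType) (n : nat) (M : manifold R n)
    (u : spacetime M -> R) : Prop := csmooth (fun p => (u p)%:C%C).

(* C_0^oo(A), for a compact subset A of N. *)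
Definition csmooth0_in (R : realType) (n : nat) (M : manifold R n)
    (A : set (spacetime M)) (u : spacetime M -> R[i]) : Prop :=
  csmooth u /\ forall p, ~ A p -> u p = 0.

(* C_0^oo(N). *)
Definition csmooth0 (R : realType) (n : nat) (M : manifold R n)
    (u : spacetime M -> R[i]) : Prop :=
  exists A : set (spacetime M), compact A /\ csmooth0_in A u.

(* M_T = [0, T] x M. *)
Definition slab (R : realType) (n : nat) (M : manifold R n) (T : R)
    : set (spacetime M) := [set p : R * M | 0 <= p.1 <= T].

(* A metric is given by its components [gcomp c x] in every chart c of the
   maximal atlas, at the point of coordinates x. As ['J f x a b] is the
   derivative of f^b in direction a, [metric_transform] is the transformation
   law g_ab = (dy^i/dx^a) (dy^j/dx^b) g'_ij. *)
Record lorentz_metric (R : realType) (n : nat) (M : manifold R n) :=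
  LorentzMetric {
  gcomp :> chart R n.+1 (spacetime M) -> 'rV[R]_n.+1 -> 'M[R]_n.+1;
  metric_smooth : forall c, smooth_chart c ->
    forall a b, smooth_on (crange c) (fun x => gcomp c x a b);
  metric_sym : forall c, smooth_chart c ->
    forall x, crange c x -> (gcomp c x)^T = gcomp c x;
  metric_signature : forall c, smooth_chart c -> forall x, crange c x ->
    exists2 P : 'M[R]_n.+1, P \in unitmx &
      P *m gcomp c x *m P^T =
      diag_mx (\row_(i < n.+1) if i == ord0 then -1 else 1);
  metric_transform : forall c c', smooth_chart c -> smooth_chart c' ->
    forall p, cdom c p -> cdom c' p ->
    let J := 'J (transition c c') (cmap c p) in
    gcomp c (cmap c p) = J *m gcomp c' (cmap c' p) *m J^T }.

(* g^{ab} *)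
Definition gup (R : realType) (n : nat) (M : manifold R n)
    (g : lorentz_metric M) (c : chart R n.+1 (spacetime M))
    (x : 'rV[R]_n.+1) (a b : 'I_n.+1) : R := invmx (g c x) a b.

(* |g|^{1/2} *)
Definition gvol (R : realType) (n : nat) (M : manifold R n)
    (g : lorentz_metric M) (c : chart R n.+1 (spacetime M))
    (x : 'rV[R]_n.+1) : R := Num.sqrt `|\det (g c x)|.

(* <grad u, grad v>_g, extended complex bilinearly. It is evaluated at p in the
   chart [st_chart p]; by [metric_transform] any other chart around p gives the
   same value. The same applies to [box]. *)
Definition gradp (R : realType) (n : nat) (M : manifold R n)
    (g : lorentz_metric M) (u v : spacetime M -> R[i]) (p : spacetime M) : R[i] :=
  let c := st_chart p in
  let x := cmap c p in
  \sum_(a < n.+1) \sum_(b < n.+1) (gup g c x a b)%:C%C *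
    cpd [:: a] (fun y => u (cinv c y)) x *
    cpd [:: b] (fun y => v (cinv c y)) x.

Definition box (R : realType) (n : nat) (M : manifold R n)
    (g : lorentz_metric M) (u : spacetime M -> R[i]) (p : spacetime M) : R[i] :=
  let c := st_chart p in
  let x := cmap c p in
  - ((gvol g c x)^-1)%:C%C *
  \sum_(a < n.+1)
    cpd [:: a] (fun y => \sum_(b < n.+1) (gvol g c y * gup g c y a b)%:C%C *
                           cpd [:: b] (fun y' => u (cinv c y')) y) x.

Definition coord_curve (R : realType) (n : nat) (M : manifold R n)
    (c : chart R n.+1 (spacetime M)) (gamma : R -> spacetime M)
    (a : 'I_n.+1) (s : R) : R := cmap c (gamma s) 0 a.

Definition smooth_curve (R : realType) (n : nat) (M : manifold R n)
    (D : set R) (gamma : R -> spacetime M) : Prop :=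
  forall s, D s -> {for s, continuous gamma} /\
    forall c, smooth_chart c -> cdom c (gamma s) ->
    forall (a : 'I_n.+1) (k : nat),
      derivable (derive1n k (coord_curve c gamma a)) s 1.

Definition velocity (R : realType) (n : nat) (M : manifold R n)
    (c : chart R n.+1 (spacetime M)) (gamma : R -> spacetime M) (s : R)
    : 'rV[R]_n.+1 :=
  \row_a derive1 (coord_curve c gamma a) s.

(* g(gamma'(s), gamma'(s)) *)
Definition speed2 (R : realType) (n : nat) (M : manifold R n)
    (g : lorentz_metric M) (c : chart R n.+1 (spacetime M))
    (gamma : R -> spacetime M) (s : R) : R :=
  (velocity c gamma s *m g c (cmap c (gamma s)) *m (velocity c gamma s)^T) 0 0.

(* Inextendible timelike curves; any open interval of parameters can be
   reparametrized to R. *)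
Definition inextendible_timelike (R : realType) (n : nat) (M : manifold R n)
    (g : lorentz_metric M) (gamma : R -> spacetime M) : Prop :=
  [/\ smooth_curve setT gamma,
      forall c s, smooth_chart c -> cdom c (gamma s) -> speed2 g c gamma s < 0,
      ~ (exists p : spacetime M, gamma s @[s --> +oo] --> p) &
      ~ (exists p : spacetime M, gamma s @[s --> -oo] --> p)].

Definition cauchy_hypersurface (R : realType) (n : nat) (M : manifold R n)
    (g : lorentz_metric M) (S : set (spacetime M)) : Prop :=
  forall gamma, inextendible_timelike g gamma -> exists! s, S (gamma s).

Definition globally_hyperbolic (R : realType) (n : nat) (M : manifold R n)
    (g : lorentz_metric M) : Prop :=
  exists S : set (spacetime M), cauchy_hypersurface g S.

Definition christoffel (R : realType) (n : nat) (M : manifold R n)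
    (g : lorentz_metric M) (c : chart R n.+1 (spacetime M))
    (x : 'rV[R]_n.+1) (a b e : 'I_n.+1) : R :=
  2^-1 * \sum_(d < n.+1) gup g c x a d *
    (pd [:: b] (fun y => g c y d e) x + pd [:: e] (fun y => g c y b d) x
     - pd [:: d] (fun y => g c y b e) x).

Definition lightlike_geodesic (R : realType) (n : nat) (M : manifold R n)
    (g : lorentz_metric M) (D : set R) (gamma : R -> spacetime M) : Prop :=
  [/\ open D, is_interval D, smooth_curve D gamma &
    forall c s, smooth_chart c -> D s -> cdom c (gamma s) ->
    [/\ velocity c gamma s != 0, speed2 g c gamma s = 0 &
      forall a : 'I_n.+1,
        derive1n 2 (coord_curve c gamma a) s +
        \sum_(b < n.+1) \sum_(e < n.+1)
          christoffel g c (cmap c (gamma s)) a b e *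
          velocity c gamma s 0 b * velocity c gamma s 0 e = 0]].

(* Coordinates z = (s, z^1, ..., z^n): s has index 0 and z^i has index i. *)
Definition axis_pt (R : realType) (n : nat) (s : R) : 'rV[R]_n.+1 :=
  s *: delta_mx 0 ord0.

(* Euclidean norm |z'| *)
Definition tnorm (R : realType) (n : nat) (z : 'rV[R]_n.+1) : R :=
  Num.sqrt (\sum_(i < n) (z 0 (lift ord0 i)) ^+ 2).

(* 2 ds dz^1 + sum_{i >= 2} (dz^i)^2, where 2 ds dz^1 is the symmetric form
   ds (x) dz^1 + dz^1 (x) ds. *)
Definition fermi_matrix (R : realType) (n : nat) : 'M[R]_n.+1 :=
  \matrix_(a, b)
    if ((a == 0 :> nat) && (b == 1 :> nat)) || ((a == 1 :> nat) && (b == 0 :> nat))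
    then 1 else ((a == b) && (2 <= a)%N)%:R.

Definition fermi_coordinates (R : realType) (n : nat) (M : manifold R n)
    (g : lorentz_metric M) (gamma : R -> spacetime M)
    (c : chart R n.+1 (spacetime M)) (I : set R) (delta : R) : Prop :=
  [/\ smooth_chart c, is_interval I, 0 < delta,
      forall z : 'rV[R]_n.+1, I (z 0 ord0) -> tnorm z < delta -> crange c z &
      forall s, I s ->
      [/\ cdom c (gamma s), cmap c (gamma s) = axis_pt n s,
          g c (axis_pt n s) = fermi_matrix R n &
          forall i j k, pd [:: i] (fun z => g c z j k) (axis_pt n s) = 0]].

(* The part of N with Fermi coordinates in I x B_delta. *)
Definition fermi_tube (R : realType) (n : nat) (M : manifold R n)
    (c : chart R n.+1 (spacetime M)) (I : set R) (delta : R)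
    : set (spacetime M) :=
  [set p | [/\ cdom c p, I (cmap c p 0 ord0) & tnorm (cmap c p) < delta]].

(* d_z^alpha u (s, 0) = 0 for s in I and |alpha| <= K. *)
Definition vanishes_on_axis (R : realType) (n : nat) (M : manifold R n)
    (c : chart R n.+1 (spacetime M)) (I : set R) (K : nat)
    (u : spacetime M -> R[i]) : Prop :=
  forall s, I s -> forall alpha : {ffun 'I_n.+1 -> 'I_K.+1},
    (\sum_i alpha i <= K)%N ->
    cpd (mindex_seq alpha) (fun z => u (cinv c z)) (axis_pt n s) = 0.

(* On the tube, u is a homogeneous polynomial of degree i in z^1, ..., z^n with
   complex coefficients depending on s. *)
Definition homog_poly_on_tube (R : realType) (n : nat) (M : manifold R n)
    (c : chart R n.+1 (spacetime M)) (I : set R) (delta : R) (i : nat)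
    (u : spacetime M -> R[i]) : Prop :=
  exists coef : {ffun 'I_n -> 'I_i.+1} -> R -> R[i],
  forall p, fermi_tube c I delta p ->
    u p = \sum_(alpha : {ffun 'I_n -> 'I_i.+1} | (\sum_j alpha j)%N == i)
      coef alpha (cmap c p 0 ord0) *
      \prod_(j < n) ((cmap c p 0 (lift ord0 j)) ^+ alpha j)%:C%C.

(* H Phi *)
Definition eikonal (R : realType) (n : nat) (M : manifold R n)
    (g : lorentz_metric M) (Phi : spacetime M -> R[i]) : spacetime M -> R[i] :=
  gradp g Phi Phi.

(* T a *)
Definition transport (R : realType) (n : nat) (M : manifold R n)
    (g : lorentz_metric M) (Phi a : spacetime M -> R[i]) (p : spacetime M)
    : R[i] :=
  2 * gradp g Phi a p - box g Phi p * a p.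

(* (box_g + Q) u *)
Definition wave_op (R : realType) (n : nat) (M : manifold R n)
    (g : lorentz_metric M) (Q u : spacetime M -> R[i]) (p : spacetime M)
    : R[i] :=
  box g u p + Q p * u p.

(* The amplitudes [beam_amp b l] (the a_l) are only meaningful on the Fermi
   tube; it is their products with the cut-off that are functions on N. *)
Record beam (R : realType) (n : nat) (M : manifold R n) := Beam {
  beam_dom : set R;
  beam_curve : R -> spacetime M;
  beam_chart : chart R n.+1 (spacetime M);
  beam_I : set R;
  beam_delta : R;
  beam_phase : spacetime M -> R[i];
  beam_cut : spacetime M -> R;
  beam_amp : nat -> spacetime M -> R[i] }.

Definition beam_tube (R : realType) (n : nat) (M : manifold R n) (b : beam M)
    : set (spacetime M) :=
  fermi_tube (beam_chart b) (beam_I b) (beam_delta b).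

Definition beam_trace (R : realType) (n : nat) (M : manifold R n) (b : beam M)
    : set (spacetime M) := beam_curve b @` beam_dom b.

(* Since h ranges over (0, 1), chi * sum_l a_l h^l lies in C_0^oo(N) for all h
   iff each chi * a_l does. *)
Definition beam_amplitude_axiom (R : realType) (n : nat) (M : manifold R n)
    (K : nat) (b : beam M) : Prop :=
  let c := beam_chart b in let delta := beam_delta b in
  [/\ rsmooth (beam_cut b), forall p, 0 <= beam_cut b p,
      forall p, beam_tube b p ->
        (tnorm (cmap c p) <= delta / 4 -> beam_cut b p = 1) /\
        (delta / 2 <= tnorm (cmap c p) -> beam_cut b p = 0),
      forall l, (l <= K)%N ->
        csmooth0 (fun p => (beam_cut b p)%:C%C * beam_amp b l p) &
      forall l, (l <= K)%N ->
        exists a : nat -> spacetime M -> R[i],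
          (forall i, (i <= K)%N ->
             homog_poly_on_tube c (beam_I b) delta i (a i)) /\
          (forall p, beam_tube b p ->
             beam_amp b l p = \sum_(i < K.+1) a i p)].

(* Formal Gaussian beam of degree K for box_g + Q along the lightlike geodesic
   [beam_curve b]. *)
Definition gaussian_beam (R : realType) (n : nat) (M : manifold R n)
    (g : lorentz_metric M) (Q : spacetime M -> R[i]) (K : nat) (b : beam M)
    : Prop :=
  let c := beam_chart b in let I := beam_I b in
  let Phi := beam_phase b in let a := beam_amp b in
  [/\ lightlike_geodesic g (beam_dom b) (beam_curve b) /\ I `<=` beam_dom b,
      fermi_coordinates g (beam_curve b) c I (beam_delta b),
      csmooth Phi /\ vanishes_on_axis c I K (eikonal g Phi),
      (forall s, I s -> complex.Im (Phi (beam_curve b s)) = 0) /\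
      (exists2 C : R, 0 < C & forall p, beam_tube b p ->
         C * tnorm (cmap c p) ^+ 2 <= complex.Im (Phi p)) &
      beam_amplitude_axiom K b /\
      vanishes_on_axis c I K (transport g Phi (a 0%N)) /\
      (forall k, (k < K)%N ->
         vanishes_on_axis c I K (fun p =>
           - 'i%C * transport g Phi (a k.+1) p + wave_op g Q (a k) p))].

(* e^{i Phi / h} *)
Definition osc (R : realType) (n : nat) (M : manifold R n)
    (Phi : spacetime M -> R[i]) (h : R) (p : spacetime M) : R[i] :=
  cexp ('i%C * Phi p / h%:C%C).

Definition beam_sol (R : realType) (n : nat) (M : manifold R n)
    (K : nat) (b : beam M) (h : R) (p : spacetime M) : R[i] :=
  osc (beam_phase b) h p * (beam_cut b p)%:C%C *
  \sum_(0 <= l < K.+1) beam_amp b l p * h%:C%C ^+ l.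

(* (f - (box_g + Q) u0 - i (box_g Phi) u1 + 2 i <grad Phi, grad u1>)
     / <grad Phi, grad Phi> *)
Definition formal_step (R : realType) (n : nat) (M : manifold R n)
    (g : lorentz_metric M) (Q Phi f u0 u1 : spacetime M -> R[i])
    (p : spacetime M) : R[i] :=
  (f p - wave_op g Q u0 p - 'i%C * box g Phi p * u1 p
   + 2 * 'i%C * gradp g Phi u1 p) / gradp g Phi Phi p.

(* c_0 = c_1 = 0, and c_m obtained from the source [src (m - 2)], c_{m-2} and
   c_{m-1}. *)
Fixpoint formal_coef (R : realType) (n : nat) (M : manifold R n)
    (g : lorentz_metric M) (Q Phi : spacetime M -> R[i])
    (src : nat -> spacetime M -> R[i]) (m : nat) : spacetime M -> R[i] :=
  match m with
  | 0 => fun _ => 0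
  | 1 => fun _ => 0
  | (m'.+1 as m1).+1 =>
      formal_step g Q Phi (src m')
        (formal_coef g Q Phi src m') (formal_coef g Q Phi src m1)
  end.

Definition phase2 (R : realType) (n : nat) (M : manifold R n)
    (bj bk : beam M) (p : spacetime M) : R[i] :=
  beam_phase bj p + beam_phase bk p.

(* b_l *)
Definition inter_amp (R : realType) (n : nat) (M : manifold R n) (K : nat)
    (chiB : spacetime M -> R) (bj bk : beam M) (l : nat) (p : spacetime M)
    : R[i] :=
  (beam_cut bj p * beam_cut bk p * chiB p)%:C%C *
  \sum_(0 <= m < K.+1) \sum_(0 <= m' < K.+1 | (m + m')%N == l)
    beam_amp bj m p * beam_amp bk m' p.

(* c_m *)
Definition inter_coef (R : realType) (n : nat) (M : manifold R n)
    (g : lorentz_metric M) (Q q : spacetime M -> R[i]) (K : nat)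
    (chiB : spacetime M -> R) (bj bk : beam M) : nat -> spacetime M -> R[i] :=
  formal_coef g Q (phase2 bj bk) (fun l p => q p * inter_amp K chiB bj bk l p).

Definition inter_sol (R : realType) (n : nat) (M : manifold R n)
    (g : lorentz_metric M) (Q q : spacetime M -> R[i]) (K : nat)
    (chiB : spacetime M -> R) (bj bk : beam M) (h : R) (p : spacetime M)
    : R[i] :=
  osc (phase2 bj bk) h p *
  \sum_(2 <= m < (2 * K + 2).+1) inter_coef g Q q K chiB bj bk m p * h%:C%C ^+ m.

Definition phase3 (R : realType) (n : nat) (M : manifold R n)
    (bi bj bk : beam M) (p : spacetime M) : R[i] :=
  beam_phase bi p + beam_phase bj p + beam_phase bk p.

(* F = q (v^i w^jk + v^j w^ik + v^k w^ij) *)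
Definition source3 (R : realType) (n : nat) (M : manifold R n)
    (g : lorentz_metric M) (Q q : spacetime M -> R[i]) (K : nat)
    (chiB : spacetime M -> R) (bi bj bk : beam M) (h : R) (p : spacetime M)
    : R[i] :=
  q p * (beam_sol K bi h p * inter_sol g Q q K chiB bj bk h p
       + beam_sol K bj h p * inter_sol g Q q K chiB bi bk h p
       + beam_sol K bk h p * inter_sol g Q q K chiB bi bj h p).

(* Coefficient of h^m in
   chi_i (sum_l a^i_l h^l) (sum_m' c^jk_m' h^m'). *)
Definition beam_inter_coef (R : realType) (n : nat) (M : manifold R n)
    (g : lorentz_metric M) (Q q : spacetime M -> R[i]) (K : nat)
    (chiB : spacetime M -> R) (bi bj bk : beam M) (m : nat) (p : spacetime M)
    : R[i] :=
  (beam_cut bi p)%:C%C *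
  \sum_(0 <= l < K.+1) \sum_(2 <= m' < (2 * K + 2).+1 | (l + m')%N == m)
    beam_amp bi l p * inter_coef g Q q K chiB bj bk m' p.

(* beta_m *)
Definition beta_coef (R : realType) (n : nat) (M : manifold R n)
    (g : lorentz_metric M) (Q q : spacetime M -> R[i]) (K : nat)
    (chiB : spacetime M -> R) (bi bj bk : beam M) (m : nat) (p : spacetime M)
    : R[i] :=
  beam_inter_coef g Q q K chiB bi bj bk m p
  + beam_inter_coef g Q q K chiB bj bi bk m p
  + beam_inter_coef g Q q K chiB bk bi bj m p.

(* chi vanishes off a coordinate ball around p0 contained in N0. *)
Definition ball_cutoff (R : realType) (n : nat) (M : manifold R n)
    (p0 : spacetime M) (N0 : set (spacetime M)) (chi : spacetime M -> R)
    : Prop :=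
  rsmooth chi /\
  exists (c : chart R n.+1 (spacetime M)) (r : R),
    let B := [set x : 'rV[R]_n.+1 |
                \sum_(a < n.+1) (x 0 a - cmap c p0 0 a) ^+ 2 < r ^+ 2] in
    [/\ smooth_chart c, cdom c p0, 0 < r,
        B `<=` crange c /\ cinv c @` B `<=` N0 &
        forall p, chi p != 0 -> (cinv c @` B) p].

(* A locally finite partition of unity on N with coordinates on each piece. *)
Record sobolev_atlas (R : realType) (n : nat) (M : manifold R n) :=
  SobolevAtlas {
  sob_chart : nat -> chart R n.+1 (spacetime M);
  sob_cut : nat -> spacetime M -> R;
  sob_chart_smooth : forall i, smooth_chart (sob_chart i);
  sob_cut_smooth : forall i, rsmooth (sob_cut i);
  sob_cut_ge0 : forall i p, 0 <= sob_cut i p;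
  sob_cut_supp : forall i, exists2 A : set (spacetime M),
    compact A & A `<=` cdom (sob_chart i) /\
                forall p, ~ A p -> sob_cut i p = 0;
  sob_cut_locfin : forall p : spacetime M, exists m : nat,
    \forall p' \near p, forall i, (m <= i)%N -> sob_cut i p' = 0;
  sob_cut_sum : forall p, \forall m \near \oo,
    \sum_(0 <= i < m) sob_cut i p = 1 }.

(* |d^alpha ((rho_i u) o c_i^-1) (x)|^2, for x in the image of M_T by c_i. *)
Definition sob_density (R : realType) (n : nat) (M : manifold R n)
    (P : sobolev_atlas M) (T : R) (u : spacetime M -> R[i]) (i : nat)
    (k : nat) (alpha : {ffun 'I_n.+1 -> 'I_k.+1}) (x : 'rV[R]_n.+1) : R :=
  let c := sob_chart P i in
  let w := cpd (mindex_seq alpha)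
             (fun y => (sob_cut P i (cinv c y))%:C%C * u (cinv c y)) x in
  \1_(cmap c @` (cdom c `&` slab T)) x
  * (complex.Re w ^+ 2 + complex.Im w ^+ 2).

(* H^kappa(M_T) norm, kappa a natural number. Different partitions of unity
   give equivalent norms for functions supported in a fixed compact set. *)
Definition sobolev_norm (R : realType) (n : nat) (M : manifold R n)
    (P : sobolev_atlas M) (T : R) (kappa : nat) (u : spacetime M -> R[i])
    : \bar R :=
  ((\sum_(0 <= i <oo)
      \sum_(alpha : {ffun 'I_n.+1 -> 'I_kappa.+1} |
              (\sum_j alpha j <= kappa)%N)
        iint (fun x : 'rV[R]_n.+1 => (sob_density P T u i alpha x)%:E))
    `^ 2^-1)%E.

(* Main.v *)
Require Import Defs.
From HB Require Import structures.
From mathcomp Require Import all_boot all_order perm all_algebra.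
From mathcomp Require Import complex.
From mathcomp Require Import all_classical all_reals all_analysis.
From mathcomp Require Import measurable_realfun ring lra.
Set Implicit Arguments.
Unset Strict Implicit.
Unset Printing Implicit Defensive.
Import Order.TTheory GRing.Theory Num.Theory.
Import numFieldNormedType.Exports.
Local Open Scope classical_set_scope.
Local Open Scope ring_scope.

(** With S a formal sum of amplitudes, the conjugated operator is
      e^{-i Phi/h} (box + Q) (e^{i Phi/h} S)
        = h^-2 <grad Phi, grad Phi> S + h^-1 (i (box Phi) S - 2 i <grad Phi, grad S>)
          + (box + Q) S.
    Inserting S = sum_l theta_l h^l, the recursion for theta_l makes every power
    of h below 3K + 3 cancel against the source, and the remainder is
    e^{i Phi/h} (h^(3K+3) A + h^(3K+4) B) with A, B in C_0^oo(N_0).  On N_0 one has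
    Im Phi >= 0, so |e^{i Phi/h}| <= 1, and each derivative costs one factor h^-1.

    The operators are defined pointwise, in a chart that varies with the point.
    Hence even the smoothness of [box u] requires the invariance of box under
    changes of coordinates; it is obtained from the Piola identity. *)

(** * Differentiation of real functions *)

(** Three obstacles shape the development. [smooth_on] quantifies over lists of derivatives, and the
    product and chain rules do not follow such a list; the graded classes [Ck] restore an induction
    on the order. The recursion divides by <grad Phi, grad Phi>, which may vanish off N_0; each
    numerator vanishes off the closed set N_0, and this makes the quotient smooth on all of N.
    Transition maps may reverse orientation, so the density |g|^{1/2} brings in the sign of the
    Jacobian determinant, which is locally constant.

    The recursion for theta is the one that defines the interaction solutions, run with the source q
    beta_(k+2): theta_l is its coefficient of index l - 2.

    Since the remainder starts at h^(3K+3), kappa derivatives leave h^(3K+3-kappa), two powers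
    better than the claimed bound. The constant is uniform in h because the derivatives of e^{i
    Phi/h} a are e^{i Phi/h} times a finite family of amplitudes independent of h, weighted by
    powers of h, and because a compact set meets only finitely many pieces of the partition of
    unity. *)

(** The first-order expansion at [x] only sees the germ of the function, so the differential of [f]
    serves for [g]. Coordinate identities hold only on open sets, hence the need for a local
    form. *)
Lemma near_eq_differentiable (R : realType) (V W : normedModType R)
    (f g : V -> W) (x : V) :
  (\near x, f x = g x) -> differentiable f x -> differentiable g x.
Proof.
move=> fg df; have fgx := nbhs_singleton fg.
have [dfc /eqaddoP fE] := (diff_locallyP x f).1 df.
have gE : g \o shift x = cst (g x) + 'd f x +o_ 0 id.
  apply/eqaddoP => e /fE fe; move: fg; rewrite (near_shift 0 x) /= => fg.
  near=> y.
  have -> : (g \o shift x - (cst (g x) + 'd f x)) y =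
            (f \o shift x - (cst (f x) + 'd f x)) y.
    rewrite !fctE /= fgx; congr (_ - _); near: y.
    by apply: filterS fg => y /=; rewrite subr0 => ->.
  by near: y.
by apply/diff_locallyP; rewrite (diff_unique dfc gE).
Unshelve. all: by end_near. Qed.

Section real_calculus.
Context {R : realType}.
Implicit Types d m k : nat.

Lemma pd_near d (l : seq 'I_d) (f g : 'rV[R]_d -> R) (x : 'rV[R]_d) :
  (\near x, f x = g x) -> \near x, pd l f x = pd l g x.
Proof.
elim: l => [//|i l IH] /= /IH /nbhs_interior; apply: filterS => y.
exact: near_eq_derive.
Qed.

Lemma pd_near_eq d (l : seq 'I_d) (f g : 'rV[R]_d -> R) (x : 'rV[R]_d) :
  (\near x, f x = g x) -> pd l f x = pd l g x.
Proof. by move=> /(pd_near l)/nbhs_singleton. Qed.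

(** The recursion of [pd] peels off the outermost derivative; peeling off the innermost one lets an
    induction on the order change the function. *)
Lemma pd_rcons d (l : seq 'I_d) i (f : 'rV[R]_d -> R) :
  pd (rcons l i) f = pd l (pd [:: i] f).
Proof. by elim: l => [//|j l /= ->]. Qed.

(** Graded by order and recursive through first derivatives: these are given by the product and
    chain rules in terms of functions one class lower, so closure properties follow by induction on
    [k]. At level [k], all partial derivatives of order at most [k] are Frechet differentiable. *)
Fixpoint Ck d k (U : set 'rV[R]_d) (f : 'rV[R]_d -> R) : Prop :=
  (forall x, U x -> differentiable f x) /\
  if k is k'.+1 then forall i, Ck k' U (pd [:: i] f) else True.

Lemma Ck_diff d k (U : set 'rV[R]_d) f x : Ck k U f -> U x -> differentiable f x.
Proof. by case: k => [|k] [] df _; exact: df. Qed.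

Lemma CkS d k (U : set 'rV[R]_d) f : Ck k.+1 U f -> Ck k U f.
Proof. by elim: k f => [|k IH] f [df pf]; split => // i; exact/IH/pf. Qed.

Lemma smooth_onP d (U : set 'rV[R]_d) f :
  smooth_on U f <-> forall k, Ck k U f.
Proof.
split=> [sf k|Cf l x Ux].
  elim: k f sf => [|k IH] f sf; split => //; try by move=> x; exact: (sf [::]).
  by move=> i; apply: IH => l x Ux; rewrite -pd_rcons; exact: sf.
elim/last_ind: l f Cf => [|l i IH] f Cf; first exact: (Ck_diff (Cf 0%N)).
by rewrite pd_rcons; apply: IH => k; exact: (Cf k.+1).2.
Qed.

Lemma smooth_on_diff d (U : set 'rV[R]_d) f x :
  smooth_on U f -> U x -> differentiable f x.
Proof. by move=> sf; exact: (sf [::]). Qed.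

Lemma smooth_on_pd d (U : set 'rV[R]_d) l f :
  smooth_on U f -> smooth_on U (pd l f).
Proof.
have pd_cat l1 : pd l1 (pd l f) = pd (l1 ++ l) f by elim: l1 => //= a l1 ->.
by move=> sf l' x Ux; rewrite pd_cat; exact: sf.
Qed.

Lemma smooth_on_sub d (U V : set 'rV[R]_d) f :
  V `<=` U -> smooth_on U f -> smooth_on V f.
Proof. by move=> VU sf l x /VU; exact: sf. Qed.

(** The set [V] need not be open: differentiability of [pd l g] at [x] already involves a
    neighbourhood of [x]. *)
Lemma smooth_on_loc d (U : set 'rV[R]_d) f :
  (forall x : 'rV[R]_d, U x -> exists2 g, (\near x, f x = g x) &
     exists2 V : set 'rV[R]_d, V x & smooth_on V g) -> smooth_on U f.
Proof.
move=> H l x /H[g fg [V Vx sg]].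
apply: near_eq_differentiable (sg l x Vx).
by apply: filterS (pd_near l fg) => y ->.
Qed.

Lemma eq_smooth_on d (U : set 'rV[R]_d) f g : open U ->
  (forall x, U x -> f x = g x) -> smooth_on U f -> smooth_on U g.
Proof.
move=> oU fg sf; apply: smooth_on_loc => x Ux; exists f; last by exists U.
by apply: filterS (open_nbhs_nbhs (conj oU Ux)) => y /fg.
Qed.

Lemma eq_Ck d k (U : set 'rV[R]_d) f g : open U ->
  (forall x, U x -> f x = g x) -> Ck k U f -> Ck k U g.
Proof.
move=> oU; have near_eq (f' g' : 'rV[R]_d -> R) (x : 'rV[R]_d) :
    (forall x, U x -> f' x = g' x) -> U x -> \near x, f' x = g' x.
  by move=> fg Ux; apply: filterS (open_nbhs_nbhs (conj oU Ux)) => y /fg.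
elim: k f g => [|k IH] f g fg [df pf]; split => //; try by
  move=> x Ux; apply: near_eq_differentiable (df x Ux); exact: near_eq.
move=> i; apply: IH (pf i) => x Ux; apply: pd_near_eq; exact: near_eq.
Qed.

Lemma pdD d (f g : 'rV[R]_d -> R) i x :
  differentiable f x -> differentiable g x ->
  pd [:: i] (fun y => f y + g y) x = pd [:: i] f x + pd [:: i] g x.
Proof. by move=> df dg; apply: deriveD; exact: diff_derivable. Qed.

Lemma pdN d (f : 'rV[R]_d -> R) i x :
  differentiable f x -> pd [:: i] (fun y => - f y) x = - pd [:: i] f x.
Proof. by move=> df; apply: deriveN; exact: diff_derivable. Qed.

Lemma pdM d (f g : 'rV[R]_d -> R) i x :
  differentiable f x -> differentiable g x ->
  pd [:: i] (fun y => f y * g y) x = pd [:: i] f x * g x + f x * pd [:: i] g x.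
Proof.
move=> df dg /=.
have /= := @deriveM _ _ f g x (delta_mx 0 i) (diff_derivable df) (diff_derivable dg).
by move=> ->; rewrite addrC [g x *: _]mulrC.
Qed.

Lemma pd_cst d (c : R) i (x : 'rV[R]_d) : pd [:: i] (fun=> c) x = 0.
Proof. exact: derive_cst. Qed.

(** Both conclusions go through one induction, as the sum rule for a longer sum needs the
    differentiability of the shorter one. *)
Lemma pd_sum d (I : Type) (r : seq I) (P : pred I) (f : I -> 'rV[R]_d -> R) i x :
  (forall j, P j -> differentiable (f j) x) ->
  pd [:: i] (fun y => \sum_(j <- r | P j) f j y) x =
    \sum_(j <- r | P j) pd [:: i] (f j) x /\
  differentiable (fun y => \sum_(j <- r | P j) f j y) x.
Proof.
move=> df; elim: r => [|j r [IHe IHd]].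
  under [X in pd _ X]funext do rewrite big_nil.
  under [X in differentiable X _]funext do rewrite big_nil.
  by rewrite big_nil; split; [exact: pd_cst|exact: differentiable_cst].
under [X in pd _ X]funext do rewrite big_cons.
under [X in differentiable X _]funext do rewrite big_cons.
rewrite big_cons; case: ifP => // Pj.
by split; [rewrite pdD ?IHe //; exact: df|apply: differentiableD => //; exact: df].
Qed.

Lemma differentiable_comp1 d (f : 'rV[R]_d -> R) (psi : R -> R) x (dpsi : R) :
  differentiable f x -> is_derive (f x) 1 psi dpsi ->
  differentiable (fun y => psi (f y)) x.
Proof.
move=> df [psid _]; apply: differentiable_comp => //; exact/derivable1_diffP.
Qed.

Lemma pd_comp1 d (f : 'rV[R]_d -> R) (psi : R -> R) i x (dpsi : R) :
  differentiable f x -> is_derive (f x) 1 psi dpsi ->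
  pd [:: i] (fun y => psi (f y)) x = dpsi * pd [:: i] f x.
Proof.
move=> df dp; have [psid psiv] := dp.
have psid' : differentiable psi (f x) by exact/derivable1_diffP.
rewrite /= !deriveE //; last exact: differentiable_comp1 dp.
rewrite (@diff_comp _ _ _ _ f psi) //=.
have /(congr1 (fun u => u ('d f x (delta_mx 0 i)))) := deriv1E psid.
by move=> ->; rewrite derive1E psiv mulrC.
Qed.

Lemma differentiable_rV d m (phi : 'rV[R]_d -> 'rV[R]_m) x :
  (forall a, differentiable (fun y => phi y 0 a) x) -> differentiable phi x.
Proof.
move=> dphi; rewrite [phi](_ : _ =
    \sum_(a < m) (fun y => phi y 0 a *: (delta_mx 0 a : 'rV[R]_m))).
  by apply: differentiable_sum => a; exact: differentiableZl.
by apply/funext => y; rewrite [LHS]row_sum_delta fct_sumE.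
Qed.

Lemma pd_comp d m (f : 'rV[R]_m -> R) (phi : 'rV[R]_d -> 'rV[R]_m) i x :
  (forall a, differentiable (fun y => phi y 0 a) x) ->
  differentiable f (phi x) ->
  pd [:: i] (fun y => f (phi y)) x =
  \sum_(a < m) pd [:: i] (fun y => phi y 0 a) x * pd [:: a] f (phi x).
Proof.
move=> dphi df; have dph := differentiable_rV dphi.
rewrite /= deriveE; last exact: differentiable_comp.
rewrite (@diff_comp _ _ _ _ phi f) //=.
have -> : 'd phi x (delta_mx 0 i) = 'D_(delta_mx 0 i) phi x by rewrite deriveE.
rewrite derive_mx; last exact: diff_derivable.
rewrite [X in 'd f _ X]row_sum_delta linear_sum; apply: eq_bigr => a _.
by rewrite linearZ /= mxE [in RHS](@deriveE _ _ _ f).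
Qed.

End real_calculus.

(** * Closure properties of smooth real functions *)

Section smooth_closure.
Context {R : realType}.

Section at_order.
Context {d : nat} (U : set 'rV[R]_d) (oU : open U).
Implicit Types f g : 'rV[R]_d -> R.

Lemma Ck_cst k (c : R) : Ck k U (fun=> c).
Proof.
elim: k c => [|k IH] c; split => //; try by move=> x _; exact: differentiable_cst.
move=> i; apply: (eq_Ck oU _ (IH 0)) => x _; by rewrite pd_cst.
Qed.

Lemma Ck_coord k a : Ck k U (fun x => x 0 a).
Proof.
case: k => [|k]; split => //; try by move=> x _; exact: differentiable_coord.
move=> i; apply: (eq_Ck oU _ (Ck_cst k ((i == a)%:R))) => x _ /=.
rewrite deriveE; last exact: differentiable_coord.
pose M : 'rV[R]_d -> 'rV[R]_d := id.
have dM : derivable M x (delta_mx 0 i) by exact: derivable_id.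
rewrite -deriveE; last exact: differentiable_coord.
have := derive_mx dM; rewrite derive_id => /matrixP/(_ 0 a).
by rewrite !mxE eqxx eq_sym.
Qed.

Lemma CkD k f g : Ck k U f -> Ck k U g -> Ck k U (fun x => f x + g x).
Proof.
elim: k f g => [|k IH] f g [df pf] [dg pg]; split => //; try by
  move=> x Ux; apply: differentiableD; [exact: df|exact: dg].
move=> i; apply: (eq_Ck oU _ (IH _ _ (pf i) (pg i))) => x Ux.
by rewrite pdD //; [exact: df|exact: dg].
Qed.

Lemma CkM k f g : Ck k U f -> Ck k U g -> Ck k U (fun x => f x * g x).
Proof.
elim: k f g => [|k IH] f g Cf Cg; have [df pf] := Cf; have [dg pg] := Cg;
  split => //; try by
  move=> x Ux; apply: differentiableM; [exact: df|exact: dg].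
move=> i; apply: (eq_Ck oU _ (CkD (IH _ _ (pf i) (CkS Cg))
                                  (IH _ _ (CkS Cf) (pg i)))) => x Ux.
by rewrite pdM //; [exact: df|exact: dg].
Qed.

Lemma Ck_sum k (I : Type) (r : seq I) (P : pred I) (f : I -> 'rV[R]_d -> R) :
  (forall j, P j -> Ck k U (f j)) -> Ck k U (fun x => \sum_(j <- r | P j) f j x).
Proof.
move=> Cf; elim: r => [|j r IH].
  by apply: (eq_Ck oU _ (Ck_cst k 0)) => x _; rewrite big_nil.
have [Pj|nPj] := boolP (P j).
  by apply: (eq_Ck oU _ (CkD (Cf j Pj) IH)) => x _; rewrite big_cons Pj.
by apply: (eq_Ck oU _ IH) => x _; rewrite big_cons (negbTE nPj).
Qed.

Lemma Ck_inv k f : (forall x, U x -> f x != 0) -> Ck k U f ->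
  Ck k U (fun x => (f x)^-1).
Proof.
move=> f0; elim: k f f0 => [|k IH] f f0 Cf; have [df pf] := Cf; split => //; try by
  move=> x Ux; apply: differentiableV; [exact: df|exact: f0].
move=> i; have Cif := IH _ f0 (CkS Cf).
apply: (eq_Ck oU _ (CkM (Ck_cst k (-1)) (CkM (CkM Cif Cif) (pf i)))) => x Ux.
rewrite [RHS](@deriveV _ _ f) ?f0 //; last exact/diff_derivable/df.
by rewrite mulN1r -exprVn scaleNr expr2.
Qed.

Lemma Ck_expR k f : Ck k U f -> Ck k U (fun x => expR (f x)).
Proof.
elim: k f => [|k IH] f Cf; have [df pf] := Cf; split => //; try by
  move=> x Ux; apply: differentiable_comp1 (df x Ux) _; exact: is_derive_expR.
move=> i; apply: (eq_Ck oU _ (CkM (IH _ (CkS Cf)) (pf i))) => x Ux.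
by rewrite (pd_comp1 i (df x Ux) (is_derive_expR _)).
Qed.

(** Sine and cosine are each other's derivative up to sign, so neither induction closes alone. *)
Lemma Ck_cos_sin k f : Ck k U f ->
  Ck k U (fun x => cos (f x)) /\ Ck k U (fun x => sin (f x)).
Proof.
have dcos (h : 'rV[R]_d -> R) x : differentiable h x -> differentiable (fun y => cos (h y)) x.
  by move=> dh; apply: differentiable_comp1 dh _; exact: is_derive_cos.
have dsin (h : 'rV[R]_d -> R) x : differentiable h x -> differentiable (fun y => sin (h y)) x.
  by move=> dh; apply: differentiable_comp1 dh _; exact: is_derive_sin.
elim: k f => [|k IH] f Cf; have [df pf] := Cf.
  by split; split => // x Ux; [exact/dcos/df|exact/dsin/df].
have [Cc Cs] := IH _ (CkS Cf).
split; split => [x Ux|i]; [exact/dcos/df| |exact/dsin/df|].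
- apply: (eq_Ck oU _ (CkM (Ck_cst k (-1)) (CkM Cs (pf i)))) => x Ux.
  by rewrite (pd_comp1 i (df x Ux) (is_derive_cos _)) mulN1r mulNr.
- apply: (eq_Ck oU _ (CkM Cc (pf i))) => x Ux.
  by rewrite (pd_comp1 i (df x Ux) (is_derive_sin _)).
Qed.

Lemma Ck_sqrt k f : (forall x, U x -> 0 < f x) -> Ck k U f ->
  Ck k U (fun x => Num.sqrt (f x)).
Proof.
move=> f0; elim: k f f0 => [|k IH] f f0 Cf; have [df pf] := Cf; split => //; try by
  move=> x Ux; apply: differentiable_comp1 (df x Ux) _; apply: is_derive1_sqrt;
  exact: f0.
move=> i; have Cif := IH _ f0 (CkS Cf).
have Cinv : Ck k U (fun x => (2 * Num.sqrt (f x))^-1).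
  apply: Ck_inv; last by apply: CkM => //; exact: Ck_cst.
  by move=> x Ux; rewrite mulf_neq0 // gt_eqF // sqrtr_gt0 f0.
apply: (eq_Ck oU _ (CkM Cinv (pf i))) => x Ux.
by rewrite (pd_comp1 i (df x Ux) (is_derive1_sqrt (f0 _ Ux))).
Qed.

End at_order.

(** By the chain rule, a first derivative of the composite is a sum of products of derivatives of
    [phi] with derivatives of [f] composed with the same [phi]; the induction on [k] therefore
    varies [f] and keeps [phi]. *)
Lemma Ck_comp d m k (U : set 'rV[R]_d) (V : set 'rV[R]_m)
    (f : 'rV[R]_m -> R) (phi : 'rV[R]_d -> 'rV[R]_m) :
  open U -> open V -> (forall x, U x -> V (phi x)) ->
  (forall a, Ck k U (fun x => phi x 0 a)) -> Ck k V f ->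
  Ck k U (fun x => f (phi x)).
Proof.
move=> oU oV UV; elim: k f => [|k IH] f Cphi Cf; have [df pf] := Cf.
  split => // x Ux; apply: differentiable_comp; last exact/df/UV.
  by apply: differentiable_rV => a; exact: (Ck_diff (Cphi a)).
split=> [x Ux|i].
  apply: differentiable_comp; last exact/df/UV.
  by apply: differentiable_rV => a; exact: (Ck_diff (Cphi a)).
pose F x := \sum_(a < m) pd [:: i] (fun y => phi y 0 a) x * pd [:: a] f (phi x).
apply: (@eq_Ck _ _ _ _ F _ oU).
  move=> x Ux; rewrite pd_comp //; last exact/df/UV.
  by move=> a; exact: (Ck_diff (Cphi a)).
apply: (Ck_sum oU) => a _; apply: (CkM oU); first exact: (Cphi a).2.
by apply: IH => [b|]; [exact/CkS/Cphi|exact: pf].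
Qed.

Section smooth.
Context {d : nat} (U : set 'rV[R]_d) (oU : open U).
Implicit Types f g : 'rV[R]_d -> R.

Lemma smooth_cst (c : R) : smooth_on U (fun=> c).
Proof. by apply/smooth_onP => k; exact: Ck_cst. Qed.

Lemma smooth_coord a : smooth_on U (fun x => x 0 a).
Proof. by apply/smooth_onP => k; exact: Ck_coord. Qed.

Lemma smoothD f g : smooth_on U f -> smooth_on U g ->
  smooth_on U (fun x => f x + g x).
Proof. by move=> /smooth_onP Cf /smooth_onP Cg; apply/smooth_onP => k; exact: CkD. Qed.

Lemma smoothM f g : smooth_on U f -> smooth_on U g ->
  smooth_on U (fun x => f x * g x).
Proof. by move=> /smooth_onP Cf /smooth_onP Cg; apply/smooth_onP => k; exact: CkM. Qed.

Lemma smoothN f : smooth_on U f -> smooth_on U (fun x => - f x).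
Proof.
move=> sf; apply: (eq_smooth_on oU _ (smoothM (smooth_cst (-1)) sf)) => x _.
by rewrite mulN1r.
Qed.

Lemma smoothB f g : smooth_on U f -> smooth_on U g ->
  smooth_on U (fun x => f x - g x).
Proof. by move=> sf sg; apply: smoothD => //; exact: smoothN. Qed.

Lemma smooth_sum (I : Type) (r : seq I) (P : pred I) (f : I -> 'rV[R]_d -> R) :
  (forall j, P j -> smooth_on U (f j)) ->
  smooth_on U (fun x => \sum_(j <- r | P j) f j x).
Proof.
move=> sf; apply/smooth_onP => k; apply: Ck_sum => // j Pj.
by move/smooth_onP: (sf j Pj).
Qed.

Lemma smooth_prod (I : Type) (r : seq I) (P : pred I) (f : I -> 'rV[R]_d -> R) :
  (forall j, P j -> smooth_on U (f j)) ->
  smooth_on U (fun x => \prod_(j <- r | P j) f j x).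
Proof.
move=> sf; elim: r => [|j r IH].
  by apply: (eq_smooth_on oU _ (smooth_cst 1)) => x _; rewrite big_nil.
have [Pj|nPj] := boolP (P j).
  by apply: (eq_smooth_on oU _ (smoothM (sf j Pj) IH)) => x _; rewrite big_cons Pj.
by apply: (eq_smooth_on oU _ IH) => x _; rewrite big_cons (negbTE nPj).
Qed.

Lemma smoothV f : (forall x, U x -> f x != 0) -> smooth_on U f ->
  smooth_on U (fun x => (f x)^-1).
Proof. by move=> f0 /smooth_onP Cf; apply/smooth_onP => k; exact: Ck_inv. Qed.

Lemma smooth_expR f : smooth_on U f -> smooth_on U (fun x => expR (f x)).
Proof. by move=> /smooth_onP Cf; apply/smooth_onP => k; exact: Ck_expR. Qed.

Lemma smooth_cos f : smooth_on U f -> smooth_on U (fun x => cos (f x)).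
Proof.
by move=> /smooth_onP Cf; apply/smooth_onP => k; have [] := Ck_cos_sin oU (Cf k).
Qed.

Lemma smooth_sin f : smooth_on U f -> smooth_on U (fun x => sin (f x)).
Proof.
by move=> /smooth_onP Cf; apply/smooth_onP => k; have [] := Ck_cos_sin oU (Cf k).
Qed.

Lemma smooth_sqrt f : (forall x, U x -> 0 < f x) -> smooth_on U f ->
  smooth_on U (fun x => Num.sqrt (f x)).
Proof. by move=> f0 /smooth_onP Cf; apply/smooth_onP => k; exact: Ck_sqrt. Qed.

Lemma smooth_det m (A : 'rV[R]_d -> 'M[R]_m) :
  (forall a b, smooth_on U (fun x => A x a b)) ->
  smooth_on U (fun x => \det (A x)).
Proof.
move=> sA; apply: smooth_sum => s _; apply: smoothM; first exact: smooth_cst.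
by apply: smooth_prod => i _; exact: sA.
Qed.

Lemma smooth_adj m (A : 'rV[R]_d -> 'M[R]_m) a b :
  (forall a b, smooth_on U (fun x => A x a b)) ->
  smooth_on U (fun x => (\adj (A x)) a b).
Proof.
move=> sA.
suff : smooth_on U (fun x => cofactor (A x) b a).
  by apply: (eq_smooth_on oU) => x _; rewrite mxE.
apply: smoothM; first exact: smooth_cst.
apply: smooth_det => i j.
apply: (eq_smooth_on oU _ (sA (lift b i) (lift a j))) => x _.
by rewrite !mxE.
Qed.

(** Cramer's formula: the entries are cofactors, polynomial in the entries of [A], divided by a
    nonvanishing determinant. *)
Lemma smooth_invmx m (A : 'rV[R]_d -> 'M[R]_m) a b :
  (forall x, U x -> A x \in unitmx) ->
  (forall a b, smooth_on U (fun x => A x a b)) ->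
  smooth_on U (fun x => invmx (A x) a b).
Proof.
move=> uA sA.
have dA x : U x -> \det (A x) != 0.
  by move=> Ux; rewrite -unitfE -unitmxE; exact: uA.
apply: (eq_smooth_on oU _ (smoothM (smoothV dA (smooth_det sA))
                                   (smooth_adj a b sA))) => x Ux.
by rewrite /invmx uA // [RHS]mxE.
Qed.

End smooth.

Lemma smooth_comp d m (U : set 'rV[R]_d) (V : set 'rV[R]_m)
    (f : 'rV[R]_m -> R) (phi : 'rV[R]_d -> 'rV[R]_m) :
  open U -> open V -> (forall x, U x -> V (phi x)) ->
  (forall a, smooth_on U (fun x => phi x 0 a)) -> smooth_on V f ->
  smooth_on U (fun x => f (phi x)).
Proof.
move=> oU oV UV sphi /smooth_onP Cf; apply/smooth_onP => k.
apply: (Ck_comp oU oV UV _ (Cf k)) => a.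
by move/smooth_onP: (sphi a).
Qed.

End smooth_closure.

(** * Symmetry of second derivatives *)

Section schwarz.
Context {R : realType} {d : nat}.
Implicit Types (f : 'rV[R]_d -> R) (x y v w : 'rV[R]_d).

Lemma is_derive_line f y v (s : R) : differentiable f (y + s *: v) ->
  is_derive s 1 (fun u : R => f (y + u *: v)) ('D_v f (y + s *: v)).
Proof.
move=> df.
have dL : is_diff s (fun u : R => y + u *: v) ( *:%R ^~ v).
  have := is_diffD (is_diff_cst y s) (is_diff_scalel s v).
  suff -> : 0 + ( *:%R ^~ v : R -> 'rV[R]_d) = *:%R ^~ v by [].
  by apply/funext => h; exact: add0r.
have dF : is_diff s (fun u : R => f (y + u *: v))
    ('d f (y + s *: v) \o ( *:%R ^~ v)).
  exact: (@is_diff_comp _ _ _ _ _ _ f _ s dL (differentiableP df)).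
apply: DeriveDef; first exact/diff_derivable/ex_diff.
rewrite deriveE; last exact: ex_diff.
have /(congr1 (fun u : R -> R => u 1)) /= -> := @diff_val _ _ _ _ _ _ _ dF.
by rewrite scale1r deriveE.
Qed.

(** Two applications of the mean value theorem: in direction [e] to the increment of [f] by
    [t *: w], then in direction [w] to the derivative of [f] along [e]. *)
Lemma second_difference f x (i j : 'I_d) (t : R) :
  let e := delta_mx 0 i in let w := delta_mx 0 j in
  0 < t ->
  (forall a b, 0 <= a <= t -> 0 <= b <= t ->
     differentiable f (x + a *: e + b *: w) /\
     differentiable (pd [:: i] f) (x + a *: e + b *: w)) ->
  exists a b, [/\ 0 <= a <= t, 0 <= b <= t &
    f (x + t *: e + t *: w) - f (x + t *: e) - f (x + t *: w) + f x =
    t ^+ 2 * pd [:: j; i] f (x + a *: e + b *: w)].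
Proof.
move=> e w t0 df.
have t00 : 0 <= (0 : R) <= t by rewrite lexx ltW.
have tt : 0 <= t <= t by rewrite lexx ltW.
pose g s := f (x + t *: w + s *: e) - f (x + s *: e).
pose dg s := pd [:: i] f (x + t *: w + s *: e) - pd [:: i] f (x + s *: e).
have gd s : 0 <= s <= t -> is_derive s 1 g (dg s).
  move=> st; have [D1 _] := df s t st tt; have [D0 _] := df s 0 st t00.
  rewrite scale0r addr0 in D0; rewrite addrAC in D1.
  exact: is_deriveB (is_derive_line D1) (is_derive_line D0).
have itvW (s : R) : s \in `]0, t[%R -> 0 <= s <= t.
  by rewrite in_itv /= => /andP[s0 st]; rewrite !ltW.
have itvE (s : R) : `[0, t]%classic s -> 0 <= s <= t by rewrite /= in_itv.
have [|a /itvW at0 Ea] := MVT t0 (fun s st => gd s (itvW s st)).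
  apply: derivable_within_continuous => s st.
  by have [] := gd s (itvE s st).
pose k s := pd [:: i] f (x + a *: e + s *: w).
have kd s : 0 <= s <= t -> is_derive s 1 k (pd [:: j; i] f (x + a *: e + s *: w)).
  by move=> st; have [_ D] := df a s at0 st; exact: is_derive_line.
have [|b /itvW bt0 Eb] := MVT t0 (fun s st => kd s (itvW s st)).
  apply: derivable_within_continuous => s st.
  by have [] := kd s (itvE s st).
exists a, b; split => //.
have -> : t ^+ 2 * pd [:: j; i] f (x + a *: e + b *: w) = g t - g 0.
  rewrite Ea subr0 expr2 -mulrA mulrC; congr (_ * _).
  rewrite subr0 in Eb; rewrite mulrC -Eb /k /dg scale0r addr0.
  by rewrite [x + t *: w + _]addrAC.
rewrite /g !scale0r !addr0 [x + t *: w + _]addrAC.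
by ring.
Qed.

(** The second difference is symmetric in the two directions, so the two mixed derivatives take a
    common value at points arbitrarily close to [x]; continuity at [x] concludes. *)
Lemma pd_comm (U : set 'rV[R]_d) f (i j : 'I_d) x : open U -> U x ->
  smooth_on U f -> pd [:: i; j] f x = pd [:: j; i] f x.
Proof.
move=> oU Ux sf; set e : 'rV[R]_d := delta_mx 0 i; set w : 'rV[R]_d := delta_mx 0 j.
have sU y l : U y -> differentiable (pd l f) y by move=> Uy; exact: sf.
have cij : {for x, continuous (pd [:: i; j] f)}.
  exact/differentiable_continuous/sU.
have cji : {for x, continuous (pd [:: j; i] f)}.
  exact/differentiable_continuous/sU.
apply/eqP; rewrite -subr_eq0 -normr_le0; apply/ler_addgt0Pl => eps eps0.
rewrite addr0.
have near_dist (F : 'rV[R]_d -> R) (r : R) : {for x, continuous F} -> 0 < r ->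
    \forall y \near x, `|F x - F y| < r.
  by move=> /cvgrPdist_lt cF r0; exact: cF.
have e20 : 0 < eps / 2 by rewrite divr_gt0.
have nU := open_nbhs_nbhs (conj oU Ux).
have nij := near_dist _ _ cij e20.
have nji := near_dist _ _ cji e20.
have nI := filterI nU (filterI nij nji).
have [r r0 rP] := (nbhs_ballP _ _).1 (nI _ _).
(* With this step the whole parallelogram spanned by [t *: e] and [t *: w] at [x] lies in the ball;
   the summand 1 makes the inequality strict and the denominator positive. *)
pose t := r / (`|e| + `|w| + 1).
have D0 : 0 < `|e| + `|w| + 1 by rewrite ltr_wpDl // addr_ge0.
have t0 : 0 < t by rewrite divr_gt0.
have inB a b : 0 <= a <= t -> 0 <= b <= t -> ball x r (x + a *: e + b *: w).
  move=> /andP[a0 at_] /andP[b0 bt].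
  rewrite -ball_normE /= -addrA opprD addrA subrr add0r normrN.
  apply: le_lt_trans (ler_normD _ _) _; rewrite !normrZ !ger0_norm //.
  apply: (@le_lt_trans _ _ (t * `|e| + t * `|w|)).
    by apply: lerD; apply: ler_wpM2r.
  by rewrite -mulrDr /t mulrAC ltr_pdivrMr // ltr_pM2l // ltrDl.
have [|a [b [ha hb E1]]] := @second_difference f x i j t t0.
  move=> a b ha hb; have [Uy _] := rP _ (inB a b ha hb).
  by split; [exact: (sU _ [::])|exact: sU].
have inB' a' b' : 0 <= a' <= t -> 0 <= b' <= t -> ball x r (x + a' *: w + b' *: e).
  by move=> ha' hb'; rewrite addrAC; exact: inB.
have [|a' [b' [ha' hb' E2]]] := @second_difference f x j i t t0.
  move=> c c' hc hc'; have [Uy _] := rP _ (inB' c c' hc hc').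
  by split; [exact: (sU _ [::])|exact: sU].
have [_ [_ H1]] := rP _ (inB a b ha hb).
have [_ [H2 _]] := rP _ (inB' a' b' ha' hb').
have E : pd [:: j; i] f (x + a *: e + b *: w) =
         pd [:: i; j] f (x + a' *: w + b' *: e).
  have t20 : t ^+ 2 != 0 by rewrite expf_neq0 // gt_eqF.
  apply: (mulfI t20); rewrite -[LHS]E1 -[RHS]E2.
  have -> : x + t *: delta_mx 0 j + t *: delta_mx 0 i = x + t *: e + t *: w.
    exact: addrAC.
  by congr (_ + _); exact: addrAC.
rewrite -E in H2; have := lerD (ltW H1) (ltW H2).
rewrite -splitr addrC => /(le_trans _); apply.
by rewrite [X in _ <= _ + X]distrC ler_distD.
Qed.

End schwarz.

(** * Jacobi formula and Piola identity *)

Arguments pd : simpl never.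

Section piola.
Context {R : realType}.

Lemma pd_prod d (I : eqType) (r : seq I) (f : I -> 'rV[R]_d -> R) k x :
  uniq r -> (forall j, differentiable (f j) x) ->
  pd [:: k] (fun y => \prod_(j <- r) f j y) x =
    \sum_(i <- r) pd [:: k] (f i) x * \prod_(j <- r | j != i) f j x /\
  differentiable (fun y => \prod_(j <- r) f j y) x.
Proof.
move=> ur df; elim: r ur => [_|a r IH /= /andP[ar /IH[IHe IHd]]].
  under [X in pd _ X]funext do rewrite big_nil.
  under [X in differentiable X _]funext do rewrite big_nil.
  by rewrite big_nil; split; [exact: pd_cst|exact: differentiable_cst].
under [X in pd _ X]funext do rewrite big_cons.
under [X in differentiable X _]funext do rewrite big_cons.
split; last by apply: differentiableM.
rewrite pdM // IHe big_cons; congr (_ + _).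
  rewrite big_cons eqxx /=; congr (_ * _).
  rewrite [RHS]big_seq_cond [LHS]big_seq; apply: eq_bigl => j.
  by have [jr|//] := boolP (j \in r); apply/esym; apply: contraNneq ar => <-.
rewrite mulr_sumr; apply: eq_big_seq => i ir.
rewrite big_cons ifT; last by apply: contraNneq ar => ->.
by rewrite mulrCA.
Qed.

Definition dmx d m1 m2 (k : 'I_d) (A : 'rV[R]_d -> 'M[R]_(m1, m2)) x
    : 'M[R]_(m1, m2) :=
  \matrix_(a, b) pd [:: k] (fun y => A y a b) x.

(** Jacobi's formula. Differentiating the permutation expansion gives the sum over [i] of the
    determinants in which row [i] is differentiated; the expansion of each along that row has the
    cofactors of [A] as coefficients. *)
Lemma pd_det d m k (A : 'rV[R]_d -> 'M[R]_m) x :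
  (forall a b, differentiable (fun y => A y a b) x) ->
  pd [:: k] (fun y => \det (A y)) x = \tr (dmx k A x *m \adj (A x)).
Proof.
move=> dA.
(* [B i] is [A x] with row [i] replaced by its derivative. *)
pose B i := \matrix_(a, b) if a == i then dmx k A x a b else A x a b.
have dP (s : 'S_m) := pd_prod k (index_enum_uniq 'I_m) (fun i => dA i (s i)).
rewrite /determinant.
have [-> _] := @pd_sum R d _ (index_enum 'S_m) xpredT
  (fun s y => (-1) ^+ s * \prod_i A y i (s i)) k x
  (fun s _ => differentiableM (differentiable_cst _ _) (dP s).2).
transitivity (\sum_i \det (B i)).
  rewrite /determinant exchange_big /=; apply: eq_bigr => s _.
  rewrite pdM; [|exact: differentiable_cst|exact: (dP s).2].
  rewrite pd_cst mul0r add0r (dP s).1 mulr_sumr; apply: eq_bigr => i _.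
  congr (_ * _); rewrite [RHS](bigD1 i) //= !mxE eqxx; congr (_ * _).
  by apply: eq_bigr => j /negbTE ji; rewrite mxE ji.
apply: eq_bigr => i _; rewrite (expand_det_row _ i) mxE; apply: eq_bigr => b _.
rewrite !mxE eqxx; congr (_ * _); rewrite /cofactor; congr (_ * \det _).
by apply/matrixP => a c; rewrite !mxE eq_sym (negbTE (neq_lift _ _)).
Qed.

Lemma dmxM d m1 m2 m3 k (A : 'rV[R]_d -> 'M[R]_(m1, m2))
    (B : 'rV[R]_d -> 'M[R]_(m2, m3)) x :
  (forall a b, differentiable (fun y => A y a b) x) ->
  (forall a b, differentiable (fun y => B y a b) x) ->
  dmx k (fun y => A y *m B y) x = dmx k A x *m B x + A x *m dmx k B x.
Proof.
move=> dA dB; apply/matrixP => a c; rewrite !mxE.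
under [X in pd _ X]funext do rewrite mxE.
have [-> _] := @pd_sum R d _ (index_enum 'I_m2) xpredT
  (fun b y => A y a b * B y b c) k x
  (fun b _ => differentiableM (dA a b) (dB b c)).
by rewrite -big_split; apply: eq_bigr => b _; rewrite pdM // !mxE.
Qed.

(** Rows are directions of differentiation and columns are components, as in [jacobian], which acts
    on row vectors. *)
Definition jac d m (phi : 'rV[R]_d -> 'rV[R]_m) x : 'M[R]_(d, m) :=
  \matrix_(a, i) pd [:: a] (fun y => phi y 0 i) x.

(* Differentiating [J *m adj J = det J] and Jacobi's formula reduce the
   identity to the symmetry of second derivatives. *)
Lemma piola m (phi : 'rV[R]_m -> 'rV[R]_m) (U : set 'rV[R]_m) x j :
  open U -> U x -> (forall i, smooth_on U (fun y => phi y 0 i)) ->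
  \det (jac phi x) != 0 ->
  \sum_a pd [:: a] (fun y => \adj (jac phi y) j a) x = 0.
Proof.
move=> oU Ux sphi detN0.
have sJ a b : smooth_on U (fun y => jac phi y a b).
  by apply: (eq_smooth_on oU _ (smooth_on_pd [:: a] (sphi b))) => y _; rewrite mxE.
have dJ a b : differentiable (fun y => jac phi y a b) x := smooth_on_diff (sJ a b) Ux.
have dadj a b : differentiable (fun y => \adj (jac phi y) a b) x.
  exact: smooth_on_diff (smooth_adj oU _ _ sJ) Ux.
have hess a b i : dmx a (jac phi) x b i = dmx b (jac phi) x a i.
  have E c : (fun y => jac phi y c i) = pd [:: c] (fun y => phi y 0 i).
    by apply/funext => y; rewrite mxE.
  rewrite [LHS]mxE [RHS]mxE !E.
  exact: (pd_comm a b oU Ux (sphi i)).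
pose J := jac phi x; pose ad := \adj J.
(* The derivative of [J *m \adj J = (\det J)%:M], multiplied on the left by the adjugate, is solved
   for the derivative of the adjugate without dividing by [\det J]. *)
have key a : \det J *: dmx a (fun y => \adj (jac phi y)) x =
    \tr (dmx a (jac phi) x *m ad) *: ad - ad *m dmx a (jac phi) x *m ad.
  have /esym := dmxM a dJ dadj.
  have -> : (fun y => jac phi y *m \adj (jac phi y)) =
      (fun y => (\det (jac phi y))%:M).
    by apply/funext => y; exact: mul_mx_adj.
  have -> : dmx a (fun y => (\det (jac phi y))%:M) x =
      (\tr (dmx a (jac phi) x *m ad))%:M :> 'M[R]_m.
    apply/matrixP => b c; rewrite !mxE.
    have [->|bc] := eqVneq b c.
      rewrite mulr1n -pd_det //; congr (pd _ _ _).
      by apply/funext => y; rewrite mxE eqxx.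
    rewrite mulr0n -[RHS](pd_cst 0 a x); congr (pd _ _ _).
    by apply/funext => y; rewrite mxE (negbTE bc).
  move=> /(congr1 (mulmx ad)); rewrite mulmxDr mulmxA mulmxA mul_adj_mx.
  by rewrite mul_scalar_mx mul_mx_scalar => <-; rewrite addrAC subrr add0r.
pose H a : 'M[R]_m := dmx a (jac phi) x.
have hessH a b i : H a b i = H b a i := hess a b i.
have keyH a : \det J *: dmx a (fun y => \adj (jac phi y)) x =
    \tr (H a *m ad) *: ad - ad *m H a *m ad := key a.
clear key hess; clearbody ad H.
apply: (mulfI detN0); rewrite mulr0 mulr_sumr.
have keyja a : \det J * pd [:: a] (fun y => \adj (jac phi y) j a) x =
    \sum_b \sum_i (H a b i * ad i b * ad j a
                   - ad j b * H a b i * ad i a).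
  have := congr1 (fun u : 'M[R]_m => u j a) (keyH a).
  rewrite [LHS]mxE [dmx _ _ _ _ _]mxE => ->.
  rewrite mxE [X in X + _ = _]mxE [X in _ + X = _]mxE.
  under [in RHS]eq_bigr do rewrite sumrB; rewrite sumrB; congr (_ - _).
    rewrite /mxtrace mulr_suml; apply: eq_bigr => b _; rewrite mxE mulr_suml.
    by apply: eq_bigr.
  rewrite [RHS]exchange_big mxE; apply: eq_bigr => i _.
  rewrite mxE mulr_suml.
  by apply: eq_bigr.
under eq_bigr do rewrite keyja; under eq_bigr do
  under eq_bigr do rewrite sumrB; under eq_bigr do rewrite sumrB.
(* Exchanging [a] and [b] in the second sum turns it into the first with [H b a i] in place of
   [H a b i], and these agree by the symmetry of second derivatives. *)
rewrite sumrB [X in _ - X]exchange_big /= -sumrB; apply: big1 => a _.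
rewrite -sumrB; apply: big1 => b _; rewrite -sumrB; apply: big1 => i _.
by rewrite (hessH a b i); ring.
Qed.

End piola.

(** * Complex-valued functions *)

Section complex_calculus.
Context {R : realType}.
Local Notation Re := (@complex.Re R).
Local Notation Im := (@complex.Im R).

Lemma complexE (z w : R[i]) : Re z = Re w -> Im z = Im w -> z = w.
Proof. by case: z w => [a b] [c e] /= -> ->. Qed.

Lemma cReD (z w : R[i]) : Re (z + w) = Re z + Re w.
Proof. by case: z w => [a b] [c e]. Qed.
Lemma cImD (z w : R[i]) : Im (z + w) = Im z + Im w.
Proof. by case: z w => [a b] [c e]. Qed.
Lemma cReN (z : R[i]) : Re (- z) = - Re z.
Proof. by case: z. Qed.
Lemma cImN (z : R[i]) : Im (- z) = - Im z.
Proof. by case: z. Qed.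
Lemma cReM (z w : R[i]) : Re (z * w) = Re z * Re w - Im z * Im w.
Proof. by case: z w => [a b] [c e]. Qed.
Lemma cImM (z w : R[i]) : Im (z * w) = Re z * Im w + Im z * Re w.
Proof. by case: z w => [a b] [c e]. Qed.
Lemma cReV (z : R[i]) : Re z^-1 = Re z * (Re z ^+ 2 + Im z ^+ 2)^-1.
Proof. by case: z. Qed.
Lemma cImV (z : R[i]) : Im z^-1 = - Im z * (Re z ^+ 2 + Im z ^+ 2)^-1.
Proof. by case: z => a b /=; rewrite mulNr. Qed.

Definition ReImE := (cReD, cImD, cReN, cImN, cReM, cImM).

Lemma Re_sum (I : Type) (r : seq I) (P : pred I) (F : I -> R[i]) :
  Re (\sum_(j <- r | P j) F j) = \sum_(j <- r | P j) Re (F j).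
Proof. exact: (big_morph Re cReD erefl). Qed.

Lemma Im_sum (I : Type) (r : seq I) (P : pred I) (F : I -> R[i]) :
  Im (\sum_(j <- r | P j) F j) = \sum_(j <- r | P j) Im (F j).
Proof. exact: (big_morph Im cImD erefl). Qed.

Lemma cexpD (z w : R[i]) : cexp (z + w) = cexp z * cexp w.
Proof.
by apply: complexE; rewrite /cexp !ReImE expRD cosD sinD /=; ring.
Qed.

Lemma Re_cexp (z : R[i]) : Re (cexp z) = expR (Re z) * cos (Im z).
Proof. by rewrite /cexp cReM /= mul0r subr0. Qed.

Lemma Im_cexp (z : R[i]) : Im (cexp z) = expR (Re z) * sin (Im z).
Proof. by rewrite /cexp cImM /= mul0r addr0. Qed.

Section fixed_domain.
Context {d : nat}.
Implicit Types (f g : 'rV[R]_d -> R[i]) (x : 'rV[R]_d) (U : set 'rV[R]_d).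

Definition cdiff f x :=
  differentiable (fun y => Re (f y)) x /\ differentiable (fun y => Im (f y)) x.

Lemma csmooth_cdiff U f x : csmooth_on U f -> U x -> cdiff f x.
Proof. by move=> [rf if_] Ux; split; apply: smooth_on_diff Ux. Qed.

Lemma Re_cpd l f x : Re (cpd l f x) = pd l (fun y => Re (f y)) x.
Proof. by []. Qed.

Lemma Im_cpd l f x : Im (cpd l f x) = pd l (fun y => Im (f y)) x.
Proof. by []. Qed.

Lemma cpd_cons i l f : cpd (i :: l) f = cpd [:: i] (cpd l f).
Proof. by []. Qed.

Lemma cpd_near_eq l f g x : (\near x, f x = g x) -> cpd l f x = cpd l g x.
Proof.
by move=> fg; congr Complex; apply: pd_near_eq; apply: filterS fg => y ->.
Qed.

Lemma eq_cpd U l f g x : open U -> U x -> (forall y, U y -> f y = g y) ->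
  cpd l f x = cpd l g x.
Proof.
move=> oU Ux fg; apply: cpd_near_eq.
by apply: filterS (open_nbhs_nbhs (conj oU Ux)) => y /fg.
Qed.

Lemma cdiffD f g x : cdiff f x -> cdiff g x -> cdiff (fun y => f y + g y) x.
Proof.
move=> [rf if_] [rg ig]; split.
  under [X in differentiable X _]funext do rewrite cReD.
  exact: differentiableD.
under [X in differentiable X _]funext do rewrite cImD.
exact: differentiableD.
Qed.

Lemma cdiffM f g x : cdiff f x -> cdiff g x -> cdiff (fun y => f y * g y) x.
Proof.
move=> [rf if_] [rg ig]; split.
  under [X in differentiable X _]funext do rewrite cReM.
  by apply: differentiableB; exact: differentiableM.
under [X in differentiable X _]funext do rewrite cImM.
by apply: differentiableD; exact: differentiableM.
Qed.

Lemma cdiff_cst (c : R[i]) x : cdiff (fun=> c) x.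
Proof. by split; exact: differentiable_cst. Qed.

Lemma cpdD f g i x : cdiff f x -> cdiff g x ->
  cpd [:: i] (fun y => f y + g y) x = cpd [:: i] f x + cpd [:: i] g x.
Proof.
move=> [rf if_] [rg ig]; apply: complexE; rewrite !ReImE !(Re_cpd, Im_cpd).
  by under [X in pd _ X]funext do rewrite cReD; exact: pdD.
by under [X in pd _ X]funext do rewrite cImD; exact: pdD.
Qed.

Lemma cpd_cst (c : R[i]) i x : cpd [:: i] (fun=> c) x = 0.
Proof. by apply: complexE => /=; exact: pd_cst. Qed.

Lemma cpdM f g i x : cdiff f x -> cdiff g x ->
  cpd [:: i] (fun y => f y * g y) x = cpd [:: i] f x * g x + f x * cpd [:: i] g x.
Proof.
move=> [rf if_] [rg ig].
have dM (u v : 'rV[R]_d -> R) : differentiable u x -> differentiable v x ->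
  differentiable (fun y => u y * v y) x by exact: differentiableM.
have dN (u : 'rV[R]_d -> R) : differentiable u x ->
  differentiable (fun y => - u y) x by exact: differentiableN.
apply: complexE; rewrite !ReImE !(Re_cpd, Im_cpd).
  under [X in pd _ X]funext do rewrite cReM.
  by rewrite pdD ?pdN ?pdM; [ring|auto..].
under [X in pd _ X]funext do rewrite cImM.
by rewrite pdD ?pdM; [ring|auto..].
Qed.

Lemma cpdZ (c : R[i]) f i x : cdiff f x ->
  cpd [:: i] (fun y => c * f y) x = c * cpd [:: i] f x.
Proof. by move=> df; rewrite cpdM ?cpd_cst ?mul0r ?add0r //; exact: cdiff_cst. Qed.

Lemma cpd_sum (I : Type) (r : seq I) (P : pred I) (f : I -> 'rV[R]_d -> R[i]) i x :
  (forall j, P j -> cdiff (f j) x) ->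
  cpd [:: i] (fun y => \sum_(j <- r | P j) f j y) x =
    \sum_(j <- r | P j) cpd [:: i] (f j) x /\
  cdiff (fun y => \sum_(j <- r | P j) f j y) x.
Proof.
move=> df; elim: r => [|j r [IHe IHd]].
  under [X in cpd _ X]funext do rewrite big_nil.
  under [X in cdiff X _]funext do rewrite big_nil.
  by rewrite big_nil; split; [exact: cpd_cst|exact: cdiff_cst].
under [X in cpd _ X]funext do rewrite big_cons.
under [X in cdiff X _]funext do rewrite big_cons.
rewrite big_cons; case: ifP => // Pj.
by split; [rewrite cpdD ?IHe //; exact: df|apply: cdiffD => //; exact: df].
Qed.

Lemma cdiff_real (f : 'rV[R]_d -> R) x :
  differentiable f x -> cdiff (fun y => (f y)%:C%C) x.
Proof. by move=> df; split => //; exact: differentiable_cst. Qed.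

Lemma cpd_real (f : 'rV[R]_d -> R) i x :
  cpd [:: i] (fun y => (f y)%:C%C) x = (pd [:: i] f x)%:C%C.
Proof. by apply: complexE => //=; rewrite pd_cst. Qed.

Lemma cpd_cexp f i x : cdiff f x ->
  cpd [:: i] (fun y => cexp (f y)) x = cexp (f x) * cpd [:: i] f x.
Proof.
move=> [rf if_].
have de := differentiable_comp1 rf (is_derive_expR _).
have dc := differentiable_comp1 if_ (is_derive_cos _).
have ds := differentiable_comp1 if_ (is_derive_sin _).
apply: complexE; rewrite (cReM, cImM) Re_cexp Im_cexp !(Re_cpd, Im_cpd).
  under [X in pd _ X]funext do rewrite Re_cexp.
  rewrite pdM // (pd_comp1 _ rf (is_derive_expR _)).
  by rewrite (pd_comp1 _ if_ (is_derive_cos _)); ring.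
under [X in pd _ X]funext do rewrite Im_cexp.
rewrite pdM // (pd_comp1 _ rf (is_derive_expR _)).
by rewrite (pd_comp1 _ if_ (is_derive_sin _)); ring.
Qed.

Lemma csmooth_on_sub U (V : set 'rV[R]_d) f :
  V `<=` U -> csmooth_on U f -> csmooth_on V f.
Proof. by move=> VU [rf if_]; split; exact: smooth_on_sub VU _. Qed.

Lemma csmooth_on_loc U f :
  (forall x, U x -> exists2 g, (\near x, f x = g x) &
     exists2 V : set 'rV[R]_d, V x & csmooth_on V g) -> csmooth_on U f.
Proof.
move=> H; split; apply: smooth_on_loc => x /H[g fg [V Vx [rg ig]]].
  by exists (fun y => Re (g y)); [apply: filterS fg => y ->|exists V].
by exists (fun y => Im (g y)); [apply: filterS fg => y ->|exists V].
Qed.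

Lemma csmooth_on_cpd U l f : csmooth_on U f -> csmooth_on U (cpd l f).
Proof. by move=> [rf if_]; split; exact: smooth_on_pd. Qed.

Context (U : set 'rV[R]_d) (oU : open U).

Lemma eq_csmooth_on f g : (forall x, U x -> f x = g x) ->
  csmooth_on U f -> csmooth_on U g.
Proof.
by move=> fg [rf if_]; split; [move: rf|move: if_]; apply: eq_smooth_on => // x /fg ->.
Qed.

Lemma csmooth_cst (c : R[i]) : csmooth_on U (fun=> c).
Proof. by split; exact: smooth_cst. Qed.

Lemma csmooth_real (f : 'rV[R]_d -> R) :
  smooth_on U f -> csmooth_on U (fun x => (f x)%:C%C).
Proof. by move=> sf; split => //; exact: smooth_cst. Qed.

Lemma csmoothD f g : csmooth_on U f -> csmooth_on U g ->
  csmooth_on U (fun x => f x + g x).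
Proof.
move=> [rf if_] [rg ig]; split.
  by under [X in smooth_on _ X]funext do rewrite cReD; exact: smoothD.
by under [X in smooth_on _ X]funext do rewrite cImD; exact: smoothD.
Qed.

Lemma csmoothM f g : csmooth_on U f -> csmooth_on U g ->
  csmooth_on U (fun x => f x * g x).
Proof.
move=> [rf if_] [rg ig]; split.
  under [X in smooth_on _ X]funext do rewrite cReM.
  by apply: smoothB => //; exact: smoothM.
under [X in smooth_on _ X]funext do rewrite cImM.
by apply: smoothD => //; exact: smoothM.
Qed.

Lemma csmooth_sum (I : Type) (r : seq I) (P : pred I) (f : I -> 'rV[R]_d -> R[i]) :
  (forall j, P j -> csmooth_on U (f j)) ->
  csmooth_on U (fun x => \sum_(j <- r | P j) f j x).
Proof.
move=> sf; split.
  under [X in smooth_on _ X]funext do rewrite Re_sum.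
  by apply: smooth_sum => // j /sf[].
under [X in smooth_on _ X]funext do rewrite Im_sum.
by apply: smooth_sum => // j /sf[].
Qed.

Lemma csmoothV f : (forall x, U x -> f x != 0) -> csmooth_on U f ->
  csmooth_on U (fun x => (f x)^-1).
Proof.
move=> f0 [rf if_].
have s2 : smooth_on U (fun x => (Re (f x) ^+ 2 + Im (f x) ^+ 2)^-1).
  apply: smoothV => // [x /f0|]; last by apply: smoothD => //; exact: smoothM.
  apply: contra_neq => /eqP; rewrite paddr_eq0 ?sqr_ge0 // !sqrf_eq0.
  by move=> /andP[/eqP r0 /eqP i0]; apply: complexE.
split.
  by under [X in smooth_on _ X]funext do rewrite cReV; exact: smoothM.
under [X in smooth_on _ X]funext do rewrite cImV.
by apply: smoothM => //; exact: smoothN.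
Qed.

Lemma csmooth_cexp f : csmooth_on U f -> csmooth_on U (fun x => cexp (f x)).
Proof.
move=> [rf if_]; split.
  under [X in smooth_on _ X]funext do rewrite Re_cexp.
  by apply: smoothM => //; [exact: smooth_expR|exact: smooth_cos].
under [X in smooth_on _ X]funext do rewrite Im_cexp.
by apply: smoothM => //; [exact: smooth_expR|exact: smooth_sin].
Qed.

End fixed_domain.

Lemma csmooth_comp d m (U : set 'rV[R]_d) (V : set 'rV[R]_m)
    (f : 'rV[R]_m -> R[i]) (phi : 'rV[R]_d -> 'rV[R]_m) :
  open U -> open V -> (forall x, U x -> V (phi x)) ->
  (forall a, smooth_on U (fun x => phi x 0 a)) -> csmooth_on V f ->
  csmooth_on U (fun x => f (phi x)).
Proof.
move=> oU oV UV sphi [rf if_]; split.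
  exact: (smooth_comp oU oV UV sphi rf).
exact: (smooth_comp oU oV UV sphi if_).
Qed.

Lemma cpd_comp d m (f : 'rV[R]_m -> R[i]) (phi : 'rV[R]_d -> 'rV[R]_m) i x :
  (forall a, differentiable (fun y => phi y 0 a) x) ->
  cdiff f (phi x) ->
  cpd [:: i] (fun y => f (phi y)) x =
  \sum_(a < m) (jac phi x i a)%:C%C * cpd [:: a] f (phi x).
Proof.
move=> dphi [rf if_]; apply: complexE; rewrite !(Re_cpd, Im_cpd).
  rewrite Re_sum (@pd_comp _ _ _ (fun y => Re (f y)) phi) //.
  by apply: eq_bigr => a _; rewrite cReM mxE mul0r subr0.
rewrite Im_sum (@pd_comp _ _ _ (fun y => Im (f y)) phi) //.
by apply: eq_bigr => a _; rewrite cImM mxE mul0r addr0.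
Qed.

End complex_calculus.

(** * Charts of the spacetime *)

Section charts.
Context {R : realType}.

Lemma open_preim (X Y : topologicalType) (f : X -> Y) (D : set X) (W : set Y) :
  open D -> (forall x, D x -> {for x, continuous f}) -> open W ->
  open (D `&` f @^-1` W).
Proof.
move=> oD cf oW; rewrite openE => x [Dx Wfx].
apply: filterI; first exact: open_nbhs_nbhs.
exact: (cf x Dx _ (open_nbhs_nbhs (conj oW Wfx))).
Qed.

Lemma continuous_rV (X : topologicalType) m (phi : X -> 'rV[R]_m) (x : X) :
  (forall a, {for x, continuous (fun y => phi y 0 a)}) ->
  {for x, continuous phi}.
Proof.
move=> cphi; apply/cvgrPdist_le => e e0; near=> y.
rewrite /Num.Def.normr/= mx_normrE (bigmax_le _ (ltW e0))//= => i _.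
rewrite !mxE; move: i; near: y; apply: filter_forall => -[i a] /=.
by rewrite (ord1 i); exact: (cvgrPdist_le _ _).1 (cphi a) _ e0.
Unshelve. all: by end_near. Qed.

Section general.
Context {d : nat} {X : topologicalType}.
Implicit Types c : chart R d X.

Lemma chart_cmapK c p : is_chart c -> cdom c p -> cinv c (cmap c p) = p.
Proof. by move=> [_ _ cK _ _]; exact: cK. Qed.

Lemma chart_cinvK c x : is_chart c -> crange c x ->
  cdom c (cinv c x) /\ cmap c (cinv c x) = x.
Proof. by move=> ic [p dp <-]; rewrite chart_cmapK. Qed.

Lemma crange_cmap c p : cdom c p -> crange c (cmap c p).
Proof. by move=> dp; exists p. Qed.

(** Writing the image of an overlap as a preimage under [cinv] reduces its openness to the
    continuity of [cinv] on [crange c]. *)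
Lemma chart_overlapE c (W : set X) : is_chart c ->
  cmap c @` (cdom c `&` W) = crange c `&` cinv c @^-1` W.
Proof.
move=> ic; apply/seteqP; split=> [x [p [dp Wp] <-]|x [rx Wx]].
  by split; [exists p|rewrite /= chart_cmapK].
by have [dx xE] := chart_cinvK ic rx; exists (cinv c x).
Qed.

Lemma open_chart_overlap c (W : set X) : is_chart c -> open W ->
  open (cmap c @` (cdom c `&` W)).
Proof.
move=> ic oW; rewrite chart_overlapE //; have [_ or _ _ ci] := ic.
exact: open_preim.
Qed.

End general.

Section manifolds.
Context {n : nat} (M : manifold R n).
Implicit Types p q : spacetime M.

Lemma st_chart_crangeE p :
  crange (st_chart p) = [set z : 'rV[R]_(1 + n) | crange (chart_at p.2) (rsubmx z)].
Proof.
apply/seteqP; split=> [z [[t y] /= dy <-]|z /= [y dy yE]].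
  by rewrite /= row_mxKr; exists y.
have zE : (z 0 ord0)%:M = @lsubmx R 1 1 n z.
  apply/matrixP => i j; rewrite !ord1 !mxE /= mulr1n; congr (z _ _).
  exact/val_inj.
by exists (z 0 ord0, y) => //=; rewrite yE zE; exact: (@hsubmxK _ 1 1 n z).
Qed.

Lemma st_chart_is_chart p : is_chart (st_chart p).
Proof.
have [od or cK cm ci] := chart_at_is_chart p.2.
have cn : continuous (rsubmx : 'rV[R]_(1 + n) -> 'rV[R]_n).
  exact: continuous_rsubmx.
split.
- apply: open_comp od => x _; exact: cvg_snd.
- by rewrite st_chart_crangeE; apply: open_comp or => x _; exact: cn.
- move=> [t y] /= dy; rewrite row_mxKr cK //; congr pair.
  by rewrite mxE; case: splitP => // j _; rewrite ord1 mxE eqxx.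
- move=> [t y] /= dy; apply: continuous_rV => a.
  case: (@split_ordP 1 n a) => j ->.
    rewrite (_ : (fun _ => _) = fun q : R * M => q.1); first exact: cvg_fst.
    by apply/funext => q /=; rewrite (@row_mxEl _ 1 1 n) !ord1 mxE eqxx mulr1n.
  rewrite (_ : (fun _ => _) = fun q : R * M => cmap (chart_at p.2) q.2 0 j);
    last by apply/funext => q /=; rewrite (@row_mxEr _ 1 1 n).
  apply: (@continuous_comp _ _ _ (fun q : R * M => cmap (chart_at p.2) q.2)
            (fun x : 'rV[R]_n => x 0 j)); last exact: coord_continuous.
  apply: (@continuous_comp _ _ _ (fun q : R * M => q.2)); first exact: cvg_snd.
  exact: cm.
- rewrite st_chart_crangeE => z /= rz.
  have c0 : {for z, continuous (fun x : 'rV[R]_(1 + n) => x 0 ord0)}.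
    exact: coord_continuous.
  have c1 : {for z, continuous (fun x : 'rV[R]_(1 + n) =>
      cinv (chart_at p.2) (rsubmx x))}.
    by apply: continuous_comp; [exact: cn|exact: ci].
  exact: cvg_pair c0 c1.
Qed.

Lemma st_chart_dom p : cdom (st_chart p) p.
Proof. exact: chart_at_dom. Qed.

Lemma st_chart_compatible p q : compatible (st_chart p) (st_chart q).
Proof.
suff H p' q' a : smooth_on (cmap (st_chart p') @`
      (cdom (st_chart p') `&` cdom (st_chart q')))
      (fun x => transition (st_chart p') (st_chart q') x 0 a).
  by move=> a; split; [|rewrite setIC]; exact: H.
have iB := chart_at_is_chart p'.2.
have oB : open (cmap (chart_at p'.2) @` (cdom (chart_at p'.2) `&` cdom (chart_at q'.2))).
  by apply: open_chart_overlap => //; have [] := chart_at_is_chart q'.2.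
set V := cmap _ @` _ in oB.
have ip := st_chart_is_chart p'.
set U := cmap _ @` _.
have oU : open U.
  by apply: open_chart_overlap => //; have [] := st_chart_is_chart q'.
have UV z : U z -> V (rsubmx (z : 'rV[R]_(1 + n))).
  by move=> [[t y] /= [d1 d2] <-]; rewrite row_mxKr; exists y.
have srs b : smooth_on U (fun z : 'rV[R]_(1 + n) => rsubmx z 0 b).
  by apply: eq_smooth_on oU _ (smooth_coord oU (rshift 1 b)) => z _; rewrite mxE.
case: (@split_ordP 1 n a) => j ->.
  apply: (eq_smooth_on oU _ (smooth_coord oU ord0)) => z _.
  by rewrite /transition /= (@row_mxEl _ 1 1 n) ord1 mxE eqxx mulr1n.
have [sT _] := chart_at_compatible p'.2 q'.2 j.
apply: (eq_smooth_on oU _ (smooth_comp oU oB UV srs sT)) => z _.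
by rewrite /transition /= (@row_mxEr _ 1 1 n).
Qed.

Lemma st_chart_smooth p : smooth_chart (st_chart p).
Proof. by split; [exact: st_chart_is_chart|exact: st_chart_compatible]. Qed.

Lemma open_crange (c : chart R n.+1 (spacetime M)) : is_chart c -> open (crange c).
Proof. by case. Qed.

(** [csmooth] tests only the product charts [st_chart p]. Near [x], any chart of the maximal atlas
    factors through the product chart at the point of coordinates [x] by a smooth transition map. *)
Lemma csmooth_chart (c : chart R n.+1 (spacetime M)) (u : spacetime M -> R[i]) :
  smooth_chart c -> csmooth u -> csmooth_on (crange c) (fun x => u (cinv c x)).
Proof.
move=> [ic cc] su; apply: csmooth_on_loc => x rx.
have [dx xE] := chart_cinvK ic rx.
pose p := cinv c x; pose c' := st_chart p.
have ic' := st_chart_is_chart p; have [od' or' _ _ _] := ic'.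
pose O := cmap c @` (cdom c `&` cdom c').
have oO : open O by exact: open_chart_overlap.
have Ox : O x by exists p => //; split => //; exact: st_chart_dom.
have OE y : O y -> crange c' (transition c c' y) /\
    u (cinv c y) = u (cinv c' (transition c c' y)).
  rewrite /O chart_overlapE // => -[ry dy].
  split; first exact: crange_cmap.
  by rewrite /transition chart_cmapK.
exists (fun y => u (cinv c' (transition c c' y))).
  by apply: filterS (open_nbhs_nbhs (conj oO Ox)) => y /OE[].
exists O => //; apply: (csmooth_comp oO or' _ _ (su p)).
  by move=> y /OE[].
by move=> a; have [] := cc p a.
Qed.

End manifolds.

End charts.

(** * Coordinate expressions of the operators *)

Lemma jacobianE (R : realType) d m (phi : 'rV[R]_d -> 'rV[R]_m) x :
  differentiable phi x -> jacobian phi x = jac phi x.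
Proof.
move=> dphi; apply/matrixP => a i.
have -> : jacobian phi x a i = 'd phi x (delta_mx 0 a) 0 i by rewrite mxE.
have -> : 'd phi x (delta_mx 0 a) = 'D_(delta_mx 0 a) phi x by rewrite deriveE.
by rewrite derive_mx ?mxE //; exact: diff_derivable.
Qed.

Section operators.
Context {R : realType} {n : nat} {M : manifold R n} (g : lorentz_metric M).
Notation rchart := (chart R n.+1 (spacetime M)).
Implicit Types (c : rchart) (u v : spacetime M -> R[i]) (x : 'rV[R]_n.+1).

(** The vector density |g|^{1/2} g^{ab} d_b u, whose coordinate divergence is box u up to the factor
    -|g|^{-1/2}. *)
Definition flux c u (a : 'I_n.+1) x : R[i] :=
  \sum_(b < n.+1) (gvol g c x * gup g c x a b)%:C%C *
    cpd [:: b] (fun y => u (cinv c y)) x.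

(** Unlike [box], which uses at each point the chart of that point, [cbox] keeps one chart fixed and
    can thus be differentiated; [cgrad] plays the same role for [gradp]. *)
Definition cbox c u x : R[i] :=
  - ((gvol g c x)^-1)%:C%C * \sum_(a < n.+1) cpd [:: a] (flux c u a) x.

Definition cgrad c u v x : R[i] :=
  \sum_(a < n.+1) \sum_(b < n.+1) (gup g c x a b)%:C%C *
    cpd [:: a] (fun y => u (cinv c y)) x * cpd [:: b] (fun y => v (cinv c y)) x.

Local Notation rc := (map_mx (real_complex R)).

Definition cdmx c u x : 'cV[R[i]]_n.+1 :=
  \col_b cpd [:: b] (fun y => u (cinv c y)) x.

Lemma fluxE c u a x :
  flux c u a x = (gvol g c x)%:C%C * (rc (invmx (g c x)) *m cdmx c u x) a 0.
Proof.
rewrite mxE mulr_sumr; apply: eq_bigr => b _.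
by rewrite !mxE rmorphM mulrA.
Qed.

Lemma cgradE c u v x :
  cgrad c u v x = ((cdmx c u x)^T *m rc (invmx (g c x)) *m cdmx c v x) 0 0.
Proof.
rewrite /cgrad exchange_big mxE; apply: eq_bigr => b _.
rewrite mxE mulr_suml; apply: eq_bigr => a _.
by rewrite !mxE [_ * cpd [:: a] _ _]mulrC.
Qed.

Section one_chart.
Context (c : rchart) (sc : smooth_chart c).

Let oc : open (crange c) := open_crange sc.1.

(** The signature gives [\det P ^+ 2 * \det g = -1]. The definite sign also removes the absolute
    value in [gvol], hence its smoothness. *)
Lemma gdet_lt0 x : crange c x -> \det (g c x) < 0.
Proof.
move=> rx; have [P uP /(congr1 determinant)] := metric_signature g sc rx.
rewrite !det_mulmx det_tr det_diag big_ord_recl mxE eqxx big1 => [|i _].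
  rewrite mulr1 mulrAC -expr2 => E.
  have P2 : 0 < \det P ^+ 2.
    by rewrite lt0r sqr_ge0 andbT expf_neq0 // -unitfE -unitmxE.
  by rewrite -(pmulr_rlt0 _ P2) E ltrN10.
by rewrite mxE.
Qed.

Lemma g_unit x : crange c x -> g c x \in unitmx.
Proof. by move=> /gdet_lt0 g0; rewrite unitmxE unitfE lt_eqF. Qed.

Lemma gvol_gt0 x : crange c x -> 0 < gvol g c x.
Proof. by move=> /gdet_lt0 g0; rewrite sqrtr_gt0 normr_gt0 lt_eqF. Qed.

Lemma smooth_gup a b : smooth_on (crange c) (fun x => gup g c x a b).
Proof. exact: (smooth_invmx oc _ _ g_unit (metric_smooth g sc)). Qed.

Lemma smooth_gvol : smooth_on (crange c) (gvol g c).
Proof.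
have s : smooth_on (crange c) (fun x => - \det (g c x)).
  by apply: smoothN => //; apply: smooth_det => //; exact: metric_smooth.
have s0 x : crange c x -> 0 < - \det (g c x).
  by move=> /gdet_lt0; rewrite oppr_gt0.
apply: (eq_smooth_on oc _ (smooth_sqrt oc s0 s)) => x rx.
by rewrite /gvol ltr0_norm // gdet_lt0.
Qed.

Lemma gup_sym x a b : crange c x -> gup g c x a b = gup g c x b a.
Proof.
move=> rx; rewrite /gup -[in LHS](Defs.metric_sym g sc rx).
by rewrite -trmx_inv mxE.
Qed.

Lemma csmooth_flux u a : csmooth_on (crange c) (fun x => u (cinv c x)) ->
  csmooth_on (crange c) (flux c u a).
Proof.
move=> su; apply: csmooth_sum => // b _; apply: csmoothM => //.
  by apply: csmooth_real => //; apply: smoothM => //; [exact: smooth_gvol|exact: smooth_gup].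
exact: csmooth_on_cpd.
Qed.

Lemma csmooth_cbox u : csmooth_on (crange c) (fun x => u (cinv c x)) ->
  csmooth_on (crange c) (cbox c u).
Proof.
move=> su; apply: csmoothM => //.
  have s := smoothV oc (fun x rx => lt0r_neq0 (gvol_gt0 rx)) smooth_gvol.
  have := csmoothM oc (csmooth_cst oc (-1)) (csmooth_real oc s).
  by apply: eq_csmooth_on => // x _; rewrite mulN1r.
apply: csmooth_sum => // a _.
exact/csmooth_on_cpd/csmooth_flux.
Qed.

Lemma csmooth_cgrad u v : csmooth_on (crange c) (fun x => u (cinv c x)) ->
  csmooth_on (crange c) (fun x => v (cinv c x)) ->
  csmooth_on (crange c) (cgrad c u v).
Proof.
move=> su sv; apply: csmooth_sum => // a _; apply: csmooth_sum => // b _.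
apply: csmoothM => //; last exact: csmooth_on_cpd.
apply: csmoothM => //; last exact: csmooth_on_cpd.
by apply: csmooth_real => //; exact: smooth_gup.
Qed.

End one_chart.

(** * Invariance of the operators under changes of chart *)

Section change_of_chart.
Context (c c' : rchart) (sc : smooth_chart c) (sc' : smooth_chart c').
Context (cc : compatible c c').

Let O := cmap c @` (cdom c `&` cdom c').
Let phi := transition c c'.

Let oO : open O.
Proof. by apply: open_chart_overlap sc.1 _; have [[]] := sc'. Qed.

Let phi_smooth a : smooth_on O (fun x => phi x 0 a).
Proof. by have [] := cc a. Qed.

Let phi_diff x : O x -> forall a, differentiable (fun y => phi y 0 a) x.
Proof. by move=> Ox a; exact: smooth_on_diff (phi_smooth a) Ox. Qed.

Let O_range x : O x -> crange c x /\ crange c' (phi x).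
Proof.
move=> [p [dp dp'] <-]; split; first exact: crange_cmap.
by rewrite /phi /transition (chart_cmapK sc.1 dp); exact: crange_cmap.
Qed.

Let cinv_phi x : O x -> cinv c x = cinv c' (phi x).
Proof.
move=> [p [dp dp'] <-]; rewrite /phi /transition (chart_cmapK sc.1 dp).
by rewrite (chart_cmapK sc'.1 dp').
Qed.

Lemma metric_jac x : O x ->
  g c x = jac phi x *m g c' (phi x) *m (jac phi x)^T.
Proof.
move=> Ox; rewrite -jacobianE; last exact/differentiable_rV/phi_diff.
have [p [dp dp'] xE] := Ox.
have phix : phi x = cmap c' p by rewrite -xE /phi /transition (chart_cmapK sc.1 dp).
by have := metric_transform g sc sc' dp dp'; rewrite xE -phix.
Qed.

Lemma det_metric_jac x : O x ->
  \det (g c x) = \det (jac phi x) ^+ 2 * \det (g c' (phi x)).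
Proof.
by move=> Ox; rewrite (metric_jac Ox) !det_mulmx det_tr mulrAC -expr2.
Qed.

Lemma det_jac_neq0 x : O x -> \det (jac phi x) != 0.
Proof.
move=> Ox; have := gdet_lt0 sc (O_range Ox).1.
by rewrite (det_metric_jac Ox); apply: contraTneq => ->; rewrite expr0n mul0r ltxx.
Qed.

Lemma gvol_jac x : O x -> gvol g c x = `|\det (jac phi x)| * gvol g c' (phi x).
Proof.
move=> Ox; rewrite /gvol (det_metric_jac Ox) normrM normrX sqrtrM ?sqr_ge0 //.
by rewrite sqrtr_sqr normr_id.
Qed.

Lemma gup_jac x : O x ->
  (jac phi x)^T *m invmx (g c x) *m jac phi x = invmx (g c' (phi x)).
Proof.
move=> Ox; have [r r'] := O_range Ox.
have u := g_unit sc r; have u' := g_unit sc' r'.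
have uJ : jac phi x \in unitmx by rewrite unitmxE unitfE; exact: det_jac_neq0.
have gJ := metric_jac Ox; set J := jac phi x in uJ gJ *.
have E : J^T *m invmx (g c x) *m J *m g c' (phi x) = 1%:M.
  have -> : J^T *m invmx (g c x) *m J *m g c' (phi x) =
      J^T *m (invmx (g c x) *m (J *m g c' (phi x) *m J^T)) *m invmx J^T.
    by rewrite !mulmxA mulmxK // unitmx_tr.
  by rewrite -gJ mulVmx // mulmx1 mulmxV // unitmx_tr.
by rewrite -[LHS]mulmx1 -(mulmxV u') mulmxA E mul1mx.
Qed.

Lemma cdmx_chart u x : O x -> csmooth_on (crange c') (fun y => u (cinv c' y)) ->
  cdmx c u x = rc (jac phi x) *m cdmx c' u (phi x).
Proof.
move=> Ox su; have [_ r'] := O_range Ox.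
apply/matrixP => b j; rewrite mxE [RHS]mxE.
transitivity (cpd [:: b] (fun y => u (cinv c' (phi y))) x).
  by apply: (eq_cpd _ oO Ox) => y /cinv_phi ->.
rewrite (@cpd_comp R _ _ (fun y => u (cinv c' y)) phi); last 2 first.
- exact: phi_diff.
- exact: csmooth_cdiff su r'.
by apply: eq_bigr => i _; rewrite [rc _ _ _]mxE [cdmx _ _ _ _ _]mxE.
Qed.

Lemma cgrad_change u v x : O x ->
  csmooth_on (crange c') (fun y => u (cinv c' y)) ->
  csmooth_on (crange c') (fun y => v (cinv c' y)) ->
  cgrad c u v x = cgrad c' u v (phi x).
Proof.
move=> Ox su sv; rewrite !cgradE (cdmx_chart Ox su) (cdmx_chart Ox sv).
by rewrite -(gup_jac Ox) !map_mxM -matrix.map_trmx trmx_mul !mulmxA.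
Qed.

(** The density contributes |det J| and the inverse metric, expressed in the other chart, a factor
    J^{-1}; together they form the adjugate up to the sign of det J. This is the matrix whose
    divergence the Piola identity kills. *)
Lemma flux_change u a x : O x -> csmooth_on (crange c') (fun y => u (cinv c' y)) ->
  flux c u a x = \sum_j (Num.sg (\det (jac phi x)) * \adj (jac phi x) j a)%:C%C *
    flux c' u j (phi x).
Proof.
move=> Ox su; rewrite fluxE (cdmx_chart Ox su) (gvol_jac Ox) mulmxA -map_mxM.
set J := jac phi x; set G := invmx (g c x).
(* From [J^T *m G *m J = g'^-1], multiplied on the left by the transposed adjugate. *)
have E : \det J *: (G *m J) = (\adj J)^T *m invmx (g c' (phi x)).
  rewrite -(gup_jac Ox) -/J -/G !mulmxA -trmx_mul mul_mx_adj tr_scalar_mx.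
  by rewrite -mulmxA mul_scalar_mx.
have E2 : (\det J)%:C%C * (rc (G *m J) *m cdmx c' u (phi x)) a 0 =
    (rc ((\adj J)^T *m invmx (g c' (phi x))) *m cdmx c' u (phi x)) a 0.
  by rewrite -E map_mxZ -scalemxAl [RHS]mxE.
move: E2; set X := (_ *m _) a 0 => E2; rewrite normrEsg.
transitivity ((Num.sg (\det J))%:C%C * (gvol g c' (phi x))%:C%C *
  ((\det J)%:C%C * X)); first by ring.
rewrite E2 map_mxM -mulmxA mxE mulr_sumr; apply: eq_bigr => j _.
rewrite fluxE [rc _ a j]mxE [_^T a j]mxE; ring.
Qed.

(** In the divergence of [flux_change], the terms that differentiate the adjugate vanish by the
    Piola identity. In the others the chain rule produces adj J J = det J, so the divergence is
    multiplied by |det J|, and the ratio of the two volume factors cancels this. *)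
Lemma cbox_change u x : O x -> csmooth_on (crange c') (fun y => u (cinv c' y)) ->
  cbox c u x = cbox c' u (phi x).
Proof.
move=> Ox su; have [r r'] := O_range Ox.
pose J := jac phi x; pose s := Num.sg (\det J).
have sJ a b : smooth_on O (fun y => jac phi y a b).
  apply: (eq_smooth_on oO _ (smooth_on_pd [:: a] (phi_smooth b))) => y _.
  by rewrite mxE.
have sadj a b := smooth_adj oO a b sJ.
(* The sign of the nonvanishing continuous determinant is locally constant, so it is a constant
   factor under differentiation. *)
have sgJ : \near x, Num.sg (\det (jac phi x)) = s.
  have cdet : {for x, continuous (fun y => \det (jac phi y))}.
    exact/differentiable_continuous/(smooth_on_diff (smooth_det oO sJ) Ox).
  have dN0 := det_jac_neq0 Ox; rewrite /s.
  have [d0|d0|/eqP] := ltrgtP (\det J) 0; last by rewrite (negbTE dN0).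
    have := cvgr_lt _ cdet _ d0.
    by move=> /(_ _); apply: filterS => y y0; rewrite !ltr0_sg.
  have := cvgr_gt _ cdet _ d0.
  by move=> /(_ _); apply: filterS => y y0; rewrite !gtr0_sg.
pose W j y : R[i] := flux c' u j (phi y).
have sW j : csmooth_on O (W j).
  apply: (csmooth_comp oO (open_crange sc'.1) _ phi_smooth (csmooth_flux sc' j su)).
  by move=> y /O_range[].
have dW j : cdiff (W j) x := csmooth_cdiff (sW j) Ox.
pose A a j y : R[i] := (s * \adj (jac phi y) j a)%:C%C.
have dsadj a j : differentiable (fun y => s * \adj (jac phi y) j a) x.
  apply: differentiableM; first exact: differentiable_cst.
  exact: smooth_on_diff (sadj j a) Ox.
have dA a j : cdiff (A a j) x by exact: cdiff_real.
have step a : cpd [:: a] (flux c u a) x = \sum_j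
    ((s * pd [:: a] (fun y => \adj (jac phi y) j a) x)%:C%C * W j x +
     A a j x * \sum_k (J a k)%:C%C * cpd [:: k] (flux c' u j) (phi x)).
  transitivity (cpd [:: a] (fun y => \sum_j A a j y * W j y) x).
    apply: cpd_near_eq; apply: filterS2 (open_nbhs_nbhs (conj oO Ox)) sgJ.
    by move=> y Oy sy; rewrite [LHS](flux_change a Oy su) sy.
  have [-> _] := @cpd_sum R _ _ (index_enum 'I_n.+1) xpredT
    (fun j y => A a j y * W j y) a x (fun j _ => cdiffM (dA a j) (dW j)).
  apply: eq_bigr => j _; rewrite cpdM //; congr (_ * _ + _ * _).
    have dadj := smooth_on_diff (sadj j a) Ox.
    by rewrite /A cpd_real (pdM a (differentiable_cst _ _) dadj) pd_cst mul0r add0r.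
  apply: cpd_comp; first exact: phi_diff.
  exact: csmooth_cdiff (csmooth_flux sc' j su) r'.
pose B a j := pd [:: a] (fun y => \adj (jac phi y) j a) x.
have pioB j : \sum_a B a j = 0 := piola j oO Ox phi_smooth (det_jac_neq0 Ox).
pose dF k j := cpd [:: k] (flux c' u j) (phi x).
have {}step a : cpd [:: a] (flux c u a) x = \sum_j
    ((s * B a j)%:C%C * W j x +
     (s * \adj J j a)%:C%C * \sum_k (J a k)%:C%C * dF k j) := step a.
have adjJ j k : \sum_a \adj J j a * J a k = \det J *+ (j == k).
  by have /matrixP/(_ j k) := mul_adj_mx J; rewrite !mxE.
have S1 : \sum_a cpd [:: a] (flux c u a) x = (`|\det J|)%:C%C * \sum_j dF j j.
  clearbody B dF; rewrite (eq_bigr _ (fun a _ => step a)).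
  rewrite exchange_big mulr_sumr; apply: eq_bigr => j _; rewrite big_split /=.
  have -> : \sum_a (s * B a j)%:C%C * W j x = 0.
    by rewrite -mulr_suml -rmorph_sum -mulr_sumr pioB mulr0 mul0r.
  rewrite add0r.
  under eq_bigr do rewrite mulr_sumr.
  rewrite exchange_big /=.
  (* The adjugate times [J] is scalar, so only the diagonal index [k = j] survives. *)
  rewrite (bigD1 j) //= [X in _ + X]big1 ?addr0 => [|k kj].
    under eq_bigr do rewrite mulrA -rmorphM -mulrA.
    rewrite -mulr_suml -rmorph_sum -mulr_sumr adjJ eqxx mulr1n.
    by rewrite normrEsg.
  under eq_bigr do rewrite mulrA -rmorphM -mulrA.
  rewrite -mulr_suml -rmorph_sum -mulr_sumr adjJ eq_sym (negbTE kj).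
  by rewrite mulr0n mulr0 mul0r.
have dJ0 : `|\det J| != 0 by rewrite normr_eq0; exact: det_jac_neq0 Ox.
transitivity (- ((gvol g c x)^-1)%:C%C * ((`|\det J|)%:C%C * \sum_j dF j j)).
  by congr (_ * _); exact: S1.
rewrite mulrA [RHS]/(_ * \sum_j dF j j); congr (_ * _).
rewrite (gvol_jac Ox) -/J invfM rmorphM !mulNr; congr (- _).
by rewrite mulrAC -rmorphM mulVf ?mul1r.
Qed.

End change_of_chart.

End operators.

(** * Closure properties of smooth functions on the spacetime *)

Section csmooth_closure.
Context {R : realType} {n : nat} {M : manifold R n}.
Implicit Types (u v : spacetime M -> R[i]).

Let oc (p : spacetime M) : open (crange (st_chart p)) :=
  open_crange (st_chart_is_chart p).

Lemma csm_cst (a : R[i]) : csmooth (fun _ : spacetime M => a).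
Proof. by move=> p; exact: csmooth_cst. Qed.

Lemma csmD u v : csmooth u -> csmooth v -> csmooth (fun p => u p + v p).
Proof. by move=> su sv p; exact: csmoothD. Qed.

Lemma csmM u v : csmooth u -> csmooth v -> csmooth (fun p => u p * v p).
Proof. by move=> su sv p; exact: csmoothM. Qed.

Lemma csmN u : csmooth u -> csmooth (fun p => - u p).
Proof.
move=> su; have := csmM (csm_cst (-1)) su.
by congr csmooth; apply/funext => p; rewrite mulN1r.
Qed.

Lemma csmB u v : csmooth u -> csmooth v -> csmooth (fun p => u p - v p).
Proof. by move=> su sv; apply: csmD => //; exact: csmN. Qed.

Lemma csm_sum (I : Type) (r : seq I) (P : pred I) (u : I -> spacetime M -> R[i]) :
  (forall j, P j -> csmooth (u j)) -> csmooth (fun p => \sum_(j <- r | P j) u j p).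
Proof. by move=> su p; apply: csmooth_sum => // j /su. Qed.

Lemma csm_cexp u : csmooth u -> csmooth (fun p => cexp (u p)).
Proof. by move=> su p; exact: csmooth_cexp. Qed.

Lemma near_cinv (c : chart R n.+1 (spacetime M)) (P : set (spacetime M)) p :
  is_chart c -> cdom c p -> (\near p, P p) -> \forall x \near cmap c p, P (cinv c x).
Proof.
move=> ic dp nP; have [_ _ _ _ ci] := ic.
have nP' : nbhs (cinv c (cmap c p)) P by rewrite (chart_cmapK ic dp).
exact: (ci _ (crange_cmap dp) _ nP').
Qed.

(** Off the closed set [A] the numerator vanishes on a neighbourhood, so the quotient is locally 0
    whatever [v] does there; at points of [A] the denominator is nonzero, hence nonzero nearby. *)
Lemma csmV0 u v (A : set (spacetime M)) : closed A -> csmooth u ->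
  (forall p, ~ A p -> u p = 0) -> csmooth v -> (forall p, A p -> v p != 0) ->
  csmooth (fun p => u p / v p).
Proof.
move=> cA su u0 sv v0 q; apply: csmooth_on_loc => x rx.
have iq := st_chart_is_chart q; have [dx xE] := chart_cinvK iq rx.
have [Ap|nAp] := pselect (A (cinv (st_chart q) x)); last first.
  exists (fun=> 0); last by exists setT => //; exact: csmooth_cst openT _.
  have nA : nbhs (cinv (st_chart q) x) (~` A).
    by apply: open_nbhs_nbhs; split => //; exact: closed_openC.
  have := near_cinv iq dx nA; rewrite xE; apply: filterS => y nAy.
  by rewrite u0 // mul0r.
set U := fun x => u (cinv (st_chart q) x); set V := fun x => v (cinv (st_chart q) x).
have [rV iV] : csmooth_on (crange (st_chart q)) V := sv q.
(* The squared modulus of the denominator: a smooth real function, so the set where it is nonzero is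
   open. *)
pose N y := complex.Re (V y) * complex.Re (V y) + complex.Im (V y) * complex.Im (V y).
have sN : smooth_on (crange (st_chart q)) N.
  by apply: smoothD => //; exact: smoothM.
have N0 y : (N y == 0) = (V y == 0).
  rewrite /N -!expr2 paddr_eq0 ?sqr_ge0 // !sqrf_eq0.
  apply/idP/idP => [/andP[/eqP r0 /eqP i0]|/eqP ->]; last by rewrite !eqxx.
  exact/eqP/complexE.
pose W := crange (st_chart q) `&` N @^-1` [set z | z != 0].
have oW : open W.
  apply: open_preim => // y ry.
  exact/differentiable_continuous/(smooth_on_diff sN ry).
exists (fun y => U y / V y); first by apply: filterE.
exists W; first by split => //=; rewrite N0; exact: v0.
have sub : W `<=` crange (st_chart q) by move=> y [].
apply: csmoothM => //; first exact: csmooth_on_sub sub (su q).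
apply: csmoothV => // [y [_ /=]|]; first by rewrite N0.
exact: csmooth_on_sub sub (sv q).
Qed.

End csmooth_closure.

(** * Product and exponential rules for the gradient and the wave operator *)

Section leibniz.
Context {R : realType} {n : nat} {M : manifold R n} (g : lorentz_metric M).
Implicit Types (u v : spacetime M -> R[i]) (p : spacetime M).

Lemma boxE u p : box g u p = cbox g (st_chart p) u (cmap (st_chart p) p).
Proof. by []. Qed.

Lemma gradpE u v p : gradp g u v p = cgrad g (st_chart p) u v (cmap (st_chart p) p).
Proof. by []. Qed.

Lemma overlap_mem p q x : crange (st_chart q) x -> p = cinv (st_chart q) x ->
  (cmap (st_chart q) @` (cdom (st_chart q) `&` cdom (st_chart p))) x /\
  transition (st_chart q) (st_chart p) x = cmap (st_chart p) p.
Proof.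
move=> rx pE; have [dx xE] := chart_cinvK (st_chart_is_chart q) rx.
rewrite /transition -pE; split => //; rewrite -xE -pE; exists p => //.
by split; [rewrite pE|exact: st_chart_dom].
Qed.

Lemma csmooth_gradp u v : csmooth u -> csmooth v -> csmooth (gradp g u v).
Proof.
move=> su sv q; have sq := st_chart_smooth q.
apply: eq_csmooth_on (csmooth_cgrad g sq (su q) (sv q)).
  exact: open_crange sq.1.
move=> x rx; set p := cinv (st_chart q) x.
have [Ox xE] := overlap_mem rx (erefl p).
rewrite gradpE -xE; apply: cgrad_change Ox (su p) (sv p) => //.
  exact: st_chart_smooth.
exact: st_chart_compatible.
Qed.

Lemma csmooth_box u : csmooth u -> csmooth (box g u).
Proof.
move=> su q; have sq := st_chart_smooth q.
apply: eq_csmooth_on (csmooth_cbox g sq (su q)).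
  exact: open_crange sq.1.
move=> x rx; set p := cinv (st_chart q) x.
have [Ox xE] := overlap_mem rx (erefl p).
rewrite boxE -xE; apply: cbox_change Ox (su p) => //.
  exact: st_chart_smooth.
exact: st_chart_compatible.
Qed.

Section in_chart.
Context (c : chart R n.+1 (spacetime M)) (sc : smooth_chart c).
Implicit Types x : 'rV[R]_n.+1.
Local Notation rep u := (fun x => u (cinv c x)).

Let oc : open (crange c) := open_crange sc.1.

Let cd u x : csmooth u -> crange c x -> cdiff (rep u) x.
Proof. by move=> su rx; exact: csmooth_cdiff (csmooth_chart sc su) rx. Qed.

Lemma cdmx_near_eq u v x : (\near x, u (cinv c x) = v (cinv c x)) ->
  cdmx c u x = cdmx c v x.
Proof. by move=> uv; apply/matrixP => a b; rewrite !mxE; exact: cpd_near_eq. Qed.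

Lemma cgrad_near_eq u v w x : (\near x, v (cinv c x) = w (cinv c x)) ->
  cgrad g c u v x = cgrad g c u w x.
Proof. by move=> /cdmx_near_eq E; rewrite !cgradE E. Qed.

Lemma cbox_near_eq u v x : (\near x, u (cinv c x) = v (cinv c x)) ->
  cbox g c u x = cbox g c v x.
Proof.
move=> uv; apply: (congr1 (fun z => - ((gvol g c x)^-1)%:C%C * z)).
apply: eq_bigr => a _; apply: cpd_near_eq.
by move/nbhs_interior : uv; apply: filterS => y uvy; rewrite !fluxE (cdmx_near_eq uvy).
Qed.

Lemma cgradC u v x : crange c x -> cgrad g c u v x = cgrad g c v u x.
Proof.
move=> rx; rewrite /cgrad exchange_big; apply: eq_bigr => b _; apply: eq_bigr => a _.
by rewrite (gup_sym g sc _ _ rx) mulrAC.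
Qed.

Lemma cdmxD u v x : csmooth u -> csmooth v -> crange c x ->
  cdmx c (fun p => u p + v p) x = cdmx c u x + cdmx c v x.
Proof.
move=> su sv rx; apply/matrixP => a b; rewrite !mxE.
by apply: (@cpdD _ _ (rep u) (rep v)); exact: cd.
Qed.

Lemma cdmxM u v x : csmooth u -> csmooth v -> crange c x ->
  cdmx c (fun p => u p * v p) x =
  u (cinv c x) *: cdmx c v x + v (cinv c x) *: cdmx c u x.
Proof.
move=> su sv rx; apply/matrixP => a b; rewrite !mxE.
rewrite (@cpdM _ _ (rep u) (rep v)); [|exact: cd..].
by rewrite addrC; congr (_ + _); rewrite mulrC.
Qed.

Lemma cdmx_cexp u x : csmooth u -> crange c x ->
  cdmx c (fun p => cexp (u p)) x = cexp (u (cinv c x)) *: cdmx c u x.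
Proof.
move=> su rx; apply/matrixP => a b; rewrite !mxE.
by rewrite (@cpd_cexp _ _ (rep u)) //; exact: cd.
Qed.

Lemma fluxD u v a x : csmooth u -> csmooth v -> crange c x ->
  flux g c (fun p => u p + v p) a x = flux g c u a x + flux g c v a x.
Proof. by move=> su sv rx; rewrite !fluxE cdmxD // mulmxDr [in LHS]mxE mulrDr. Qed.

Lemma fluxM u v a x : csmooth u -> csmooth v -> crange c x ->
  flux g c (fun p => u p * v p) a x =
  u (cinv c x) * flux g c v a x + v (cinv c x) * flux g c u a x.
Proof.
move=> su sv rx; rewrite !fluxE cdmxM // mulmxDr -!scalemxAr.
rewrite [X in _ * X = _]mxE [X in _ * (X + _) = _]mxE [X in _ * (_ + X) = _]mxE.
by ring.
Qed.

Lemma flux_cexp u a x : csmooth u -> crange c x ->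
  flux g c (fun p => cexp (u p)) a x = cexp (u (cinv c x)) * flux g c u a x.
Proof.
move=> su rx; rewrite !fluxE cdmx_cexp // -scalemxAr [X in _ * X = _]mxE.
by rewrite mulrCA.
Qed.

Lemma sum_flux u v x :
  \sum_a cpd [:: a] (rep u) x * flux g c v a x = (gvol g c x)%:C%C * cgrad g c u v x.
Proof.
rewrite /cgrad mulr_sumr; apply: eq_bigr => a _.
rewrite mulr_sumr mulr_sumr; apply: eq_bigr => b _.
by rewrite rmorphM; ring.
Qed.

Let cdflux u a x : csmooth u -> crange c x -> cdiff (flux g c u a) x.
Proof.
by move=> su rx; exact: csmooth_cdiff (csmooth_flux g sc a (csmooth_chart sc su)) rx.
Qed.

Let volV x : crange c x -> ((gvol g c x)^-1)%:C%C * (gvol g c x)%:C%C = 1.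
Proof.
by move=> rx; rewrite -rmorphM mulVf // gt_eqF // (gvol_gt0 g sc).
Qed.

Lemma cboxD u v x : csmooth u -> csmooth v -> crange c x ->
  cbox g c (fun p => u p + v p) x = cbox g c u x + cbox g c v x.
Proof.
move=> su sv rx; rewrite /cbox -mulrDr -big_split; congr (_ * _).
apply: eq_bigr => a _ /=; rewrite -cpdD; [|exact: cdflux..].
by apply: (eq_cpd _ oc rx) => y ry; exact: fluxD.
Qed.

(** The flux of a product obeys the Leibniz rule, and its divergence creates two cross terms, equal
    because the metric is symmetric. The minus sign comes from box being minus the divergence of the
    gradient. *)
Lemma cboxM u v x : csmooth u -> csmooth v -> crange c x ->
  cbox g c (fun p => u p * v p) x =
  u (cinv c x) * cbox g c v x + v (cinv c x) * cbox g c u x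
  - 2 * cgrad g c u v x.
Proof.
move=> su sv rx; pose S w := \sum_a cpd [:: a] (flux g c w a) x.
have E : S (fun p => u p * v p) =
    u (cinv c x) * S v + v (cinv c x) * S u +
    2 * ((gvol g c x)%:C%C * cgrad g c u v x).
  (* One of the two copies of the gradient product is written with [u] and [v] exchanged, to match
     the two cross terms. *)
  rewrite /S mulr2n mulrDl mul1r -{1}sum_flux (cgradC _ _ rx) -sum_flux.
  rewrite !mulr_sumr -!big_split; apply: eq_bigr => a _ /=.
  transitivity (cpd [:: a] (fun y => u (cinv c y) * flux g c v a y +
                                     v (cinv c y) * flux g c u a y) x).
    by apply: (eq_cpd _ oc rx) => y ry; exact: fluxM.
  have [cu cv] := (cd su rx, cd sv rx).
  have [fu fv] := (cdflux a su rx, cdflux a sv rx).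
  rewrite cpdD; [|exact: cdiffM..].
  rewrite [X in X + _ = _](cpdM a cu fv) [X in _ + X = _](cpdM a cv fu).
  by rewrite [LHS]addrACA [LHS]addrC.
have bE w : cbox g c w x = - ((gvol g c x)^-1)%:C%C * S w by [].
rewrite !bE E; move: (volV rx); clear; clearbody S.
move: (S u) (S v) (cgrad _ _ _ _ _) (u _) (v _) => Su Sv G y z.
move: (_%:C%C) (_%:C%C) => k w kw.
by rewrite -[in RHS](mul1r G) -kw; ring.
Qed.

Lemma cbox_cexp u x : csmooth u -> crange c x ->
  cbox g c (fun p => cexp (u p)) x =
  cexp (u (cinv c x)) * (cbox g c u x - cgrad g c u u x).
Proof.
move=> su rx; pose S w := \sum_a cpd [:: a] (flux g c w a) x.
have E : S (fun p => cexp (u p)) =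
    cexp (u (cinv c x)) * ((gvol g c x)%:C%C * cgrad g c u u x +
      S u).
  rewrite /S -sum_flux mulrDr !mulr_sumr -big_split; apply: eq_bigr => a _ /=.
  have cu := cd su rx; have fu := cdflux a su rx.
  have ce : cdiff (fun y => cexp (u (cinv c y))) x := cd (csm_cexp su) rx.
  transitivity (cpd [:: a] (fun y => cexp (u (cinv c y)) * flux g c u a y) x).
    by apply: (eq_cpd _ oc rx) => y ry; exact: flux_cexp.
  rewrite [LHS](cpdM a ce fu) [X in X * _ + _ = _](cpd_cexp a cu).
  by rewrite -[X in X + _ = _]mulrA.
have bE w : cbox g c w x = - ((gvol g c x)^-1)%:C%C * S w by [].
rewrite !bE E; move: (volV rx); clear; clearbody S.
move: (S u) (cgrad _ _ _ _ _) (cexp _) => Su G y.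
move: (_%:C%C) (_%:C%C) => k w kw.
by rewrite -[in RHS](mul1r G) -kw; ring.
Qed.

End in_chart.

End leibniz.

(** * WKB expansion *)

Section point_calculus.
Context {R : realType} {n : nat} {M : manifold R n} (g : lorentz_metric M).
Implicit Types (u v w Q Phi S : spacetime M -> R[i]) (p : spacetime M) (a : R[i]).

Let sc p : smooth_chart (st_chart p) := st_chart_smooth p.
Let rc p : crange (st_chart p) (cmap (st_chart p) p) := crange_cmap (st_chart_dom p).
Let cK p : cinv (st_chart p) (cmap (st_chart p) p) = p.
Proof. exact: chart_cmapK (st_chart_is_chart p) (st_chart_dom p). Qed.
Let nc u v p : (\near p, u p = v p) ->
  \forall x \near cmap (st_chart p) p, u (cinv (st_chart p) x) = v (cinv (st_chart p) x).
Proof. exact: near_cinv (st_chart_is_chart p) (st_chart_dom p). Qed.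

Lemma box_near_eq u v p : (\near p, u p = v p) -> box g u p = box g v p.
Proof. by move=> /nc; exact: cbox_near_eq. Qed.

Lemma gradp_near_eq u v w p : (\near p, v p = w p) -> gradp g u v p = gradp g u w p.
Proof. by move=> /nc; exact: cgrad_near_eq. Qed.

Lemma gradpC u v p : gradp g u v p = gradp g v u p.
Proof. exact: cgradC (sc p) _ _ _ (rc p). Qed.

Lemma gradpD u v w p : csmooth v -> csmooth w ->
  gradp g u (fun p => v p + w p) p = gradp g u v p + gradp g u w p.
Proof.
move=> sv sw; rewrite !gradpE !cgradE (cdmxD (sc p)) //.
by rewrite mulmxDr mxE.
Qed.

Lemma gradpM u v w p : csmooth v -> csmooth w ->
  gradp g u (fun p => v p * w p) p = v p * gradp g u w p + w p * gradp g u v p.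
Proof.
move=> sv sw; rewrite !gradpE !cgradE (cdmxM (sc p)) // cK.
by rewrite mulmxDr -!scalemxAr mxE [X in X + _ = _]mxE [X in _ + X = _]mxE.
Qed.

Lemma gradp_cexp u v p : csmooth v ->
  gradp g u (fun p => cexp (v p)) p = cexp (v p) * gradp g u v p.
Proof.
move=> sv; rewrite !gradpE !cgradE (cdmx_cexp (sc p)) // cK.
by rewrite -!scalemxAr mxE.
Qed.

Lemma boxD u v p : csmooth u -> csmooth v ->
  box g (fun p => u p + v p) p = box g u p + box g v p.
Proof. by move=> su sv; apply: cboxD (sc p) _ _ _ su sv (rc p). Qed.

Lemma boxM u v p : csmooth u -> csmooth v ->
  box g (fun p => u p * v p) p =
  u p * box g v p + v p * box g u p - 2 * gradp g u v p.
Proof.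
by move=> su sv; have := cboxM g (sc p) su sv (rc p); rewrite cK.
Qed.

Lemma box_cexp u p : csmooth u ->
  box g (fun p => cexp (u p)) p = cexp (u p) * (box g u p - gradp g u u p).
Proof. by move=> su; have := cbox_cexp g (sc p) su (rc p); rewrite cK. Qed.

Lemma gradp_cst u a p : gradp g u (fun=> a) p = 0.
Proof.
rewrite gradpE cgradE (_ : cdmx _ (fun=> a) _ = 0) ?mulmx0 ?mxE //.
by apply/matrixP => b j; rewrite !mxE; exact: cpd_cst.
Qed.

Lemma box_cst a p : box g (fun=> a) p = 0.
Proof.
have f0 b : flux g (st_chart p) (fun=> a) b = fun=> 0.
  apply/funext => x; rewrite /flux big1 // => j _.
  by rewrite (cpd_cst a) mulr0.
rewrite boxE /cbox big1 ?mulr0 // => b _.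
by rewrite f0; exact: cpd_cst.
Qed.

Lemma gradpZ u v a p : csmooth v ->
  gradp g u (fun p => a * v p) p = a * gradp g u v p.
Proof.
by move=> sv; rewrite gradpM ?gradp_cst ?mulr0 ?addr0 //; exact: csm_cst.
Qed.

Lemma boxZ v a p : csmooth v -> box g (fun p => a * v p) p = a * box g v p.
Proof.
move=> sv; rewrite boxM //; last exact: csm_cst.
by rewrite box_cst gradpC gradp_cst !mulr0 addr0 subr0.
Qed.

Lemma box_sum (I : Type) (r : seq I) (u : I -> spacetime M -> R[i]) p :
  (forall j, csmooth (u j)) ->
  box g (fun p => \sum_(j <- r) u j p) p = \sum_(j <- r) box g (u j) p.
Proof.
move=> su; elim: r => [|j r IH].
  by under [X in box _ X]funext do rewrite big_nil; rewrite box_cst big_nil.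
under [X in box _ X]funext do rewrite big_cons.
by rewrite big_cons -IH; apply: boxD => //; exact: csm_sum.
Qed.

Lemma gradp_sum (I : Type) (r : seq I) w (u : I -> spacetime M -> R[i]) p :
  (forall j, csmooth (u j)) ->
  gradp g w (fun p => \sum_(j <- r) u j p) p = \sum_(j <- r) gradp g w (u j) p.
Proof.
move=> su; elim: r => [|j r IH].
  by under [X in gradp _ _ X]funext do rewrite big_nil; rewrite gradp_cst big_nil.
under [X in gradp _ _ X]funext do rewrite big_cons.
by rewrite big_cons -IH; apply: gradpD => //; exact: csm_sum.
Qed.

Lemma csmooth_wave_op Q u : csmooth Q -> csmooth u -> csmooth (wave_op g Q u).
Proof. by move=> sQ su; apply: csmD; [exact: csmooth_box|exact: csmM]. Qed.

Lemma oscE Phi (h : R) p : osc Phi h p = cexp ('i%C / h%:C%C * Phi p).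
Proof. by rewrite /osc mulrAC. Qed.

Lemma csmooth_osc Phi (h : R) : csmooth Phi -> csmooth (osc Phi h).
Proof.
move=> sP; have := csm_cexp (csmM (csm_cst ('i%C / h%:C%C)) sP).
by congr csmooth; apply/funext => p; rewrite oscE.
Qed.

Lemma i2 : 'i%C * 'i%C = -1 :> R[i].
Proof. by apply: complexE => /=; ring. Qed.

Lemma wave_op_osc Q Phi S (h : R) p : csmooth Phi -> csmooth S ->
  wave_op g Q (fun p => osc Phi h p * S p) p =
  osc Phi h p * (wave_op g Q S p + 'i%C / h%:C%C * box g Phi p * S p
    + (h%:C%C)^-2 * gradp g Phi Phi p * S p
    - 2 * ('i%C / h%:C%C) * gradp g Phi S p).
Proof.
move=> sP sS; pose a : R[i] := 'i%C / h%:C%C; pose f p := a * Phi p.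
have sf : csmooth f by apply: csmM => //; exact: csm_cst.
have oE : osc Phi h = fun p => cexp (f p) by apply/funext => q; rewrite oscE.
(* The minus sign of i^2 cancels the one in [box_cexp]: the eikonal term enters with coefficient
   +h^-2. *)
have aa : a * a = - (h%:C%C)^-2.
  by rewrite /a mulrACA i2 mulN1r -exprVn expr2.
have gfP : gradp g Phi f p = a * gradp g Phi Phi p by exact: gradpZ.
have gff : gradp g f f p = - (h%:C%C)^-2 * gradp g Phi Phi p.
  have -> : gradp g f f p = a * gradp g f Phi p by exact: gradpZ.
  by rewrite (gradpC f Phi) gfP mulrA aa.
have bf : box g f p = a * box g Phi p by exact: boxZ.
have gfS : gradp g f S p = a * gradp g Phi S p.
  have -> : gradp g f S p = gradp g S f p by exact: gradpC.
  by rewrite (gradpC Phi S); exact: gradpZ.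
have gS : gradp g (fun p => cexp (f p)) S p = cexp (f p) * (a * gradp g Phi S p).
  by rewrite gradpC gradp_cexp // gradpC gfS.
rewrite oE /wave_op boxM //; last exact: csm_cexp.
rewrite gS box_cexp // bf gff -/a.
move: (box g S p) (box g Phi p) (gradp g Phi Phi p) (gradp g Phi S p) (cexp (f p)).
by move: (S p) (Q p) ((h%:C%C)^-2) => *; ring.
Qed.

End point_calculus.

(** For m <= N the coefficient of y^m on the left is G_m + X_(m+1) + Y_m, that is s_m by the
    recursion; the vanishing initial values supply the terms missing at m = 0 and m = 1. At m = N+1
    and m = N+2 the triple is incomplete, which leaves the remainder. *)
Lemma second_order_telescope (A : comPzRingType) (G X Y s : nat -> A) (y : A) N :
  X 1%N = 0 -> Y 0%N = 0 -> Y 1%N = 0 ->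
  (forall k, G k = s k - Y k - X k.+1) ->
  \sum_(0 <= k < N.+1) (y ^+ k * G k + y ^+ k.+1 * X k.+2 + y ^+ k.+2 * Y k.+2) =
  \sum_(0 <= k < N.+1) s k * y ^+ k +
  y ^+ N.+1 * (X N.+2 + Y N.+1) + y ^+ N.+2 * Y N.+2.
Proof.
move=> X1 Y0 Y1 GE; elim: N => [|N IH].
  by rewrite !big_nat1 GE X1 Y0 Y1 expr0; ring.
by rewrite big_nat_recr //= IH GE [in RHS]big_nat_recr //= !exprS; ring.
Qed.

(** * Formal series with coefficients supported in a closed set *)

Section formal_series.
Context {R : realType} {n : nat} {M : manifold R n} (g : lorentz_metric M).
Implicit Types (u v w Q Phi S : spacetime M -> R[i]) (p : spacetime M) (a : R[i]).

Section support.
Context (A : set (spacetime M)) (cA : closed A).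

Lemma near_notin p : ~ A p -> \near p, ~ A p.
Proof. by move=> nAp; apply: open_nbhs_nbhs; split => //; exact: closed_openC. Qed.

Lemma csmooth0_cst0 : csmooth0_in A (fun=> 0).
Proof. by split => //; exact: csm_cst. Qed.

Lemma csmooth0D u v : csmooth0_in A u -> csmooth0_in A v ->
  csmooth0_in A (fun p => u p + v p).
Proof.
by move=> [su u0] [sv v0]; split => [|p nAp]; [exact: csmD|rewrite u0 ?v0 ?addr0].
Qed.

Lemma csmooth0B u v : csmooth0_in A u -> csmooth0_in A v ->
  csmooth0_in A (fun p => u p - v p).
Proof.
by move=> [su u0] [sv v0]; split => [|p nAp]; [exact: csmB|rewrite u0 ?v0 ?subr0].
Qed.

Lemma csmooth0Ml u v : csmooth u -> csmooth0_in A v ->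
  csmooth0_in A (fun p => u p * v p).
Proof.
by move=> su [sv v0]; split => [|p nAp]; [exact: csmM|rewrite v0 ?mulr0].
Qed.

Lemma csmooth0_sum (I : Type) (r : seq I) (P : pred I) (u : I -> spacetime M -> R[i]) :
  (forall j, P j -> csmooth0_in A (u j)) ->
  csmooth0_in A (fun p => \sum_(j <- r | P j) u j p).
Proof.
move=> su; split => [|p nAp]; first by apply: csm_sum => j /su[].
by apply: big1 => j /su[_ ->].
Qed.

(** The index range stays available as a hypothesis because the amplitudes of a beam are controlled
    only up to order [K]. *)
Lemma csmooth0_sum_nat (m1 m2 : nat) (P : pred nat) (u : nat -> spacetime M -> R[i]) :
  (forall j, (m1 <= j < m2)%N -> P j -> csmooth0_in A (u j)) ->
  csmooth0_in A (fun p => \sum_(m1 <= j < m2 | P j) u j p).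
Proof.
move=> su; have := @csmooth0_sum nat (index_iota m1 m2)
  (fun j => (m1 <= j < m2)%N && P j) u (fun j => fun h => su j (andP h).1 (andP h).2).
by congr csmooth0_in; apply/funext => p; rewrite [RHS]big_nat_cond.
Qed.

Lemma csmooth0_gradp Phi u : csmooth Phi -> csmooth0_in A u ->
  csmooth0_in A (gradp g Phi u).
Proof.
move=> sP [su u0]; split => [|p nAp]; first exact: csmooth_gradp.
rewrite -(gradp_cst g Phi 0 p); apply: gradp_near_eq.
by apply: filterS (near_notin nAp) => q; exact: u0.
Qed.

Lemma csmooth0_wave_op Q u : csmooth Q -> csmooth0_in A u ->
  csmooth0_in A (wave_op g Q u).
Proof.
move=> sQ [su u0]; split => [|p nAp]; first exact: csmooth_wave_op.
rewrite /wave_op u0 // mulr0 addr0 -(box_cst g 0 p); apply: box_near_eq.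
by apply: filterS (near_notin nAp) => q; exact: u0.
Qed.

Lemma csmooth0_formal_step Q Phi f u0 u1 : csmooth Q -> csmooth Phi ->
  (forall p, A p -> gradp g Phi Phi p != 0) ->
  csmooth0_in A f -> csmooth0_in A u0 -> csmooth0_in A u1 ->
  csmooth0_in A (formal_step g Q Phi f u0 u1).
Proof.
move=> sQ sP P0 cf c0 c1.
have [sN N0] : csmooth0_in A (fun p => f p - wave_op g Q u0 p
    - 'i%C * box g Phi p * u1 p + 2 * 'i%C * gradp g Phi u1 p).
  apply: csmooth0D; [apply: csmooth0B; [apply: csmooth0B|]|].
  - exact: cf.
  - exact: csmooth0_wave_op.
  - apply: csmooth0Ml => //; apply: csmM; [exact: csm_cst|exact: csmooth_box].
  - by apply: csmooth0Ml; [exact: csm_cst|exact: csmooth0_gradp].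
split => [|p nAp]; last by rewrite /formal_step N0 // mul0r.
by apply: csmV0 cA sN N0 _ P0; exact: csmooth_gradp.
Qed.

Lemma csmooth0_formal_coef Q Phi src : csmooth Q -> csmooth Phi ->
  (forall p, A p -> gradp g Phi Phi p != 0) ->
  (forall m, csmooth0_in A (src m)) ->
  forall m, csmooth0_in A (formal_coef g Q Phi src m).
Proof.
move=> sQ sP P0 csrc m.
(* The recursion has two terms, so two consecutive coefficients are carried through the
   induction. *)
suff : csmooth0_in A (formal_coef g Q Phi src m) /\
       csmooth0_in A (formal_coef g Q Phi src m.+1) by case.
elim: m => [|m [IH0 IH1]]; first by split; exact: csmooth0_cst0.
by split => //; exact: csmooth0_formal_step.
Qed.

End support.

(* The coefficient of h^{-1} in e^{-i Phi / h} box (e^{i Phi / h} u). *)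
Definition transport_part Phi u p : R[i] :=
  'i%C * box g Phi p * u p - 2 * 'i%C * gradp g Phi u p.

(** The powers start at h^(j+2), so that after the factor h^-2 of the conjugated operator all
    exponents are natural numbers. *)
Lemma wave_op_osc_sum Q Phi (a : nat -> spacetime M -> R[i]) (h : R) N j p :
  h != 0 -> csmooth Phi -> (forall k, csmooth (a k)) ->
  wave_op g Q (fun p => osc Phi h p *
    \sum_(0 <= k < N) a k p * h%:C%C ^+ (k + j.+2)) p =
  osc Phi h p * \sum_(0 <= k < N)
    (h%:C%C ^+ (k + j) * (gradp g Phi Phi p * a k p) +
     h%:C%C ^+ (k + j).+1 * transport_part Phi (a k) p +
     h%:C%C ^+ (k + j).+2 * wave_op g Q (a k) p).
Proof.
move=> h0 sP sa; have hC0 : h%:C%C != 0 :> R[i] by rewrite fmorph_eq0.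
have E q : \sum_(0 <= k < N) a k q * h%:C%C ^+ (k + j.+2) =
    \sum_(0 <= k < N) h%:C%C ^+ (k + j.+2) * a k q.
  by apply: eq_bigr => k _; rewrite mulrC.
under [X in wave_op _ _ X]funext do rewrite E.
have sS k : csmooth (fun q => h%:C%C ^+ (k + j.+2) * a k q).
  by apply: csmM => //; exact: csm_cst.
rewrite wave_op_osc //; last exact: csm_sum.
congr (_ * _); rewrite /wave_op box_sum // gradp_sum // /transport_part.
move: (gradp g Phi Phi p) (box g Phi p) => G B.
rewrite !mulr_sumr -!big_split -sumrB; apply: eq_bigr => k _ /=.
rewrite boxZ // gradpZ // !addnS !exprS.
move: (box g (a k) p) (gradp g Phi (a k) p).
move: (a k p) (Q p) (h%:C%C ^+ (k + j)) => *.
by field.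
Qed.

Lemma formal_coefSS Q Phi src m :
  formal_coef g Q Phi src m.+2 = formal_step g Q Phi (src m)
    (formal_coef g Q Phi src m) (formal_coef g Q Phi src m.+1).
Proof. by []. Qed.

Lemma formal_coef_telescope Q Phi src (y : R[i]) N p :
  gradp g Phi Phi p != 0 ->
  let c := formal_coef g Q Phi src in
  \sum_(0 <= k < N.+1)
    (y ^+ k * (gradp g Phi Phi p * c k.+2 p) +
     y ^+ k.+1 * transport_part Phi (c k.+2) p +
     y ^+ k.+2 * wave_op g Q (c k.+2) p) =
  \sum_(0 <= k < N.+1) src k p * y ^+ k +
  y ^+ N.+1 * (transport_part Phi (c N.+2) p + wave_op g Q (c N.+1) p) +
  y ^+ N.+2 * wave_op g Q (c N.+2) p.
Proof.
move=> G0 c.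
apply: (@second_order_telescope _ (fun k => gradp g Phi Phi p * c k.+2 p)
  (fun k => transport_part Phi (c k) p) (fun k => wave_op g Q (c k) p)
  (fun k => src k p)).
- by rewrite /transport_part gradp_cst !mulr0 subr0.
- by rewrite /wave_op box_cst mulr0 addr0.
- by rewrite /wave_op box_cst mulr0 addr0.
(* Clearing the denominator of [formal_step] gives the linear relation that the telescoping
   requires. *)
- move=> k; rewrite /c formal_coefSS /formal_step mulrC divfK // -/c.
  rewrite /transport_part; move: (c k) (c k.+1) => u0 u1.
  by rewrite opprB addrA addrAC.
Qed.

End formal_series.

(** * Interaction of beams *)

(** Serves to make compact subsets of R x M closed, which the support arguments use. *)
Lemma prod_hausdorff (X Y : topologicalType) :
  hausdorff_space X -> hausdorff_space Y -> hausdorff_space (X * Y)%type.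
Proof.
move=> hX hY [x y] [x' y'] cl.
have nfst (z : X * Y) A : nbhs z.1 A -> nbhs z (fst @^-1` A) by exact: cvg_fst.
have nsnd (z : X * Y) A : nbhs z.2 A -> nbhs z (snd @^-1` A) by exact: cvg_snd.
congr pair.
  apply: hX => A B nA nB.
  by have [[a b] [Aa Ba]] := cl _ _ (nfst (x, y) A nA) (nfst (x', y') B nB); exists a.
apply: hY => A B nA nB.
by have [[a b] [Aa Ba]] := cl _ _ (nsnd (x, y) A nA) (nsnd (x', y') B nB); exists b.
Qed.

(** Degrees 0 to K and 2 to L+2 add up to degrees 2 to K+L+2, so each pair of indices contributes to
    exactly one power in the range. *)
Lemma cauchy_product_sum (A : comPzRingType) (a b : nat -> A) (y : A) K L :
  (\sum_(0 <= l < K.+1) a l * y ^+ l) * (\sum_(2 <= m < L.+3) b m * y ^+ m) =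
  \sum_(2 <= m < (K + L).+3)
    (\sum_(0 <= l < K.+1) \sum_(2 <= m' < L.+3 | (l + m')%N == m) a l * b m') * y ^+ m.
Proof.
under [RHS]eq_bigr do rewrite mulr_suml.
rewrite exchange_big mulr_suml; apply: eq_big_nat => l /andP[_ lK].
under [RHS]eq_bigr do rewrite mulr_suml big_mkcond.
rewrite exchange_big mulr_sumr; apply: eq_big_nat => m /andP[m2 mL] /=.
rewrite -big_mkcond; under eq_bigl do rewrite eq_sym.
(* The sum over the total degree reduces to its single term [l + m], once this is known to lie in
   the range. *)
rewrite big_nat1_eq ifT ?exprD; first by rewrite mulrACA.
rewrite (leq_trans m2 (leq_addl _ _)) /=.
by have := leq_add (lK : (l <= K)%N) mL; rewrite !addnS.
Qed.

Section interaction.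
Context {R : realType} {n : nat} {M : manifold R n} (g : lorentz_metric M).
Implicit Types (u v w Q q Phi : spacetime M -> R[i]) (p : spacetime M).

Lemma spacetime_compact_closed (A : set (spacetime M)) : compact A -> closed A.
Proof.
apply: compact_closed; apply: prod_hausdorff; first exact: Rhausdorff.
exact: manifold_hausdorff.
Qed.

Lemma oscD u v (h : R) p :
  osc u h p * osc v h p = osc (fun p => u p + v p) h p.
Proof. by rewrite !oscE -cexpD -mulrDr. Qed.

Lemma beam_sol_inter_sol Q q K chiB (bi bj bk : beam M) (h : R) p :
  beam_sol K bi h p * inter_sol g Q q K chiB bj bk h p =
  osc (phase3 bi bj bk) h p * \sum_(2 <= m < (3 * K + 2).+1)
    beam_inter_coef g Q q K chiB bi bj bk m p * h%:C%C ^+ m.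
Proof.
rewrite /beam_sol /inter_sol.
have -> : osc (phase3 bi bj bk) h p =
    osc (beam_phase bi) h p * osc (phase2 bj bk) h p.
  rewrite [RHS]oscD; apply: (congr1 (fun f => osc f h p)).
  by apply/funext => r; rewrite /phase2 addrA.
rewrite /beam_inter_coef; move: (inter_coef g Q q K chiB bj bk) => c.
have -> : (2 * K + 2).+1 = (2 * K).+3 by rewrite addn2.
have -> : (3 * K + 2).+1 = (K + 2 * K).+3 by rewrite addn2 mulSn.
move: (osc (beam_phase bi) h p) (osc (phase2 bj bk) h p) => o1 o2.
have := cauchy_product_sum (fun l => beam_amp bi l p) (fun m => c m p) h%:C%C K (2 * K).
move: (\sum_(0 <= l < K.+1) _) (\sum_(2 <= m < (2 * K).+3) _) => SA SB E.
transitivity (o1 * o2 * ((beam_cut bi p)%:C%C * (SA * SB))); first by ring.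
rewrite E; congr (_ * _); rewrite mulr_sumr; apply: eq_bigr => m _.
by rewrite mulrA.
Qed.

Lemma source3E Q q K chiB (bi bj bk : beam M) (h : R) p :
  source3 g Q q K chiB bi bj bk h p =
  osc (phase3 bi bj bk) h p * \sum_(2 <= m < (3 * K + 2).+1)
    q p * beta_coef g Q q K chiB bi bj bk m p * h%:C%C ^+ m.
Proof.
rewrite /source3 !beam_sol_inter_sol.
have -> : osc (phase3 bj bi bk) h p = osc (phase3 bi bj bk) h p.
  apply: (congr1 (fun f => osc f h p)); apply/funext => r.
  by rewrite /phase3; ring.
have -> : osc (phase3 bk bi bj) h p = osc (phase3 bi bj bk) h p.
  apply: (congr1 (fun f => osc f h p)); apply/funext => r.
  by rewrite /phase3; ring.
rewrite -!mulrDr mulrCA; congr (_ * _); rewrite -!big_split mulr_sumr.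
apply: eq_bigr => m _; rewrite /beta_coef /=.
by rewrite -!mulrDl mulrA.
Qed.

Section coefficients.
Context (N0 : set (spacetime M)) (cN0 : closed N0) (K : nat).
Context (Q q : spacetime M -> R[i]) (sQ : csmooth Q) (sq : csmooth q).
Context (chiB : spacetime M -> R) (schi : rsmooth chiB).
Context (chi0 : forall p, ~ N0 p -> chiB p = 0).

(** The amplitudes are meaningful only on the Fermi tube, so smoothness is stated for their products
    with the cut-off. *)
Definition smooth_beam (b : beam M) : Prop := csmooth (beam_phase b) /\
  forall l, (l <= K)%N -> csmooth (fun p => (beam_cut b p)%:C%C * beam_amp b l p).

Lemma gaussian_beam_smooth b : gaussian_beam g Q K b -> smooth_beam b.
Proof.
move=> [_ _ [sP _] _ [[_ _ _ sa _] _]]; split => // l /sa.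
by case=> A [_ []].
Qed.

Lemma csmooth_phase2 bj bk : smooth_beam bj -> smooth_beam bk ->
  csmooth (phase2 bj bk).
Proof. by move=> [sj _] [sk _]; exact: csmD. Qed.

Lemma csmooth_phase3 bi bj bk : smooth_beam bi -> smooth_beam bj ->
  smooth_beam bk -> csmooth (phase3 bi bj bk).
Proof. by move=> [si _] [sj _] [sk _]; apply: csmD => //; exact: csmD. Qed.

Lemma csmooth0_inter_amp bj bk l : smooth_beam bj -> smooth_beam bk ->
  csmooth0_in N0 (inter_amp K chiB bj bk l).
Proof.
move=> [_ sj] [_ sk].
(* Each cut-off is moved next to an amplitude of its own beam, where the product is smooth; [chiB]
   provides the support in [N0]. *)
have -> : inter_amp K chiB bj bk l = fun p =>
    \sum_(0 <= m < K.+1) \sum_(0 <= m' < K.+1 | (m + m')%N == l)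
    ((beam_cut bj p)%:C%C * beam_amp bj m p) *
    ((beam_cut bk p)%:C%C * beam_amp bk m' p) * (chiB p)%:C%C.
  apply/funext => p; rewrite /inter_amp mulr_sumr; apply: eq_bigr => m _.
  rewrite mulr_sumr; apply: eq_bigr => m' _; rewrite !rmorphM; ring.
apply: csmooth0_sum_nat => m /andP[_ mK] _.
apply: csmooth0_sum_nat => m' /andP[_ mK'] _.
apply: csmooth0Ml; first by apply: csmM; [exact: sj|exact: sk].
by split => // p /chi0 ->.
Qed.

Lemma csmooth0_inter_coef bj bk m : smooth_beam bj -> smooth_beam bk ->
  (forall p, N0 p -> gradp g (phase2 bj bk) (phase2 bj bk) p != 0) ->
  csmooth0_in N0 (inter_coef g Q q K chiB bj bk m).
Proof.
move=> sj sk P0; apply: csmooth0_formal_coef => //; first exact: csmooth_phase2.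
by move=> l; apply: csmooth0Ml => //; exact: csmooth0_inter_amp.
Qed.

Lemma csmooth0_beam_inter_coef bi bj bk m :
  smooth_beam bi -> smooth_beam bj -> smooth_beam bk ->
  (forall p, N0 p -> gradp g (phase2 bj bk) (phase2 bj bk) p != 0) ->
  csmooth0_in N0 (beam_inter_coef g Q q K chiB bi bj bk m).
Proof.
move=> [_ si] sj sk P0.
have -> : beam_inter_coef g Q q K chiB bi bj bk m = fun p =>
    \sum_(0 <= l < K.+1) \sum_(2 <= m' < (2 * K + 2).+1 | (l + m')%N == m)
    ((beam_cut bi p)%:C%C * beam_amp bi l p) * inter_coef g Q q K chiB bj bk m' p.
  apply/funext => p; rewrite /beam_inter_coef mulr_sumr; apply: eq_bigr => l _.
  by rewrite mulr_sumr; apply: eq_bigr => m' _; rewrite mulrA.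
apply: csmooth0_sum_nat => l /andP[_ lK] _.
apply: csmooth0_sum_nat => m' _ _.
by apply: csmooth0Ml; [exact: si|exact: csmooth0_inter_coef].
Qed.

Lemma csmooth0_beta_coef bi bj bk m :
  smooth_beam bi -> smooth_beam bj -> smooth_beam bk ->
  (forall p, N0 p -> gradp g (phase2 bi bj) (phase2 bi bj) p != 0) ->
  (forall p, N0 p -> gradp g (phase2 bi bk) (phase2 bi bk) p != 0) ->
  (forall p, N0 p -> gradp g (phase2 bj bk) (phase2 bj bk) p != 0) ->
  csmooth0_in N0 (beta_coef g Q q K chiB bi bj bk m).
Proof.
by move=> *; apply: csmooth0D; [apply: csmooth0D|];
  exact: csmooth0_beam_inter_coef.
Qed.

End coefficients.

(** Powers are shifted by two against [formal_coef]: a source starting at h^2 yields a solution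
    starting at h^4. On [A] the telescoped recursion applies, with [N.+1] source terms used up by
    the cancellation. *)
Lemma wave_op_formal_series Q Phi src (h : R) N p (A : set (spacetime M)) :
  h != 0 -> closed A -> csmooth Q -> csmooth Phi ->
  (forall p, A p -> gradp g Phi Phi p != 0) ->
  (forall m, csmooth0_in A (src m)) ->
  let c := formal_coef g Q Phi src in
  wave_op g Q (fun p => osc Phi h p *
    \sum_(0 <= k < N.+1) c k.+2 p * h%:C%C ^+ k.+4) p =
  osc Phi h p * (\sum_(0 <= k < N.+1) src k p * h%:C%C ^+ k.+2) +
  osc Phi h p *
    (h%:C%C ^+ N.+3 * (transport_part g Phi (c N.+2) p + wave_op g Q (c N.+1) p) +
     h%:C%C ^+ N.+4 * wave_op g Q (c N.+2) p).
Proof.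
move=> h0 cA sQ sP P0 csrc c.
have cC0 : forall m, csmooth0_in A (c m) by exact: csmooth0_formal_coef.
have E r : \sum_(0 <= k < N.+1) c k.+2 r * h%:C%C ^+ k.+4 =
    \sum_(0 <= k < N.+1) c k.+2 r * h%:C%C ^+ (k + 4).
  by apply: eq_bigr => k _; rewrite addn4.
under [X in wave_op _ _ X]funext do rewrite E.
rewrite (wave_op_osc_sum g Q _ 2 p h0 sP) => [|k]; last by have [] := cC0 k.+2.
rewrite -mulrDr; congr (_ * _).
(* Off [A] the symbol may vanish and the recursion says nothing, but all coefficients vanish there
   near [p], so both sides are 0. *)
have [Ap|nAp] := pselect (A p); last first.
  have z m : wave_op g Q (c m) p = 0 by have [_ ->] := csmooth0_wave_op g cA sQ (cC0 m).
  have z' m : transport_part g Phi (c m) p = 0.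
    have [_ c0] := cC0 m; have [_ g0] := csmooth0_gradp g cA sP (cC0 m).
    by rewrite /transport_part c0 // g0 // !mulr0 subr0.
  rewrite !z z' !(mulr0, addr0) !big1 ?addr0 // => k _.
    by have [_ ->] := csrc k; rewrite ?mul0r.
  by rewrite z z'; have [_ ->] := cC0 k.+2; rewrite ?mulr0 ?addr0.
have := formal_coef_telescope Q src h%:C%C N (P0 p Ap); rewrite -/c => T.
transitivity (h%:C%C ^+ 2 * \sum_(0 <= k < N.+1)
    (h%:C%C ^+ k * (gradp g Phi Phi p * c k.+2 p) +
     h%:C%C ^+ k.+1 * transport_part g Phi (c k.+2) p +
     h%:C%C ^+ k.+2 * wave_op g Q (c k.+2) p)).
  rewrite mulr_sumr; apply: eq_bigr => k _.
  by rewrite !addn2 !exprS; ring.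
rewrite [X in _ * X]T.
move: (transport_part _ _ _ _) (wave_op g Q (c N.+1) p) (wave_op g Q (c N.+2) p).
move=> X Y Z; rewrite !mulrDr mulr_sumr -addrA; congr (_ + _).
  by apply: eq_bigr => k _; rewrite mulrCA -exprD.
by rewrite !exprS; ring.
Qed.

End interaction.

(** * Sobolev estimate of the remainder *)

Section integrals.
Context {R : realType}.

(* The integral of a nonnegative function is a supremum over simple functions,
   so monotonicity needs no measurability. *)
Lemma ge0_integral_mono (f1 f2 : R -> \bar R) :
  (forall x, (0 <= f1 x)%E) -> (forall x, (f1 x <= f2 x)%E) ->
  (\int[@lebesgue_measure R]_x f1 x <= \int[@lebesgue_measure R]_x f2 x)%E.
Proof.
move=> f0 f12; have g0 x : (0 <= f2 x)%E := le_trans (f0 x) (f12 x).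
rewrite !ge0_integralTE //; apply: le_ereal_sup => _ [s sf <-].
by exists s => // x; exact: le_trans (sf x) (f12 x).
Qed.

(** The support lies in a cube of side 2 rho. By induction on the dimension, the inner integral is
    dominated by a constant times the indicator of [[- rho, rho]]; only this dominating function has
    to be measurable. *)
Lemma iint_box_bound d (f : 'rV[R]_d -> \bar R) (D rho : R) :
  0 <= D -> 0 < rho -> (forall x, (0 <= f x <= D%:E)%E) ->
  (forall x : 'rV[R]_d, (exists a, rho < `|x 0 a|) -> f x = 0%E) ->
  (0 <= iint f <= (D * (rho *+ 2) ^+ d)%:E)%E.
Proof.
elim: d f D => [|d IH] f D D0 r0 fD f0; first by rewrite /= expr0 mulr1.
pose G t := iint (fun y : 'rV[R]_d => f (row_mx t%:M y : 'rV[R]_(1 + d))).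
rewrite -[iint f]/(\int[@lebesgue_measure R]_t G t)%E.
have GB t : (0 <= G t <= (D * (rho *+ 2) ^+ d)%:E)%E.
  apply: IH => // y [a ra]; apply: f0; exists (rshift 1 a).
  by rewrite (@row_mxEr _ 1 1 d).
have G0 t : rho < `|t| -> G t = 0%E.
  move=> rt; apply/eqP; rewrite eq_le; apply/andP; split; last by case/andP: (GB t).
  have fz y : f (row_mx t%:M y : 'rV[R]_(1 + d)) = 0%E.
    apply: f0; exists (@lshift 1 d ord0).
    by rewrite (@row_mxEl _ 1 1 d) mxE eqxx.
  (* The induction hypothesis with the bound [D = 0]. *)
  have /andP[_] : (0 <= G t <= (0 * (rho *+ 2) ^+ d)%:E)%E.
    by apply: IH => // y; rewrite fz lexx.
  by rewrite mul0r.
apply/andP; split; first by apply: integral_ge0 => t _; case/andP: (GB t).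
pose B := D * (rho *+ 2) ^+ d.
have B0 : 0 <= B by rewrite mulr_ge0 // exprn_ge0 // mulrn_wge0 // ltW.
pose H : R -> \bar R := fun t => (B%:E * (\1_(`[- rho, rho]%classic) t)%:E)%E.
have GH : (\int[@lebesgue_measure R]_t G t <= \int[@lebesgue_measure R]_t H t)%E.
  apply: ge0_integral_mono => t; first by case/andP: (GB t).
  have [tr|rt] := leP `|t| rho; last by rewrite G0 // mule_ge0 // lee_fin.
  rewrite /H indicE mem_set; first by rewrite mule1; case/andP: (GB t).
  by rewrite /= in_itv /= -ler_norml.
apply: (le_trans GH); rewrite /H ge0_integralZl_EFin //; last first.
  exact/measurable_EFinP/measurable_indic.
have -> : (\int[@lebesgue_measure R]_t (\1_(`[- rho, rho]%classic) t)%:E =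
    (if (- rho)%:E < rho%:E then rho%:E - (- rho)%:E else 0))%E.
  by rewrite integral_indic // setIT; exact: lebesgue_measure_itv.
rewrite lte_fin ifT; last by rewrite -subr_gt0 opprK addr_gt0.
by rewrite -EFinD opprK -EFinM lee_fin /B exprSr mulrA -mulr2n.
Qed.

End integrals.

(** * Derivatives of oscillating exponentials *)

Section oscillating_derivatives.
Context {R : realType}.
Local Notation Re := (@complex.Re R).
Local Notation Im := (@complex.Im R).

(** The l^1 norm on C: submultiplicative, free of square roots, and an upper bound for the modulus,
    which suffices for estimates up to constants. *)
Definition cabs1 (z : R[i]) : R := `|Re z| + `|Im z|.

Lemma cabs1_ge0 z : 0 <= cabs1 z.
Proof. exact: addr_ge0. Qed.

Lemma cabs1D z w : cabs1 (z + w) <= cabs1 z + cabs1 w.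
Proof.
by rewrite /cabs1 cReD cImD addrACA lerD ?ler_normD.
Qed.

Lemma cabs1_sum (I : finType) (F : I -> R[i]) :
  cabs1 (\sum_t F t) <= \sum_t cabs1 (F t).
Proof.
elim/big_ind2 : _ => // [|z1 r1 z2 r2 h1 h2]; first by rewrite /cabs1 normr0 addr0.
exact: le_trans (cabs1D _ _) (lerD h1 h2).
Qed.

Lemma cabs1M z w : cabs1 (z * w) <= cabs1 z * cabs1 w.
Proof.
rewrite /cabs1 cReM cImM mulrDl !mulrDr -!normrM.
have := ler_normB (Re z * Re w) (Im z * Im w).
by have := ler_normD (Re z * Im w) (Im z * Re w); lra.
Qed.

Lemma cabs1_real r z : cabs1 (r%:C%C * z) = `|r| * cabs1 z.
Proof. by rewrite /cabs1 cReM cImM /= !mul0r subr0 addr0 !normrM mulrDr. Qed.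

Lemma cabs1_cexp z : cabs1 (cexp z) <= expR (Re z) *+ 2.
Proof.
rewrite /cabs1 Re_cexp Im_cexp !normrM !(ger0_norm (expR_ge0 _)) -mulrDr mulr2n.
rewrite -[X in _ <= X + X]mulr1 -mulrDr ler_pM2l ?expR_gt0 // lerD //.
  by rewrite ler_norml cos_geN1 cos_le1.
by rewrite ler_norml sin_geN1 sin_le1.
Qed.

Lemma sqr_le_cabs1 z : Re z ^+ 2 + Im z ^+ 2 <= cabs1 z ^+ 2.
Proof.
rewrite -[Re z ^+ 2]real_normK ?num_real // -[Im z ^+ 2]real_normK ?num_real //.
rewrite /cabs1 sqrrD addrAC lerDl mulrn_wge0 //.
Qed.

(* Every derivative of [e^{i psi / y} a] produces at most one factor [1 / y];
   the amplitudes stay polynomial in [y] with smooth coefficients. *)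
Lemma cexp_family_cpd d (U : set 'rV[R]_d) (psi : 'rV[R]_d -> R[i]) (l : seq 'I_d)
    (I : finType) (e : I -> nat) (a : I -> 'rV[R]_d -> R[i]) :
  open U -> csmooth_on U psi -> (forall t, csmooth_on U (a t)) ->
  exists (J : finType) (e' : J -> nat) (a' : J -> 'rV[R]_d -> R[i]),
    (forall t, csmooth_on U (a' t)) /\
    forall (k y : R[i]) x, y != 0 -> U x ->
      cpd l (fun z => k * (cexp ('i%C / y * psi z) * \sum_t y ^+ e t * a t z)) x =
      k * y^-1 ^+ size l * (cexp ('i%C / y * psi x) * \sum_t y ^+ e' t * a' t x).
Proof.
move=> oU spsi; elim: l I e a => [|i l IH] I e a sa.
  by exists I, e, a; split => // k y x _ Ux; rewrite expr0 mulr1; exact: complexE.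
have [J [e1 [a1 [sa1 E1]]]] := IH I e a sa.
(* Left summands come from differentiating the exponential and right ones from differentiating an
   amplitude; the latter carry an extra power of [y] against the common factor [1 / y]. *)
pose e' (t : J + J) : nat := match t with inl t => e1 t | inr t => (e1 t).+1 end.
pose a' (t : J + J) : 'rV[R]_d -> R[i] := match t with
  | inl t => fun x => 'i%C * cpd [:: i] psi x * a1 t x
  | inr t => cpd [:: i] (a1 t) end.
exists (J + J)%type, e', a'; split => [[t|t]|k y x y0 Ux] /=.
- apply: (csmoothM oU) => //; apply: (csmoothM oU); first exact: csmooth_cst.
  exact: csmooth_on_cpd.
- exact: csmooth_on_cpd.
rewrite cpd_cons.
have cp : cdiff psi x := csmooth_cdiff spsi Ux.
have ca t : cdiff (a1 t) x := csmooth_cdiff (sa1 t) Ux.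
have cya t : cdiff (fun z => y ^+ e1 t * a1 t z) x.
  by apply: cdiffM => //; exact: cdiff_cst.
have [sE sD] := @cpd_sum R d _ (index_enum J) xpredT
  (fun t z => y ^+ e1 t * a1 t z) i x (fun t _ => cya t).
have cip : cdiff (fun z => 'i%C / y * psi z) x.
  by apply: cdiffM => //; exact: cdiff_cst.
have ce : cdiff (fun z => cexp ('i%C / y * psi z)) x.
  have := csmooth_cexp oU (csmoothM oU (csmooth_cst oU ('i%C / y)) spsi).
  by move=> s; exact: csmooth_cdiff s Ux.
transitivity (cpd [:: i] (fun z => (k * y^-1 ^+ size l) *
    (cexp ('i%C / y * psi z) * \sum_t y ^+ e1 t * a1 t z)) x).
  by apply: (eq_cpd _ oU Ux) => z Uz; exact: E1.
rewrite cpdZ; last exact: cdiffM.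
rewrite (cpdM i ce sD) (cpd_cexp i cip) (cpdZ _ i cp) sE big_sumType /=.
have -> : \sum_t cpd [:: i] (fun z => y ^+ e1 t * a1 t z) x =
    \sum_t y ^+ e1 t * cpd [:: i] (a1 t) x.
  by apply: eq_bigr => t _; rewrite cpdZ.
have -> : \sum_t y ^+ e1 t * ('i%C * cpd [:: i] psi x * a1 t x) =
    'i%C * cpd [:: i] psi x * \sum_t y ^+ e1 t * a1 t x.
  by rewrite mulr_sumr; apply: eq_bigr => t _; rewrite mulrCA.
have -> : \sum_t y ^+ (e1 t).+1 * cpd [:: i] (a1 t) x =
    y * \sum_t y ^+ e1 t * cpd [:: i] (a1 t) x.
  by rewrite mulr_sumr; apply: eq_bigr => t _; rewrite exprS mulrA.
rewrite exprS.
move: (\sum_t _) (\sum_t _) (cexp _) (cpd _ _ _) (y^-1 ^+ _) => S1 S2 E D Y.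
by field.
Qed.

End oscillating_derivatives.

Lemma compact_image_bounded (R : realType) (X : topologicalType) (A : set X)
    (f : X -> R) : compact A -> (forall x, A x -> {for x, continuous f}) ->
  exists2 D, 0 <= D & forall x, A x -> `|f x| <= D.
Proof.
move=> cA cf; have cfA : {within A, continuous f}.
  by apply: continuous_in_subspaceT => x; rewrite inE; exact: cf.
have [D [_ /(_ (`|D| + 1))]] := compact_bounded (continuous_compact cfA cA).
rewrite ltr_pwDr ?ler_norm // => /(_ isT) DP; exists (`|D| + 1).
  exact: addr_ge0.
by move=> x Ax; apply: DP; exists x.
Qed.

(** * Sobolev norm of the remainder *)

Section sobolev.
Context {R : realType} {n : nat} {M : manifold R n}.
Implicit Types (c : chart R n.+1 (spacetime M)) (u Phi : spacetime M -> R[i]).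

Lemma compact_cmap c (A : set (spacetime M)) : is_chart c -> compact A ->
  A `<=` cdom c -> compact (cmap c @` A).
Proof.
move=> [_ _ _ cc _] cA Ac; apply: continuous_compact cA.
by apply: continuous_in_subspaceT => x; rewrite inE => /Ac; exact: cc.
Qed.

Lemma csmooth_compact_bounded d (U A : set 'rV[R]_d) (f : 'rV[R]_d -> R[i]) :
  compact A -> A `<=` U -> csmooth_on U f ->
  exists2 D, 0 <= D & forall x, A x -> cabs1 (f x) <= D.
Proof.
move=> cA AU [rf if_].
have [|D1 D10 D1P] := @compact_image_bounded R _ A (fun x => complex.Re (f x)) cA.
  by move=> x /AU Ux; exact/differentiable_continuous/(smooth_on_diff rf Ux).
have [|D2 D20 D2P] := @compact_image_bounded R _ A (fun x => complex.Im (f x)) cA.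
  by move=> x /AU Ux; exact/differentiable_continuous/(smooth_on_diff if_ Ux).
exists (D1 + D2); first exact: addr_ge0.
by move=> x Ax; apply: lerD; [exact: D1P|exact: D2P].
Qed.

Lemma size_mindex_seq d k (alpha : {ffun 'I_d -> 'I_k.+1}) :
  size (mindex_seq alpha) = (\sum_i alpha i)%N.
Proof.
rewrite size_flatten /shape -map_comp sumnE big_map big_enum /=.
by apply: eq_bigr => i _; rewrite size_nseq.
Qed.

(** Compactness makes the local bounds on the indices uniform, so the Sobolev series of a function
    supported in [A] is a finite sum. *)
Lemma sobolev_atlas_finite (P : sobolev_atlas M) (A : set (spacetime M)) :
  compact A -> exists m, forall i p, (m <= i)%N -> A p -> sob_cut P i p = 0.
Proof.
move=> /compact_near_coveringP cA.
have [] := cA nat \oo (fun m p => forall i, (m <= i)%N -> sob_cut P i p = 0) _ _.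
  move=> p _; have [m mP] := sob_cut_locfin P p.
  exists ([set p' | forall i, (m <= i)%N -> sob_cut P i p' = 0], [set k | (m <= k)%N]).
    by split => //; exists m.
  by move=> [p' k] /= [p'P mk] i ki; apply: p'P; exact: leq_trans mk ki.
by move=> m _ /(_ m) mP; exists m => i p mi Ap; apply: (mP _ p) => //=.
Qed.

Lemma pd0 d (l : seq 'I_d) (x : 'rV[R]_d) : pd l (fun=> 0) x = 0.
Proof.
elim: l x => [//|i l IH] x.
have E : pd l (fun=> 0) = (fun=> 0) :> ('rV[R]_d -> R) by apply/funext.
rewrite -[LHS]/(pd [:: i] (pd l (fun=> 0)) x) E; exact: pd_cst.
Qed.

Lemma cpd0 d (l : seq 'I_d) (x : 'rV[R]_d) : cpd l (fun=> 0) x = 0.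
Proof. by apply: complexE; exact: pd0. Qed.

(** As [h < 1], losing [kappa] derivatives instead of [s] and dropping two powers of [h] only
    enlarges the bound. The exponent may be negative, hence the integer power. *)
Lemma expr_int_le (h : R) (L s kappa : nat) : 0 < h < 1 -> (s <= kappa)%N ->
  h ^+ (L + 3) * h^-1 ^+ s <= h ^ (L%:Z - kappa%:Z + 1).
Proof.
move=> /andP[h0 h1] sk; have hN0 : h != 0 by rewrite gt_eqF.
have -> : h ^ (L%:Z - kappa%:Z + 1) = h ^+ (L + 1) * h^-1 ^+ kappa.
  by rewrite addrAC expfzDr // -exprnN -PoszD exprVn.
have -> : h^-1 ^+ kappa = h^-1 ^+ s * h^-1 ^+ (kappa - s) by rewrite -exprD subnKC.
rewrite mulrA [X in _ <= X]mulrAC ler_pM2r ?exprn_gt0 ?invr_gt0 //.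
apply: (@le_trans _ _ (h ^+ (L + 1))).
  by rewrite ler_wiXn2l ?ltW // leq_add2l.
apply: ler_peMr; first by rewrite exprn_ge0 // ltW.
by apply: exprn_ege1; rewrite invf_ge1 // ltW.
Qed.

Section remainder.
Context (N0 : set (spacetime M)) (cN0 : compact N0) (Phi : spacetime M -> R[i]).
Context (sPhi : csmooth Phi) (Phi0 : forall p, N0 p -> 0 <= complex.Im (Phi p)).
Context (L : nat) (A B : spacetime M -> R[i]).
Context (sA : csmooth0_in N0 A) (sB : csmooth0_in N0 B).

Definition remainder (h : R) p : R[i] :=
  osc Phi h p * (h%:C%C ^+ (L + 3) * A p + h%:C%C ^+ (L + 4) * B p).

(** The differentiated function is supported in a fixed compact set of coordinates, where the
    exponential is bounded by 1 and the amplitudes are bounded uniformly in [h]. The power of [h] is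
    squared because the density is a squared modulus. *)
Lemma sobolev_term_bound (P : sobolev_atlas M) T i k (alpha : {ffun 'I_n.+1 -> 'I_k.+1}) :
  (\sum_j alpha j <= k)%N ->
  exists2 D, 0 <= D & forall h, 0 < h < 1 ->
    (0 <= iint (fun x : 'rV[R]_n.+1 => (sob_density P T (remainder h) i alpha x)%:E) <=
     (D * (h ^ (L%:Z - k%:Z + 1)) ^+ 2)%:E)%E.
Proof.
move=> ak; set c := sob_chart P i; have sc : smooth_chart c := sob_chart_smooth P i.
have ic : is_chart c := sc.1; have oc := open_crange ic.
have [S cS [Sc S0]] := sob_cut_supp P i.
pose rho : spacetime M -> R := sob_cut P i.
have srho : csmooth (fun p => (rho p)%:C%C) := sob_cut_smooth P i.
have cN0' := spacetime_compact_closed cN0; have cS' := spacetime_compact_closed cS.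
have cSN : compact (S `&` N0).
  by apply: (subclosed_compact _ cS); [exact: closedI|move=> p []].
(* Contains the support of the localized remainder, in coordinates. *)
pose Kx := cmap c @` (S `&` N0).
have cKx : compact Kx by apply: compact_cmap => // p [/Sc].
have KxU : Kx `<=` crange c by move=> x [p [/Sc dp _] <-]; exact: crange_cmap.
pose psi x := Phi (cinv c x).
have spsi : csmooth_on (crange c) psi by exact: csmooth_chart.
pose a (t : bool) x : R[i] :=
  if t then (rho (cinv c x))%:C%C * A (cinv c x) else (rho (cinv c x))%:C%C * B (cinv c x).
have sa t : csmooth_on (crange c) (a t).
  by case: t; apply: csmoothM => //; [exact: (csmooth_chart sc srho)
    |exact: (csmooth_chart sc sA.1)|exact: (csmooth_chart sc srho)
    |exact: (csmooth_chart sc sB.1)].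
pose e (t : bool) : nat := if t then 0%N else 1%N.
have [J [e' [a' [sa' aE]]]] := cexp_family_cpd (mindex_seq alpha) e oc spsi sa.
have Da t := csmooth_compact_bounded cKx KxU (sa' t).
(* Sum of the bounds of the amplitudes on [Kx]; their weights [h ^+ e' t] are at most 1. *)
pose D := \sum_t sval (cid2 (Da t)).
have D0 : 0 <= D.
  by apply: sumr_ge0 => t _; case: (cid2 (Da t)).
have [r r0 rP] : exists2 r : R, 0 < r & forall x, Kx x -> forall b, `|x 0 b| <= r.
  have [r [_ /(_ (`|r| + 1))]] := compact_bounded cKx.
  rewrite ltr_pwDr ?ler_norm // => /(_ isT) rP; exists (`|r| + 1).
    by rewrite ltr_wpDl.
  move=> x /rP xr b; apply: le_trans xr.
  rewrite [leRHS]/Num.Def.normr /= mx_normrE.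
  exact: (le_bigmax _ (fun j : 'I_1 * 'I_n.+1 => `|x j.1 j.2|) (ord0, b)).
(* The factor 2 is the bound of |cos| + |sin| in [cabs1_cexp]; the last factor is the volume of the
   cube of side [r *+ 2]. *)
exists ((D *+ 2) ^+ 2 * (r *+ 2) ^+ n.+1).
  by rewrite mulr_ge0 ?exprn_ge0 ?mulrn_wge0 // ltW.
move=> h h01; have /andP[h0 h1] := h01.
have hC0 : h%:C%C != 0 :> R[i] by rewrite fmorph_eq0 gt_eqF.
set Eh := h ^ _; have Eh0 : 0 < Eh by rewrite exprz_gt0.
set w := cpd (mindex_seq alpha) (fun y => (rho (cinv c y))%:C%C * remainder h (cinv c y)).
have wE x : crange c x -> w x = (h ^+ (L + 3) * h^-1 ^+ size (mindex_seq alpha))%:C%C *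
    (cexp ('i%C / h%:C%C * psi x) * \sum_t h%:C%C ^+ e' t * a' t x).
  move=> rx; rewrite rmorphM !rmorphXn fmorphV /= -(aE _ _ _ hC0 rx).
  congr (cpd _ _ x); apply/funext => y; rewrite big_bool /remainder oscE /=.
  by rewrite expr0 mul1r !addnS addn0 !exprS; ring.
(* Off [Kx] the localized remainder vanishes on a neighbourhood, hence so do all its derivatives. *)
have w0 x : crange c x -> ~ Kx x -> w x = 0.
  move=> rx nKx; rewrite -(cpd0 (mindex_seq alpha) x); apply: cpd_near_eq.
  have [dx xE] := chart_cinvK ic rx.
  have nSN : \forall p \near cinv c x, ~ (S `&` N0) p.
    apply: open_nbhs_nbhs; split; first by apply: closed_openC; exact: closedI.
    by move=> SNx; apply: nKx; exists (cinv c x).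
  have := near_cinv ic dx nSN; rewrite xE; apply: filterS => y nSNy.
  have [Sy|nSy] := pselect (S (cinv c y)); last by rewrite /rho S0 ?mul0r.
  have nN : ~ N0 (cinv c y) by move=> Ny; exact: nSNy.
  have [[_ A0] [_ B0]] := (sA, sB).
  by rewrite /remainder A0 // B0 // !mulr0 addr0 !mulr0.
have wB x : crange c x -> cabs1 (w x) <= D *+ 2 * Eh.
  move=> rx; have [Kxx|/w0-> //] := pselect (Kx x); last first.
    by rewrite /cabs1 /= normr0 addr0 mulr_ge0 ?mulrn_wge0 // ltW.
  rewrite wE // cabs1_real ger0_norm; last first.
    by rewrite mulr_ge0 // exprn_ge0 ?invr_ge0 // ltW.
  rewrite [X in _ <= X]mulrC; apply: ler_pM.
  - by rewrite mulr_ge0 // exprn_ge0 ?invr_ge0 // ltW.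
  - exact: cabs1_ge0.
  - by apply: expr_int_le => //; rewrite size_mindex_seq.
  apply: le_trans (cabs1M _ _) _; rewrite mulr2n -[D]mul1r -mulrDl.
  apply: ler_pM; [exact: cabs1_ge0|exact: cabs1_ge0| |].
    (* The real part of i Phi / h is -Im Phi / h, which is nonpositive on [N0]. *)
    apply: le_trans (cabs1_cexp _) _; rewrite -[X in _ <= X]/(1 *+ 2).
    rewrite lerMn2r /= -[X in _ <= X]expR0 ler_expR -fmorphV cReM /=.
    have [p [Sp Np] <-] := Kxx; rewrite /psi (chart_cmapK ic (Sc _ Sp)).
    rewrite !(mul0r, mulr0, addr0, mul1r, oppr0) sub0r oppr_le0.
    by apply: mulr_ge0; [rewrite add0r invr_ge0 ltW|exact: Phi0].
  apply: le_trans (cabs1_sum _) _; apply: ler_sum => t _.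
  case: (cid2 (Da t)) => Dt /= Dt0 DtP; apply: le_trans (DtP x Kxx).
  have he0 : 0 <= h ^+ e' t by rewrite exprn_ge0 // ltW.
  rewrite -rmorphXn cabs1_real ler_piMl ?cabs1_ge0 // (ger0_norm he0).
  by apply: exprn_ile1; rewrite ltW.
have -> : (D *+ 2) ^+ 2 * (r *+ 2) ^+ n.+1 * Eh ^+ 2 =
    (D *+ 2 * Eh) ^+ 2 * (r *+ 2) ^+ n.+1 by rewrite exprMn mulrAC.
apply: iint_box_bound => //; first exact: sqr_ge0.
- move=> x; rewrite !lee_fin /sob_density -/c -/rho -/w indicE.
  have [/set_mem [p [dp _] xp]|_] := boolP (x \in _); last first.
    by rewrite mul0r lexx sqr_ge0.
  rewrite mul1r; apply/andP; split; first by rewrite addr_ge0 ?sqr_ge0.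
  apply: le_trans (sqr_le_cabs1 _) _.
  have rx : crange c x by rewrite -xp; exact: crange_cmap.
  rewrite ler_pXn2r ?nnegrE ?cabs1_ge0 //.
    exact: wB.
  by rewrite mulr_ge0 ?mulrn_wge0 // ltW.
- move=> x [b rb]; rewrite /sob_density -/c -/rho -/w indicE.
  have [/set_mem [p [dp _] xp]|_] := boolP (x \in _); last by rewrite mul0r.
  have rx : crange c x by rewrite -xp; exact: crange_cmap.
  rewrite w0 ?expr0n ?addr0 ?mulr0 // => /rP/(_ b).
  by rewrite leNgt rb.
Qed.

Lemma sobolev_remainder (P : sobolev_atlas M) T kappa :
  exists2 C : R, 0 < C & forall h, 0 < h < 1 ->
    (sobolev_norm P T kappa (remainder h) <= (C * h ^ (L%:Z - kappa%:Z + 1))%:E)%E.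
Proof.
have [m mP] := sobolev_atlas_finite P cN0.
pose term h i (alpha : {ffun 'I_n.+1 -> 'I_kappa.+1}) : \bar R :=
  iint (fun x : 'rV[R]_n.+1 => (sob_density P T (remainder h) i alpha x)%:E).
pose E (h : R) := h ^ (L%:Z - kappa%:Z + 1).
have term0 h i alpha : (m <= i)%N -> term h i alpha = 0%E.
  move=> mi; have z x : (sob_density P T (remainder h) i alpha x)%:E = 0%E.
    rewrite /sob_density.
    have -> : (fun y => (sob_cut P i (cinv (sob_chart P i) y))%:C%C *
        remainder h (cinv (sob_chart P i) y)) = fun=> 0.
      apply/funext => y; set p := cinv _ y.
      have [Np|nNp] := pselect (N0 p); first by rewrite mP // mul0r.
      have [[_ A0] [_ B0]] := (sA, sB).
      by rewrite /remainder A0 // B0 // !mulr0 addr0 !mulr0.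
    by rewrite cpd0 expr0n addr0 mulr0.
  have z0 x : (0 <= (sob_density P T (remainder h) i alpha x)%:E <= 0%:E)%E.
    by rewrite z lexx.
  have := iint_box_bound (lexx 0) ltr01 z0 (fun x _ => z x).
  by rewrite mul0r => tB; apply/eqP; rewrite eq_le andbC.
have /choice[D DP] : forall j : nat * {ffun 'I_n.+1 -> 'I_kappa.+1}, exists D : R,
    0 <= D /\ ((\sum_l j.2 l <= kappa)%N -> forall h, 0 < h < 1 ->
      (0 <= term h j.1 j.2 <= (D * E h ^+ 2)%:E)%E).
  move=> [i alpha] /=.
  (* Multi-indices of order above [kappa] do not enter the norm and get the constant 0. *)
  have [ak|nak] := boolP (\sum_l alpha l <= kappa)%N; last by exists 0.
  by have [D D0 DP] := sobolev_term_bound P T i ak; exists D; split => // _.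
pose S := \sum_(0 <= i < m) \sum_(alpha : {ffun 'I_n.+1 -> 'I_kappa.+1} |
  (\sum_l alpha l <= kappa)%N) D (i, alpha).
have S0 : 0 <= S by do 2 (apply: sumr_ge0 => ? _); exact: (DP _).1.
(* The summand 1 makes the constant strictly positive. *)
exists (Num.sqrt S + 1); first by rewrite ltr_wpDl // sqrtr_ge0.
move=> h h01; have /andP[h0 _] := h01.
have E0 : 0 <= E h by rewrite exprz_ge0 // ltW.
pose U i := (\sum_(alpha : {ffun 'I_n.+1 -> 'I_kappa.+1} |
  (\sum_l alpha l <= kappa)%N) term h i alpha)%E.
have U0 i : (0 <= U i)%E.
  by apply: sume_ge0 => alpha ak; have /andP[] := (DP (i, alpha)).2 ak h h01.
have -> : sobolev_norm P T kappa (remainder h) = ((\sum_(0 <= i <oo) U i) `^ 2^-1)%E.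
  by [].
have US : (\sum_(0 <= i <oo) U i <= (S * E h ^+ 2)%:E)%E.
  rewrite (nneseries_split 0 m) // [X in (_ + X)%E]eseries0 ?adde0 ?add0n; last first.
    by move=> i mi _; apply: big1 => alpha _; exact: term0.
  rewrite /S mulr_suml -sumEFin; apply: lee_sum => i _.
  rewrite mulr_suml -sumEFin; apply: lee_sum => alpha ak.
  by have /andP[] := (DP (i, alpha)).2 ak h h01.
have SE0 : 0 <= S * E h ^+ 2 by rewrite mulr_ge0 ?sqr_ge0.
have V0 : (0 <= \sum_(0 <= i <oo) U i)%E by exact: nneseries_ge0.
apply: (@le_trans _ _ ((S * E h ^+ 2)%:E `^ 2^-1)%E).
  by apply: gt0_ler_poweR; rewrite ?invr_ge0 // in_itv /= ?V0 ?lee_fin ?SE0 leey.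
rewrite poweR_EFin powR12_sqrt // sqrtrM // sqrtr_sqr (ger0_norm E0) lee_fin.
by rewrite mulrDl lerDl mul1r.
Qed.

End remainder.

End sobolev.

(** * Assembly of the approximate solution *)

Lemma ball_cutoff_eq0 (R : realType) (n : nat) (M : manifold R n)
    (p0 : spacetime M) (N0 : set (spacetime M)) (chi : spacetime M -> R) p :
  ball_cutoff p0 N0 chi -> ~ N0 p -> chi p = 0.
Proof.
move=> [_ [c [r [_ _ _ [_ BN] chiB]]]] nNp; apply/eqP/negPn/negP => /chiB Bp.
exact/nNp/BN.
Qed.

Lemma gaussian_beam_Im_ge0 (R : realType) (n : nat) (M : manifold R n)
    (g : lorentz_metric M) Q K (b : beam M) p :
  gaussian_beam g Q K b -> beam_tube b p -> 0 <= complex.Im (beam_phase b p).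
Proof.
move=> [_ _ _ [_ [C C0 CP]] _] bp; apply: le_trans (CP p bp).
by rewrite mulr_ge0 ?sqr_ge0 // ltW.
Qed.

Theorem lemma3p6 (R : realType) (n : nat) (hn : (1 <= n)%N) (M : manifold R n)
    (g : lorentz_metric M) (hg : globally_hyperbolic g) (T : R) (hT : 0 < T)
    (Q q : spacetime M -> R[i]) (hQ : csmooth Q) (hq : csmooth q) (K : nat)
    (p0 : spacetime M) (N0 : set (spacetime M))
    (bi bj bk : beam M)
    (hbi : gaussian_beam g Q K bi) (hbj : gaussian_beam g Q K bj)
    (hbk : gaussian_beam g Q K bk)
    (hpi : beam_trace bi p0) (hpj : beam_trace bj p0) (hpk : beam_trace bk p0)
    (hij : beam_trace bi <> beam_trace bj)
    (hik : beam_trace bi <> beam_trace bk)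
    (hjk : beam_trace bj <> beam_trace bk)
    (hN0 : compact N0) (hN0p : nbhs p0 N0)
    (hN0i : N0 `<=` beam_tube bi) (hN0j : N0 `<=` beam_tube bj)
    (hN0k : N0 `<=` beam_tube bk)
    (chiB : spacetime M -> R) (hchiB : ball_cutoff p0 N0 chiB)
    (hPij : forall p, N0 p -> gradp g (phase2 bi bj) (phase2 bi bj) p != 0)
    (hPik : forall p, N0 p -> gradp g (phase2 bi bk) (phase2 bi bk) p != 0)
    (hPjk : forall p, N0 p -> gradp g (phase2 bj bk) (phase2 bj bk) p != 0)
    (hP : forall p, N0 p ->
       gradp g (phase3 bi bj bk) (phase3 bi bj bk) p != 0) :
  let Phi := phase3 bi bj bk in
  let F := source3 g Q q K chiB bi bj bk in
  let beta := beta_coef g Q q K chiB bi bj bk in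
  (forall h p, 0 < h < 1 ->
     F h p = osc Phi h p *
       \sum_(2 <= m < (3 * K + 2).+1) q p * beta m p * h%:C%C ^+ m) /\
  (forall m, (2 <= m <= 3 * K + 2)%N -> csmooth0_in N0 (beta m)) /\
  exists (omega r : R -> spacetime M -> R[i])
         (theta : nat -> spacetime M -> R[i]),
    [/\ forall h, 0 < h < 1 ->
          [/\ csmooth (omega h),
              forall p, slab T p -> wave_op g Q (omega h) p = F h p + r h p,
              forall p, slab T p ->
                omega h p = osc Phi h p *
                  \sum_(4 <= l < (3 * K + 4).+1) theta l p * h%:C%C ^+ l &
              csmooth0_in N0 (r h)],
        theta 2%N = (fun _ => 0) /\ theta 3%N = (fun _ => 0),
        forall l p, (4 <= l <= 3 * K + 4)%N ->
          theta l p = formal_step g Q Phi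
            (fun p => q p * beta (l - 2)%N p) (theta (l - 2)%N)
            (theta (l - 1)%N) p,
        forall l, (4 <= l <= 3 * K + 4)%N -> csmooth0_in N0 (theta l) &
        forall (P : sobolev_atlas M) (kappa : nat),
          exists2 C : R, 0 < C & forall h, 0 < h < 1 ->
            (sobolev_norm P T kappa (r h) <=
             (C * h ^ ((3 * K)%:Z - kappa%:Z + 1))%:E)%E].
Proof.
move=> Phi F beta.
have cN0 := spacetime_compact_closed hN0.
have [schi chi0] : rsmooth chiB /\ forall p, ~ N0 p -> chiB p = 0.
  by split => [|p]; [have [] := hchiB|exact: ball_cutoff_eq0 hchiB].
have si := gaussian_beam_smooth hbi; have sj := gaussian_beam_smooth hbj.
have sk := gaussian_beam_smooth hbk.
have sPhi : csmooth Phi := csmooth_phase3 si sj sk.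
(* On [N0], inside all three tubes, each imaginary part is bounded below by a multiple of a squared
   distance to the axis. *)
have Phi0 p : N0 p -> 0 <= complex.Im (Phi p).
  move=> Np; rewrite /Phi /phase3 !cImD.
  by rewrite !addr_ge0 //; [apply: gaussian_beam_Im_ge0 hbi (hN0i _ Np)|
    apply: gaussian_beam_Im_ge0 hbj (hN0j _ Np)|
    apply: gaussian_beam_Im_ge0 hbk (hN0k _ Np)].
have sbeta m : csmooth0_in N0 (beta m) by exact: csmooth0_beta_coef.
(* Shifted so that the source coefficients, which start at [beta 2], are indexed from 0. *)
pose src k p := q p * beta k.+2 p.
have ssrc k : csmooth0_in N0 (src k) by exact: csmooth0Ml.
pose c := formal_coef g Q Phi src.
have sc m : csmooth0_in N0 (c m) by exact: csmooth0_formal_coef.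
have FE h p : F h p = osc Phi h p *
    \sum_(2 <= m < (3 * K + 2).+1) q p * beta m p * h%:C%C ^+ m by exact: source3E.
(* The two zero initial values [c 0] and [c 1] become [theta 2] and [theta 3]. *)
pose theta l := c (l - 2)%N.
pose omega h p := osc Phi h p *
  \sum_(4 <= l < (3 * K + 4).+1) theta l p * h%:C%C ^+ l.
(* [A] and [B] are the uncancelled coefficients of h^(3K+3) and h^(3K+4), left by the telescoping at
   [N = 3 * K]. *)
pose A p := transport_part g Phi (c (3 * K).+2) p + wave_op g Q (c (3 * K).+1) p.
pose B := wave_op g Q (c (3 * K).+2).
have sB : csmooth0_in N0 B by exact: csmooth0_wave_op.
have sA : csmooth0_in N0 A.
  apply: csmooth0D; last exact: csmooth0_wave_op.
  apply: csmooth0B.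
    by apply: csmooth0Ml (sc _); apply: csmM; [exact: csm_cst|exact: csmooth_box].
  by apply: csmooth0Ml; [exact: csm_cst|exact: csmooth0_gradp].
have somega h : csmooth (omega h).
  apply: csmM; first exact: csmooth_osc.
  apply: csm_sum => l _; apply: csmM; last exact: csm_cst.
  by have [] := sc (l - 2)%N.
have omegaE h : omega h = fun p => osc Phi h p *
    \sum_(0 <= k < (3 * K).+1) c k.+2 p * h%:C%C ^+ k.+4.
  apply/funext => p; congr (_ * _).
  rewrite -[in LHS](add0n 4%N) big_addn -addSn addnK; apply: eq_bigr => k _.
  by rewrite /theta addn4.
have srcE h p : \sum_(2 <= m < (3 * K + 2).+1) q p * beta m p * h%:C%C ^+ m =
    \sum_(0 <= k < (3 * K).+1) src k p * h%:C%C ^+ k.+2.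
  rewrite -[in LHS](add0n 2%N) big_addn -addSn addnK; apply: eq_bigr => k _.
  by rewrite addn2.
split; first by move=> h p _; exact: FE.
split; first by move=> m _; exact: sbeta.
exists omega, (remainder Phi (3 * K) A B), theta; split.
- move=> h h01; have h0 : h != 0 by have /andP[h0 _] := h01; rewrite gt_eqF.
  split => //.
    move=> p _; rewrite omegaE FE srcE /remainder addn3 addn4.
    exact: wave_op_formal_series h0 cN0 hQ sPhi hP ssrc.
  by apply: csmooth0Ml; [exact: csmooth_osc|apply: csmooth0D;
    apply: csmooth0Ml => //; exact: csm_cst].
- by [].
- move=> l p /andP[l4 _]; rewrite /theta.
  (* The bound [4 <= l] makes these truncated subtractions exact. *)
  have -> : (l - 2 = (l - 4).+2)%N by rewrite -!subSn // ltnW // ltnW.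
  have -> : (l - 1 - 2 = (l - 4).+1)%N.
    by rewrite -subnDA -subSn.
  have -> : ((l - 4).+2 - 2 = l - 4)%N by rewrite subSS subSS subn0.
  by rewrite /c formal_coefSS.
- by move=> l _; exact: sc.
- by move=> P kappa; exact: (sobolev_remainder hN0 sPhi Phi0 (3 * K) sA sB P T kappa).
Qed.
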